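(* Let $\Delta>0$. For every $G\in\{\mathrm U,\mathrm{Sp},\mathrm O,\mathrm{SO(even)},\mathrm{SO(odd)}\}$, $$\lim_{|\alpha|\to\infty}\mathbb A(G,\pi\Delta,\alpha)=\mathbb A(\mathrm U,\pi\Delta,0)=\frac{1}{4\Delta^2}.$$
   Context: $\mathcal H_{\pi\Delta}$ is the set of entire functions of exponential type at most $\pi\Delta$ whose restriction to $\mathbb R$ is square-integrable. Densities: $W_{\mathrm U}(x)=1$; $W_{\mathrm{Sp}}(x)=1-\frac{\sin2\pi x}{2\pi x}$; $W_{\mathrm O}(x)=1+\tfrac12\boldsymbol\delta_0(x)$; $W_{\mathrm{SO(even)}}(x)=1+\frac{\sin2\pi x}{2\pi x}$; $W_{\mathrm{SO(odd)}}(x)=1-\frac{\sin2\pi x}{2\pi x}+\boldsymbol\delta_0(x)$, with $\boldsymbol\delta_0$ the Dirac delta at $0$. For $\alpha\in\mathbb R$, $$\mathbb A(G,\pi\Delta,\alpha):=\inf_{0\ne f\in\mathcal H_{\pi\Delta}}\frac{\int_{\mathbb R}|(x-\alpha)f(x)|^2\,W_G(x)\,\mathrm dx}{\int_{\mathbb R}|f(x)|^2\,W_G(x)\,\mathrm dx}.$$ *)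

(* Defs.v *)
From HB Require Import structures.
From mathcomp Require Import all_boot all_order all_algebra.
From mathcomp Require Import complex.
From mathcomp Require Import all_classical all_reals all_analysis.
Import Order.TTheory GRing.Theory Num.Theory.
Import numFieldNormedType.Exports.

Set Implicit Arguments.
Unset Strict Implicit.
Unset Printing Implicit Defensive.

Local Open Scope classical_set_scope.
Local Open Scope ring_scope.
Local Open Scope complex_scope.

(* R-valued modulus; `|z| in R[i] is R[i]-valued. *)
Definition cmod (R : realType) (z : R[i]) : R := complex.Re `|z|.

(* R[i]^o is normed over R[i], so the difference quotient has complex steps:
   this is complex differentiability at every point. *)
Definition entire (R : realType) (f : R[i] -> R[i]) : Prop :=
  forall z : R[i], derivable (f : R[i]^o -> R[i]^o) z 1.

(* limsup_(|z| -> oo) ln |f z| / |z| <= tau *)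
Definition exp_type_le (R : realType) (tau : R) (f : R[i] -> R[i]) : Prop :=
  forall eps : R, 0 < eps ->
    exists C : R, forall z, cmod (f z) <= C * expR ((tau + eps) * cmod z).

Definition paley_wiener (R : realType) (tau : R) : set (R[i] -> R[i]) :=
  [set f | [/\ entire f, exp_type_le tau f &
    (@lebesgue_measure R).-integrable setT
      (fun x : R => (cmod (f x%:C) ^+ 2)%:E)]].

Inductive symmetry_group : Set := GU | GSp | GO | GSOeven | GSOodd.

(* sin (2 pi x) / (2 pi x), continuously extended at 0 *)
Definition sinc2pi (R : realType) (x : R) : R :=
  if x == 0 then 1 else sin (2 * pi * x) / (2 * pi * x).

(* W_G = W_ac G + W_atom G * delta_0 *)
Definition W_ac (R : realType) (G : symmetry_group) (x : R) : R :=
  match G with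
  | GU | GO => 1
  | GSp | GSOodd => 1 - sinc2pi x
  | GSOeven => 1 + sinc2pi x
  end.

Definition W_atom (R : realType) (G : symmetry_group) : R :=
  match G with
  | GU | GSp | GSOeven => 0
  | GO => 2^-1
  | GSOodd => 1
  end.

Definition W_integral (R : realType) (G : symmetry_group) (g : R -> R)
    : \bar R :=
  (\int[@lebesgue_measure R]_x (g x * W_ac G x)%:E
   + (W_atom R G)%:E * \int[\d_(0%R : measurableTypeR R)]_x (g x)%:E)%E.

(* For f <> 0 in the space the denominator is positive and finite; the numerator
   may be +oo, in which case the quotient is +oo. *)
Definition bbA (R : realType) (G : symmetry_group) (tau alpha : R) : \bar R :=
  ereal_inf
    [set (W_integral G (fun x => cmod ((x - alpha)%:C * f x%:C) ^+ 2)%R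
          / W_integral G (fun x => cmod (f x%:C) ^+ 2)%R)%E
    | f in [set f | paley_wiener tau f /\ f <> cst 0]].

(* the filter |alpha| -> oo *)
Definition abs_infty (R : realType) : set_system R :=
  filter_from [set: R] (fun M => [set alpha : R | M < `|alpha|]).
Arguments abs_infty : clear implicits.

#[global] Instance abs_infty_proper (R : realType) : ProperFilter (abs_infty R).
Proof.
apply: filter_from_proper; last first.
  by move=> M _; exists (`|M| + 1); rewrite /= ger0_norm ?addr_ge0//
    (le_lt_trans (ler_norm M))// ltrDl.
apply: filter_from_filter; first by exists 0.
move=> M N _ _; exists (Num.max M N) => // x /=.
by rewrite gt_max => /andP[].
Qed.

(* Main.v *)
(** For real [t] with [|t| > 2 pi Delta] and [f] in the space, [int |f|^2 cos (t x + psi) dx = 0]: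
    the entire function [f(z) conj(f(conj z))] has type at most [2 pi Delta], so by
    Cauchy's theorem the two half-lines can be rotated onto the imaginary axis, where
    their contributions cancel.  Hence [int |f|^2 = int |f|^2 p] for every Fejer kernel
    [p] of period slightly smaller than [1 / Delta].  Centring [p] half a period away from
    [alpha] and letting it concentrate gives
    [int ((x - alpha)^2 - l^2) |f|^2 >= 0] for every [l < 1 / (2 Delta)], with
    (near-)equality for the translates of [cos (pi Delta x) / (1 - 4 Delta^2 x^2)].
    For the other groups the weight tends to [1] at infinity.  Translates to [alpha] of the
    extremal function give the upper bound.  For the lower bound one multiplies [f] by
    a wide cutoff [sinc (th (x - alpha))], which raises the type by [th] only: what happens
    near the origin, where the weight differs from [1], becomes negligible because
    [f] is [(x - alpha) f] divided by the large number [x - alpha]. *)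

Require Import Defs.
From HB Require Import structures.
From mathcomp Require Import all_boot all_order all_algebra.
From mathcomp Require Import complex ring lra.
From mathcomp Require Import all_classical all_reals all_analysis.
From mathcomp Require Import measurable_realfun.
Import Order.TTheory GRing.Theory Num.Theory.
Import numFieldNormedType.Exports.

Local Open Scope classical_set_scope.
Local Open Scope ring_scope.
Local Open Scope complex_scope.

Set Implicit Arguments.
Unset Strict Implicit.
Unset Printing Implicit Defensive.

(** * Complex numbers and entire functions *)

Section Complex.
Context {R : realType}.
Implicit Types (x y a b : R) (z w : R[i]) (f g : R[i] -> R[i]).

Notation Re := (@complex.Re R).
Notation Im := (@complex.Im R).

(** No Fourier transform is used: the band limit enters only through the vanishing cosine integrals.
    There the ray cannot be rotated directly, since close to the real axis e^(itz) does not beat the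
    growth of the entire function. In the coordinate log x sectors become rectangles, so Goursat's
    theorem for rectangles suffices. The same coordinate turns circles into segments and yields the
    mean value property, hence that a nonzero f in the space is nonzero somewhere on the real line:
    this is why the denominators are positive.

    The weights of Sp and SO(odd) vanish at 0, so |f|^2 W controls |f|^2 pointwise only away from 0.
    After integration it does so globally, because a cosine of frequency above 2 pi Delta has mean 0
    against |f|^2 and can be used to correct the weight near 0.

    The atom at 0 contributes alpha^2 |f(0)|^2 above and |f(0)|^2 below. This favours the lower
    bound once |alpha| is large, and for the translated extremal function both terms tend to 0. *)

Lemma cmodE z : cmod z = Num.sqrt (Re z ^+ 2 + Im z ^+ 2).
Proof. by rewrite /cmod normc_def. Qed.

Lemma normc_cmod z : `|z| = (cmod z)%:C.
Proof. by rewrite cmodE normc_def. Qed.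

Lemma cmod_ge0 z : 0 <= cmod z. Proof. by rewrite cmodE sqrtr_ge0. Qed.

Lemma cmodM z w : cmod (z * w) = cmod z * cmod w.
Proof. by apply: complexI; rewrite rmorphM/= -!normc_cmod normrM. Qed.

Lemma cmodN z : cmod (- z) = cmod z. Proof. by rewrite /cmod normrN. Qed.

Lemma cmodD z w : cmod (z + w) <= cmod z + cmod w.
Proof. by rewrite -lecR rmorphD/= -!normc_cmod ler_normD. Qed.

Lemma cmodB z w : cmod (z - w) <= cmod z + cmod w.
Proof. by rewrite (le_trans (cmodD _ _))// cmodN. Qed.

Lemma cmod0 : cmod (0 : R[i]) = 0. Proof. by rewrite /cmod normr0. Qed.
Lemma cmod1 : cmod (1 : R[i]) = 1. Proof. by rewrite /cmod normr1. Qed.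

Lemma cmod_eq0 z : (cmod z == 0) = (z == 0).
Proof. by rewrite -(inj_eq (@complexI R)) -normc_cmod normr_eq0. Qed.

Lemma cmod_gt0 z : (0 < cmod z) = (z != 0).
Proof. by rewrite lt0r cmod_ge0 andbT cmod_eq0. Qed.

Lemma cmodV z : cmod z^-1 = (cmod z)^-1.
Proof. by apply: complexI; rewrite fmorphV/= -!normc_cmod normfV. Qed.

Lemma cmodX z n : cmod (z ^+ n) = cmod z ^+ n.
Proof. by elim: n => [|n IH]; rewrite ?expr0 ?cmod1// !exprS cmodM IH. Qed.

Lemma cmod_real x : cmod x%:C = `|x|.
Proof. by rewrite cmodE/= expr0n/= addr0 sqrtr_sqr. Qed.

Lemma cmodi : cmod ('i%C : R[i]) = 1.
Proof. by rewrite cmodE/= expr0n expr1n add0r sqrtr1. Qed.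

Lemma sqr_cmod z : cmod z ^+ 2 = Re z ^+ 2 + Im z ^+ 2.
Proof. by rewrite cmodE sqr_sqrtr// addr_ge0// sqr_ge0. Qed.

Lemma Re_le_cmod z : `|Re z| <= cmod z.
Proof.
rewrite -(ler_pXn2r (n:=2))//= ?nnegrE ?cmod_ge0//.
by rewrite sqr_cmod real_normK ?num_real// lerDl sqr_ge0.
Qed.

Lemma Im_le_cmod z : `|Im z| <= cmod z.
Proof.
rewrite -(ler_pXn2r (n:=2))//= ?nnegrE ?cmod_ge0//.
by rewrite sqr_cmod real_normK ?num_real// lerDr sqr_ge0.
Qed.

Lemma cmod_le_ReIm z : cmod z <= `|Re z| + `|Im z|.
Proof.
rewrite {1}(complexE z) (le_trans (cmodD _ _))// cmodM cmodi mul1r.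
by rewrite !cmod_real.
Qed.

Lemma ReD z w : Re (z + w) = Re z + Re w. Proof. by case: z; case: w. Qed.
Lemma ImD z w : Im (z + w) = Im z + Im w. Proof. by case: z; case: w. Qed.
Lemma ReN z : Re (- z) = - Re z. Proof. by case: z. Qed.
Lemma ImN z : Im (- z) = - Im z. Proof. by case: z. Qed.
Lemma ReM z w : Re (z * w) = Re z * Re w - Im z * Im w.
Proof. by case: z; case: w. Qed.
Lemma ImM z w : Im (z * w) = Re z * Im w + Im z * Re w.
Proof. by case: z => a b; case: w => c d /=; rewrite addrC. Qed.

Definition ReIm_simp := (ReD, ImD, ReN, ImN, ReM, ImM).

Lemma complex_ReIm z w : Re z = Re w -> Im z = Im w -> z = w.
Proof. by case: z; case: w => /= ? ? ? ? -> ->. Qed.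

(** The norm of [R[i]] is [R[i]]-valued; here tolerances and moduli are real. Multiplying by [h]
    removes the exclusion of [h = 0], so later estimates need no division. *)
Lemma derivable_cmodP f z : derivable (f : R[i]^o -> R[i]^o) z 1 <->
  exists d, forall e : R, 0 < e -> exists2 r : R, 0 < r & forall h,
    cmod h < r -> cmod (f (z + h) - f z - d * h) <= e * cmod h.
Proof.
split.
- move=> /cvg_ex[/= d] /cvgrPdist_le /= H; exists d => e e0.
  have e0' : (0 : R[i]) < e%:C by rewrite ltcR.
  have := H _ e0'; rewrite near_withinE => /nbhs_ballP[/= r].
  rewrite ltcE/= => /andP[/eqP rI r0] Hr.
  exists (Re r) => // h hr.
  have [->|h0] := eqVneq h 0.
    by rewrite addr0 subrr mulr0 subr0 cmod0 mulr0.
  have /Hr/(_ h0) : ball (0 : R[i]^o) r h.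
    rewrite -ball_normE/= sub0r normrN normc_cmod ltcE/= rI eqxx/=.
    by [].
  have -> : h *: (1 : R[i]^o) = h by rewrite /GRing.scale/= mulr1.
  rewrite /GRing.scale/= normc_cmod lecR (addrC h) => hle.
  have -> : f (z + h) - f z - d * h = - ((d - h^-1 * (f (z + h) - f z)) * h).
    by rewrite mulrBl -mulrA mulrCA mulVf// mulr1 opprB.
  by rewrite cmodN cmodM ler_wpM2r// cmod_ge0.
- move=> [d H]; apply/cvg_ex; exists d; apply/cvgrPdist_le => /= e.
  rewrite ltcE/= => /andP[/eqP eI e0].
  have [r r0 Hr] := H _ e0.
  rewrite near_withinE; apply/nbhs_ballP; exists r%:C => /=.
    by rewrite ltcR.
  move=> h; rewrite -ball_normE/= sub0r normrN normc_cmod ltcR => hr h0.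
  have -> : h *: (1 : R[i]^o) = h by rewrite /GRing.scale/= mulr1.
  rewrite normc_cmod lecE/= eI eqxx/= /GRing.scale/= (addrC h).
  have -> : d - h^-1 * (f (z + h) - f z) = - (h^-1 * (f (z + h) - f z - d * h)).
    by rewrite [in RHS]mulrBr mulrCA mulVf// mulr1 opprB.
  rewrite cmodN cmodM cmodV ler_pdivrMl ?cmod_gt0// (mulrC (cmod h)).
  exact: Hr.
Qed.

Lemma entire_cst c : entire (fun=> c : R[i]).
Proof. by move=> z; exact: derivable_cst. Qed.

Lemma entire_id : entire (@id R[i]).
Proof. by move=> z; exact: derivable_id. Qed.

Lemma entireD f g : entire f -> entire g -> entire (fun z => f z + g z).
Proof. by move=> ef eg z; exact: derivableD. Qed.

Lemma entireM f g : entire f -> entire g -> entire (fun z => f z * g z).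
Proof. by move=> ef eg z; exact: derivableM. Qed.

Lemma entireN f : entire f -> entire (fun z => - f z).
Proof. by move=> ef z; exact: derivableN. Qed.

Lemma entire_comp f g : entire f -> entire g -> entire (fun z => f (g z)).
Proof.
move=> ef eg z; apply/derivable1_diffP.
apply: (@differentiable_comp _ _ _ _ (g : R[i]^o -> R[i]^o)
  (f : R[i]^o -> R[i]^o)); exact/derivable1_diffP.
Qed.

Lemma entire_continuous f (ef : entire f) z (e : R) : 0 < e ->
  exists2 r : R, 0 < r & forall w, cmod (w - z) < r -> cmod (f w - f z) < e.
Proof.
move=> e0; have /derivable_cmodP[d /(_ _ ltr01)[r r0 H]] := ef z.
have cd : 0 < cmod d + 2 by rewrite ltr_wpDl// cmod_ge0.
exists (Num.min r (e / (cmod d + 2))); first by rewrite lt_min r0 divr_gt0.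
move=> w; rewrite lt_min => /andP[wr we].
have := H _ wr; rewrite (addrC z) subrK => {}H.
have -> : f w - f z = (f w - f z - d * (w - z)) + d * (w - z) by rewrite subrK.
rewrite (le_lt_trans (cmodD _ _))// (le_lt_trans (lerD H (lexx _)))//.
rewrite cmodM -mulrDl.
rewrite ltr_pdivlMr// in we; rewrite (le_lt_trans _ we)// mulrC.
by rewrite ler_wpM2l ?cmod_ge0//; lra.
Qed.

End Complex.
Arguments entire_cst {R} c.

(** * Signed integrals of continuous functions *)

Section SignedIntegral.
Context {R : realType}.
Notation mu := (@lebesgue_measure R).
Implicit Types (f g F : R -> R) (a b c x : R).

Lemma continuous_itv_integrable f (cf : continuous f) a b :
  mu.-integrable `[a, b] (EFin \o f).
Proof.
apply: continuous_compact_integrable; first exact: segment_compact.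
exact: continuous_subspaceT.
Qed.

(** For either sign of [x] one of the two intervals is empty or a point, so this is the signed
    integral from 0 to [x], a primitive on the whole line. *)
Definition prim f x : R :=
  \int[mu]_(t in `[0, x]) f t - \int[mu]_(t in `[x, 0]) f t.

(** Moving the base point to the left of both 0 and [x] lets the fundamental theorem with a fixed
    lower endpoint apply near [x], whatever its sign. *)
Lemma primE f (cf : continuous f) a x : a <= 0 -> a <= x ->
  prim f x = \int[mu]_(t in `[a, x]) f t - \int[mu]_(t in `[a, 0]) f t.
Proof.
move=> a0 ax; rewrite /prim; have [x0|x0] := leP 0 x.
  have -> : \int[mu]_(t in `[x, 0]) f t = 0.
    move: x0; rewrite le_eqVlt => /predU1P[<-|x0].
      by rewrite set_itv1 Rintegral_set1.
    by rewrite set_itv_ge ?Rintegral_set0// bnd_simp -ltNge.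
  rewrite Rintegral_itvB ?bnd_simp//; last exact: continuous_itv_integrable.
  rewrite subr0 [RHS]Rintegral_itv_obnd_cbnd//.
  apply: (@integrableS _ _ _ mu `[0, x]) => //; last exact: continuous_itv_integrable.
  by apply: subset_itvr; rewrite bnd_simp.
have -> : \int[mu]_(t in `[0, x]) f t = 0.
  by rewrite set_itv_ge ?Rintegral_set0// bnd_simp -ltNge.
rewrite sub0r; apply: oppr_inj; rewrite opprK opprB.
rewrite Rintegral_itvB ?bnd_simp ?(ltW x0)//; last exact: continuous_itv_integrable.
rewrite [RHS]Rintegral_itv_obnd_cbnd//.
apply: (@integrableS _ _ _ mu `[x, 0]) => //; last exact: continuous_itv_integrable.
by apply: subset_itvr; rewrite bnd_simp.
Qed.

Lemma is_derive_prim f (cf : continuous f) x : is_derive x 1 (prim f) (f x).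
Proof.
pose a := Num.min x 0 - 1.
have ax : a < x by rewrite /a ltrBlDr (@le_lt_trans _ _ x)// ?ltrDl// ge_min lexx.
have a0 : a <= 0 by rewrite /a lerBlDr (@le_trans _ _ 0)// ?lerDl// ge_min lexx orbT.
have [d1 d2] := @continuous_FTC1_closed R f a x (x + 1) ltac:(by rewrite ltrDl)
  (continuous_itv_integrable cf _ _) ax (cf x).
pose G y := \int[mu]_(t in `[a, y]) f t.
pose cc := \int[mu]_(t in `[a, 0]) f t.
apply: (@near_eq_is_derive _ _ _ (G - cst cc)).
  near=> y; rewrite /= (@primE f cf a)//.
  by apply/ltW; near: y; exact: lt_nbhsr.
rewrite -[f x]subr0; apply: is_deriveB.
by apply: (DeriveDef d1); rewrite -derive1E; exact: d2.
Unshelve. all: by end_near. Qed.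

Lemma derive_cst_eq F f : (forall x, is_derive x 1 F (f x)) ->
  forall G, (forall x, is_derive x 1 G (f x)) ->
  forall a b, F b - F a = G b - G a.
Proof.
move=> dF G dG a b.
have : (F - G) b = (F - G) a.
  apply: is_derive_0_is_cst => x.
  by rewrite -(subrr (f x)); apply: is_deriveB.
by rewrite !fctE => h; lra.
Qed.

(** As an increment of a primitive, it satisfies Chasles' relation for endpoints in any order, and
    its algebraic rules reduce to differentiation. *)
Definition sintegral f a b : R := prim f b - prim f a.

Lemma sintegral_FTC F f a b : continuous f -> (forall x, is_derive x 1 F (f x)) ->
  sintegral f a b = F b - F a.
Proof. by move=> cf dF; apply: (derive_cst_eq _ dF) => x; exact: is_derive_prim. Qed.

Lemma sintegral_chasles f a b c : sintegral f a b + sintegral f b c = sintegral f a c.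
Proof. by rewrite /sintegral; lra. Qed.

Lemma sintegralxx f a : sintegral f a a = 0. Proof. by rewrite /sintegral subrr. Qed.

Lemma sintegralD f g a b : continuous f -> continuous g ->
  sintegral (fun x => f x + g x) a b = sintegral f a b + sintegral g a b.
Proof.
move=> cf cg; have H : forall F, F = prim f + prim g ->
    F b - F a = sintegral f a b + sintegral g a b.
  by move=> _ ->; rewrite /sintegral !fctE; lra.
rewrite -(H _ erefl); apply: sintegral_FTC.
- by move=> x; exact: (continuousD (cf x) (cg x)).
- by move=> x; apply: is_deriveD; exact: is_derive_prim.
Qed.

Lemma sintegralN f a b : continuous f -> sintegral (fun x => - f x) a b = - sintegral f a b.
Proof.
move=> cf; have H : forall F, F = - prim f -> F b - F a = - sintegral f a b.
  by move=> _ ->; rewrite /sintegral !fctE; lra.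
rewrite -(H _ erefl); apply: sintegral_FTC.
- by move=> x; exact: (continuousN (cf x)).
- by move=> x; apply: is_deriveN; exact: is_derive_prim.
Qed.

Lemma sintegralB f g a b : continuous f -> continuous g ->
  sintegral (fun x => f x - g x) a b = sintegral f a b - sintegral g a b.
Proof.
move=> cf cg; rewrite (@sintegralD f (fun x => - g x))// ?sintegralN//.
by move=> x; exact: (continuousN (cg x)).
Qed.

Lemma sintegral_bound f a b (M : R) : continuous f -> a <= b ->
  (forall x, a <= x <= b -> `|f x| <= M) -> `|sintegral f a b| <= M * (b - a).
Proof.
move=> cf ab fM.
rewrite /sintegral; have [||c cab ->] := @MVT_segment R (prim f) f a b ab.
- by move=> x _; exact: is_derive_prim.
- apply: continuous_subspaceT => x.
  apply: (@differentiable_continuous _ R^o R^o); apply/derivable1_diffP.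
  exact: (@ex_derive _ _ _ _ _ _ _ (is_derive_prim cf x)).
- rewrite normrM (ger0_norm (x := b - a)) ?subr_ge0// ler_wpM2r ?subr_ge0//.
  by apply: fM; move: cab; rewrite in_itv.
Qed.

Lemma sintegral_Rintegral f a b : continuous f -> a <= b ->
  \int[mu]_(t in `[a, b]) f t = sintegral f a b.
Proof.
move=> cf; rewrite le_eqVlt => /predU1P[->|ab].
  by rewrite set_itv1 Rintegral_set1 sintegralxx.
have dp x : derivable (prim f) x 1.
  exact: (@ex_derive _ _ _ _ _ _ _ (is_derive_prim cf x)).
have cp : continuous (prim f).
  move=> x; apply: (@differentiable_continuous _ R^o R^o); exact/derivable1_diffP.
rewrite /Rintegral (@continuous_FTC2 _ _ (prim f))//.
- exact: continuous_subspaceT.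
- split; [by move=> x _; exact: dp|apply: cvg_at_right_filter; exact: cp|apply: cvg_at_left_filter; exact: cp].
- move=> x _; rewrite derive1E.
  exact: (@derive_val _ _ _ _ _ _ _ (is_derive_prim cf x)).
Qed.

End SignedIntegral.

(** * Goursat's theorem *)

Section Goursat.
Context {R : realType}.
Implicit Types (K : R[i] -> R[i]) (a b c d x y e : R) (z : R[i]).
Notation Re := (@complex.Re R).
Notation Im := (@complex.Im R).

(** [part] stands for the real or the imaginary part and [p] for a Lipschitz parametrisation of a
    line. *)
Lemma entire_path_continuous K (eK : entire K) (p : R -> R[i]) (L : R)
    (part : R[i] -> R) :
  (forall z w, part z - part w = part (z - w)) ->
  (forall z, `|part z| <= cmod z) ->
  (forall x y, cmod (p x - p y) <= L * `|x - y|) ->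
  continuous (fun x => part (K (p x)) : R).
Proof.
move=> partB part_le pL x; apply/cvgrPdist_lt => /= e e0.
have [r r0 H] := entire_continuous eK (p x) e0.
have L0 : 0 < `|L| + 1 by rewrite ltr_wpDl.
apply/nbhs_ballP; exists (r / (`|L| + 1)) => /=; first by rewrite divr_gt0.
move=> y /=; rewrite /ball/= distrC => xy.
rewrite distrC partB (le_lt_trans (part_le _))//; apply: H.
rewrite (le_lt_trans (pL _ _))//.
rewrite ltr_pdivlMr// mulrC in xy; rewrite (le_lt_trans _ xy)//.
by rewrite ler_wpM2r// (le_trans (ler_norm _))// lerDl.
Qed.

Lemma ReB z w : Re z - Re w = Re (z - w). Proof. by rewrite ReD ReN. Qed.
Lemma ImB z w : Im z - Im w = Im (z - w). Proof. by rewrite ImD ImN. Qed.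

Lemma cmod_horiz x y c : cmod ((x +i* c) - (y +i* c)) <= 1 * `|x - y|.
Proof.
rewrite (le_trans (cmod_le_ReIm _))// -ReB -ImB/= subrr normr0 addr0.
by rewrite mul1r.
Qed.

Lemma cmod_vert x y c : cmod ((c +i* x) - (c +i* y)) <= 1 * `|x - y|.
Proof.
rewrite (le_trans (cmod_le_ReIm _))// -ReB -ImB/= subrr normr0 add0r.
by rewrite mul1r.
Qed.

Lemma Re_horiz_continuous K (eK : entire K) c :
  continuous (fun u : R => Re (K (u +i* c)) : R).
Proof.
exact: (entire_path_continuous eK ReB (@Re_le_cmod R) (fun x y => cmod_horiz x y c)).
Qed.

Lemma Im_vert_continuous K (eK : entire K) c :
  continuous (fun v : R => Im (K (c +i* v)) : R).
Proof.
exact: (entire_path_continuous eK ImB (@Im_le_cmod R) (fun x y => cmod_vert x y c)).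
Qed.

(* Only the real part of the contour integral of K is needed: the imaginary part
   is the real part for [- 'i K]. *)
Definition contour K a b c d : R :=
  sintegral (fun u => Re (K (u +i* c))) a b - sintegral (fun u => Re (K (u +i* d))) a b
  - sintegral (fun v => Im (K (b +i* v))) c d + sintegral (fun v => Im (K (a +i* v))) c d.

Lemma contour_splith K a m b c d :
  contour K a b c d = contour K a m c d + contour K m b c d.
Proof.
rewrite /contour -!(sintegral_chasles _ a m b).
by do !move: (sintegral _ _ _) => ?; lra.
Qed.

Lemma contour_splitv K a b c m d :
  contour K a b c d = contour K a b c m + contour K a b m d.
Proof.
rewrite /contour -!(sintegral_chasles _ c m d).
by do !move: (sintegral _ _ _) => ?; lra.
Qed.

Lemma contourD K1 K2 a b c d : entire K1 -> entire K2 ->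
  contour (fun z => K1 z + K2 z) a b c d
  = contour K1 a b c d + contour K2 a b c d.
Proof.
move=> e1 e2; rewrite /contour.
have E1 t : (fun u => Re (K1 (u +i* t) + K2 (u +i* t))) =
            (fun u => Re (K1 (u +i* t)) + Re (K2 (u +i* t))).
  by apply/funext => u; rewrite ReD.
have E2 t : (fun u => Im (K1 (t +i* u) + K2 (t +i* u))) =
            (fun u => Im (K1 (t +i* u)) + Im (K2 (t +i* u))).
  by apply/funext => u; rewrite ImD.
rewrite !E1 !E2 !sintegralD; first by lra.
all: by [exact: Re_horiz_continuous|exact: Im_vert_continuous].
Qed.

Lemma contour_bound K a b c d M : entire K -> a <= b -> c <= d ->
  (forall x y, a <= x <= b -> c <= y <= d -> cmod (K (x +i* y)) <= M) ->
  `|contour K a b c d| <= M * (2 * ((b - a) + (d - c))).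
Proof.
move=> eK ab cd KM; rewrite /contour.
have H t : c <= t <= d -> `|sintegral (fun u => Re (K (u +i* t))) a b| <= M * (b - a).
  move=> ht; apply: sintegral_bound => //; first exact: Re_horiz_continuous.
  by move=> x hx; rewrite (le_trans (Re_le_cmod _))// KM.
have V t : a <= t <= b -> `|sintegral (fun v => Im (K (t +i* v))) c d| <= M * (d - c).
  move=> ht; apply: sintegral_bound => //; first exact: Im_vert_continuous.
  by move=> x hx; rewrite (le_trans (Im_le_cmod _))// KM.
have := H c; have := H d; have := V a; have := V b.
rewrite !lexx ab cd => /(_ isT) h1 /(_ isT) h2 /(_ isT) h3 /(_ isT) h4.
move: h1 h2 h3 h4; rewrite !ler_norml => /andP[? ?] /andP[? ?] /andP[? ?] /andP[? ?].
by apply/andP; split; lra.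
Qed.

Lemma is_derive_quad (p q x : R) :
  is_derive x 1 (fun u : R => p * u + q * (u ^+ 2 / 2)) (p + q * x).
Proof.
have d1 : is_derive x 1 (p \*: (@id R)) (p *: 1).
  by apply: is_deriveZ; exact: is_derive_id.
have d2 : is_derive x 1 ((q/2) \*: (@id R ^+ 2)) ((q/2) *: ((2%:R * x ^+ 1) *: 1)).
  by apply: is_deriveZ; apply: is_deriveX; exact: is_derive_id.
have := is_deriveD d1 d2.
rewrite /GRing.scale/= !mulr1 expr1.
have -> : q / 2 * (2 * x) = q * x by rewrite mulrA divfK.
move=> H; apply: (near_eq_is_derive _ H).
near=> u.
by rewrite /= !fctE /= /GRing.scale/= mulrAC mulrA. 
Unshelve. all: end_near. Qed.

Lemma sintegral_affine (p q a b : R) : sintegral (fun u => p + q * u) a b =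
  (p * b + q * (b ^+ 2 / 2)) - (p * a + q * (a ^+ 2 / 2)).
Proof.
have H := @sintegral_FTC R (fun u : R => p * u + q * (u ^+ 2 / 2)) (fun u => p + q * u) a b.
apply: H => [x|x]; last exact: is_derive_quad.
by apply: cvgD; [exact: cvg_cst|apply: cvgM; [exact: cvg_cst|exact: cvg_id]].
Qed.

Lemma contour_affine (p q : R[i]) a b c d :
  contour (fun z => p + q * z) a b c d = 0.
Proof.
rewrite /contour.
have E1 t : (fun u => Re (p + q * (u +i* t))) = (fun u => (Re p - Im q * t) + Re q * u).
  by apply/funext => u; rewrite !ReIm_simp/=; lra.
have E2 t : (fun u => Im (p + q * (t +i* u))) = (fun u => (Im p + Im q * t) + Re q * u).
  by apply/funext => u; rewrite !ReIm_simp/=; lra.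
by rewrite !E1 !E2 !sintegral_affine; lra.
Qed.

(** Subtracting the affine Taylor polynomial at [z] does not change the contour integral. The
    remainder is at most (e/2) s on a rectangle of half-perimeter s, and the perimeter is 2 s. *)
Lemma contour_local K (eK : entire K) z e : 0 < e -> exists2 r, 0 < r &
  forall a b c d, a <= Re z <= b -> c <= Im z <= d ->
    (b - a) + (d - c) < r ->
    `|contour K a b c d| <= e * ((b - a) + (d - c)) ^+ 2.
Proof.
move=> e0; have e20 : 0 < e / 2 by rewrite divr_gt0.
have /derivable_cmodP[q /(_ _ e20)[r r0 H]] := eK z.
exists r => // a b c d /andP[az zb] /andP[cz zd] sr.
have ab := le_trans az zb; have cd := le_trans cz zd.
pose A w := (K z - q * z) + q * w.
pose E w := K w + - A w.
have eA : entire A.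
  apply: entireD; first exact: entire_cst.
  by apply: entireM; [exact: entire_cst|exact: entire_id].
have eE : entire E := entireD eK (entireN eA).
have -> : K = (fun w => A w + E w) by apply/funext => w; rewrite /E addrC subrK.
rewrite (contourD _ _ _ _ eA eE) contour_affine add0r.
set s := (b - a) + (d - c).
have -> : e * s ^+ 2 = (e / 2 * s) * (2 * s) by field.
apply: contour_bound => // x y /andP[ax xb] /andP[cy yd].
pose h := (x +i* y) - z.
have hs : cmod h <= s.
  rewrite (le_trans (cmod_le_ReIm _))// /h -ReB -ImB/= /s lerD//.
    by rewrite ler_norml; apply/andP; split; lra.
  by rewrite ler_norml; apply/andP; split; lra.
have -> : E (x +i* y) = K (z + h) - K z - q * h.
  by rewrite /E /A /h (addrC z) subrK; ring.
rewrite (le_trans (H _ (le_lt_trans hs sr)))// ler_wpM2l// ltW//.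
Qed.

Section Bisection.
Variables (K : R[i] -> R[i]) (eta : R).

Let bad (w h : R) (p : R * R) : bool :=
  eta * (w + h) ^+ 2 < `|contour K p.1 (p.1 + w) p.2 (p.2 + h)|.

Let step (w h : R) (p : R * R) : R * R :=
  let p1 := (p.1 + w / 2, p.2) in
  let p2 := (p.1, p.2 + h / 2) in
  let p3 := (p.1 + w / 2, p.2 + h / 2) in
  if bad (w / 2) (h / 2) p then p else
  if bad (w / 2) (h / 2) p1 then p1 else
  if bad (w / 2) (h / 2) p2 then p2 else p3.

(** The threshold is quadratic in the half-perimeter, so halving both sides divides it by 4, the
    number of quarters. Hence one quarter of a bad rectangle is bad, and [step] may return the last
    quarter untested. *)
Let step_bad w h p : bad w h p -> bad (w / 2) (h / 2) (step w h p).
Proof.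
rewrite /step => B.
case: ifPn => // n0; case: ifPn => // n1; case: ifPn => // n2.
apply: contraT => n3; move: B n0 n1 n2 n3; rewrite /bad -!leNgt /=.
rewrite (@contour_splith _ p.1 (p.1 + w / 2)).
rewrite (@contour_splitv K p.1 (p.1 + w / 2) p.2 (p.2 + h / 2) (p.2 + h)).
rewrite (@contour_splitv K (p.1 + w / 2) (p.1 + w) p.2 (p.2 + h / 2) (p.2 + h)).
have -> : p.1 + w / 2 + w / 2 = p.1 + w by lra.
have -> : p.2 + h / 2 + h / 2 = p.2 + h by lra.
have -> : eta * (w / 2 + h / 2) ^+ 2 = eta * (w + h) ^+ 2 / 4 by field.
move=> B n0 n1 n2 n3; exfalso.
have key (x1 x2 x3 x4 X : R) : X < `|x1 + x2 + (x3 + x4)| ->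
    `|x1| <= X / 4 -> `|x2| <= X / 4 -> `|x3| <= X / 4 -> `|x4| <= X / 4 -> False.
  have := ler_normD (x1 + x2) (x3 + x4); have := ler_normD x1 x2.
  by have := ler_normD x3 x4; lra.
exact: key B n0 n2 n1 n3.
Qed.

Let step_bnd w h p : 0 <= w -> 0 <= h ->
  [/\ p.1 <= (step w h p).1, (step w h p).1 <= p.1 + w / 2,
      p.2 <= (step w h p).2 & (step w h p).2 <= p.2 + h / 2].
Proof.
by move=> w0 h0; rewrite /step; do ![case: ifP => _] => /=; split; lra.
Qed.

(** The lower left corners of the nested bad rectangles increase in each coordinate and stay below
    all upper edges; their suprema give a point common to all rectangles. *)
Lemma goursat_bisection a b c d : a <= b -> c <= d ->
  eta * ((b - a) + (d - c)) ^+ 2 < `|contour K a b c d| ->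
  exists z, forall r, 0 < r -> exists a' b' c' d',
    [/\ a' <= Re z <= b', c' <= Im z <= d', (b' - a') + (d' - c') < r &
     eta * ((b' - a') + (d' - c')) ^+ 2 < `|contour K a' b' c' d'|].
Proof.
move=> ab cd B0.
pose W n := (b - a) / 2 ^+ n; pose H n := (d - c) / 2 ^+ n.
pose P := fix P n := if n is n'.+1 then step (W n') (H n') (P n') else (a, c).
have W0 n : 0 <= W n by rewrite divr_ge0 ?subr_ge0// exprn_ge0.
have H0 n : 0 <= H n by rewrite divr_ge0 ?subr_ge0// exprn_ge0.
have WS n : W n.+1 = W n / 2 by rewrite /W exprSr invfM mulrA.
have HS n : H n.+1 = H n / 2 by rewrite /H exprSr invfM mulrA.
have PB n : bad (W n) (H n) (P n).
  elim: n => [|n IH]; last by rewrite WS HS; exact: step_bad.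
  rewrite /bad /W /H expr0 !divr1 /=.
  have -> : a + (b - a) = b by lra.
  by have -> : c + (d - c) = d by lra.
have PS n := step_bnd (P n) (W0 n) (H0 n).
have mono1 n m : (P n).1 <= (P (n + m)%N).1 /\ (P (n + m)%N).1 + W (n + m)%N <= (P n).1 + W n.
  elim: m => [|m [IH1 IH2]]; first by rewrite addn0.
  by rewrite addnS WS/=; have [? ? _ _] := PS (n + m)%N; split; lra.
have mono2 n m : (P n).2 <= (P (n + m)%N).2 /\ (P (n + m)%N).2 + H (n + m)%N <= (P n).2 + H n.
  elim: m => [|m [IH1 IH2]]; first by rewrite addn0.
  by rewrite addnS HS/=; have [_ _ ? ?] := PS (n + m)%N; split; lra.
(* Both edges are compared with those of the rectangle of index [n + m]. *)
have ub1 n m : (P m).1 <= (P n).1 + W n.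
  have [h1 h2] := mono1 n m; have := mono1 m n; have := W0 (n + m)%N.
  by rewrite (addnC m n) => ? [? ?]; lra.
have ub2 n m : (P m).2 <= (P n).2 + H n.
  have [h1 h2] := mono2 n m; have := mono2 m n; have := H0 (n + m)%N.
  by rewrite (addnC m n) => ? [? ?]; lra.
pose x := sup (range (fun n => (P n).1)); pose y := sup (range (fun n => (P n).2)).
have hx n : (P n).1 <= x <= (P n).1 + W n.
  apply/andP; split.
    apply: ub_le_sup; last by exists n.
    by exists ((P 0%N).1 + W 0%N) => _ [m _ <-].
  apply: ge_sup; first by exists (P 0%N).1, 0%N.
  by move=> _ [m _ <-].
have hy n : (P n).2 <= y <= (P n).2 + H n.
  apply/andP; split.
    apply: ub_le_sup; last by exists n.
    by exists ((P 0%N).2 + H 0%N) => _ [m _ <-].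
  apply: ge_sup; first by exists (P 0%N).2, 0%N.
  by move=> _ [m _ <-].
exists (x +i* y) => r r0.
have [n nr] : exists n, W n + H n < r.
  pose s := (b - a) + (d - c).
  have [n hn] : exists n : nat, s / r < 2 ^+ n.
    exists (Num.bound (s / r)); rewrite (lt_le_trans (archi_boundP _))//.
      by rewrite divr_ge0// ?(ltW r0)// /s addr_ge0// subr_ge0.
    by rewrite -natrX ler_nat ltnW// ltn_expl.
  exists n; rewrite /W /H -mulrDl ltr_pdivrMr ?exprn_gt0//.
  by move: hn; rewrite ltr_pdivrMr// mulrC.
exists (P n).1, ((P n).1 + W n), (P n).2, ((P n).2 + H n).
have -> : (P n).1 + W n - (P n).1 = W n by lra.
have -> : (P n).2 + H n - (P n).2 = H n by lra.
by split; [exact: hx|exact: hy|exact: nr|exact: PB].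
Qed.

End Bisection.

(** If the integral exceeded e s^2, bisection would produce arbitrarily small rectangles around one
    point with the same excess, against [contour_local] at that point. *)
Theorem goursat K a b c d : entire K -> a <= b -> c <= d ->
  contour K a b c d = 0.
Proof.
move=> eK ab cd; apply/eqP; rewrite -normr_le0.
pose s := (b - a) + (d - c).
have s0 : 0 <= s by rewrite addr_ge0 ?subr_ge0.
suff H e : 0 < e -> `|contour K a b c d| <= e * s ^+ 2.
  apply/ler_addgt0Pr => e e0; rewrite add0r.
  have t0 : 0 < s ^+ 2 + 1 by rewrite ltr_wpDl// sqr_ge0.
  rewrite (le_trans (H (e / (s ^+ 2 + 1)) _))// ?divr_gt0//.
  by rewrite -mulrA ler_piMr ?(ltW e0)// mulrC ler_pdivrMr// mul1r lerDl.
move=> e0; rewrite leNgt; apply/negP => B.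
have [z Hz] := goursat_bisection ab cd B.
have [r r0 Hr] := contour_local eK z e0.
have [a' [b' [c' [d' [h1 h2 h3]]]]] := Hz _ r0.
by rewrite ltNge Hr.
Qed.

End Goursat.
Arguments Re_horiz_continuous {R K} eK c [x t] _.
Arguments Im_vert_continuous {R K} eK c [x t] _.

(** * The complex exponential and the cardinal sine *)

Section Exponential.
Context {R : realType}.
Implicit Types (x y a b c e t : R) (z w h : R[i]).
Notation Re := (@complex.Re R).
Notation Im := (@complex.Im R).

(** A mean value inequality based at 0, meant to be iterated: a bound for one Taylor remainder is
    the derivative bound for the next. *)
Lemma derive_bound0 (F f : R -> R) (B y : R) :
  (forall t, is_derive t 1 F (f t)) -> F 0 = 0 ->
  (forall t, `|t| <= `|y| -> `|f t| <= B) -> `|F y| <= B * `|y|.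
Proof.
move=> dF F0 fB.
have cF : continuous F.
  move=> t; apply: (@differentiable_continuous _ R^o R^o).
  by apply/derivable1_diffP; exact: (@ex_derive _ _ _ _ _ _ _ (dF t)).
have [y0|y0] := leP 0 y.
  have [c cy] := @MVT_segment R F f 0 y y0 (fun x _ => dF x)
    (continuous_subspaceT cF).
  rewrite F0 !subr0 => ->; rewrite normrM ler_wpM2r// fB//.
  by move: cy; rewrite in_itv/= => /andP[c0 cy]; rewrite !ger0_norm.
have [c cy] := @MVT_segment R F f y 0 (ltW y0) (fun x _ => dF x)
  (continuous_subspaceT cF).
rewrite F0 !sub0r => E.
rewrite -normrN E normrM normrN ler_wpM2r// fB//.
move: cy; rewrite in_itv/= => /andP[yc c0].
by rewrite !ler0_norm ?lerN2 ?(ltW y0).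
Qed.

Lemma sin_le_abs y : `|sin y| <= `|y|.
Proof.
rewrite -[leRHS]mul1r; apply: (@derive_bound0 sin cos) => [|t _].
- exact: sin0.
- by rewrite ler_norml cos_geN1 cos_le1.
Qed.

Lemma cosB1_le y : `|cos y - 1| <= y ^+ 2.
Proof.
rewrite -real_normK ?num_real// expr2.
have dF t : is_derive t 1 (cos - cst 1) (- sin t).
  by rewrite -[X in is_derive _ _ _ X]subr0; exact: is_deriveB.
apply: (derive_bound0 dF) => [|t ty].
- by rewrite !fctE cos0 subrr.
- by rewrite normrN (le_trans (sin_le_abs t)).
Qed.

Lemma sinBx_le y : `|sin y - y| <= `|y| ^+ 3.
Proof.
rewrite exprSr.
have dF t : is_derive t 1 (sin - id) (cos t - 1).
  exact: is_deriveB.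
apply: (derive_bound0 dF) => [|t ty].
- by rewrite !fctE sin0 subrr.
- by rewrite (le_trans (cosB1_le t))// -real_normK ?num_real// lerXn2r ?nnegrE.
Qed.

Lemma expR_le4 y : `|y| <= 1 -> expR y <= 4.
Proof.
move=> y1; rewrite (@le_trans _ _ (expR 1))//.
  by rewrite ler_expR (le_trans (ler_norm y)).
have h : 2^-1 <= expR (- 2^-1) :> R.
  by have := expR_ge1Dx (- 2^-1 : R); lra.
rewrite expRN in h.
have e2 : expR 2^-1 <= 2 :> R.
  by rewrite -lef_pV2 ?posrE ?expR_gt0.
have -> : (1 : R) = 2^-1 + 2^-1 by field.
rewrite expRD (@le_trans _ _ (2 * 2))//; last by lra.
by rewrite ler_pM// expR_ge0.
Qed.

Lemma expRB1_le y : `|y| <= 1 -> `|expR y - 1| <= 4 * `|y|.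
Proof.
move=> y1; have dF t : is_derive t 1 (expR - cst 1) (expR t).
  by rewrite -[X in is_derive _ _ _ X]subr0; exact: is_deriveB.
apply: (derive_bound0 dF) => [|t ty].
- by rewrite !fctE expR0 subrr.
- by rewrite ger0_norm ?expR_ge0// expR_le4// (le_trans ty).
Qed.

Lemma expRB1x_le y : `|y| <= 1 -> `|expR y - 1 - y| <= 4 * `|y| ^+ 2.
Proof.
move=> y1; rewrite expr2 mulrA.
have dF t : is_derive t 1 (expR - cst 1 - id) (expR t - 1).
  by apply: is_deriveB; rewrite -[X in is_derive _ _ _ X]subr0; exact: is_deriveB.
apply: (derive_bound0 dF) => [|t ty].
- by rewrite !fctE expR0 !subrr.
- by rewrite (le_trans (expRB1_le (le_trans ty y1)))// ler_wpM2l.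
Qed.

Definition cexp z : R[i] := (expR (Re z) * cos (Im z)) +i* (expR (Re z) * sin (Im z)).

Lemma cexpD z w : cexp (z + w) = cexp z * cexp w.
Proof.
apply: complex_ReIm; rewrite !ReIm_simp /cexp/= !ReIm_simp expRD ?cosD ?sinD; ring.
Qed.

Lemma cexp0 : cexp 0 = 1.
Proof. by apply: complex_ReIm => /=; rewrite expR0 mul1r ?cos0 ?sin0. Qed.

Lemma cmod_cexp z : cmod (cexp z) = expR (Re z).
Proof.
rewrite cmodE/= !exprMn -mulrDr cos2Dsin2 mulr1 sqrtr_sqr ger0_norm// expR_ge0.
Qed.

Lemma cexp_local h : cmod h <= 1 -> cmod (cexp h - 1 - h) <= 17 * cmod h ^+ 2.
Proof.
set r := cmod h => r1.
have r0 : 0 <= r by exact: cmod_ge0.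
pose x := Re h; pose y := Im h.
have xr : `|x| <= r by exact: Re_le_cmod.
have yr : `|y| <= r by exact: Im_le_cmod.
have x1 : `|x| <= 1 := le_trans xr r1.
have x2 : `|x| ^+ 2 <= r ^+ 2 by rewrite lerXn2r ?nnegrE.
have y2 : `|y| ^+ 2 <= r ^+ 2 by rewrite lerXn2r ?nnegrE.
have A := expRB1x_le x1.
have B := cosB1_le y; rewrite -real_normK ?num_real// in B.
have D := sinBx_le y.
have D' : `|sin y - y| <= r ^+ 2.
  rewrite (le_trans D)// exprSr (le_trans (ler_wpM2r (normr_ge0 _) y2))//.
  by rewrite ler_piMr ?exprn_ge0// (le_trans yr).
have E4 := expR_le4 x1; have E0 := expR_ge0 x.
have Ex := expRB1_le x1.
have Sy := le_trans (sin_le_abs y) yr.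
rewrite (le_trans (cmod_le_ReIm _))// !ReIm_simp/= -/x -/y.
(* The four resulting terms are at most 4, 4, 4 and 1 times r^2, within the constant 17. *)
have -> : expR x * cos y - 1 - x = (expR x - 1 - x) + expR x * (cos y - 1) by ring.
have -> : expR x * sin y - 0 - y = (expR x - 1) * sin y + (sin y - y) by ring.
have t1 : `|expR x * (cos y - 1)| <= 4 * r ^+ 2.
  by rewrite normrM (ger0_norm E0) ler_pM// (le_trans B).
have t2 : `|(expR x - 1) * sin y| <= 4 * r ^+ 2.
  rewrite normrM expr2 mulrA ler_pM// (le_trans Ex)// ler_wpM2l//.
have := ler_normD (expR x - 1 - x) (expR x * (cos y - 1)).
have := ler_normD ((expR x - 1) * sin y) (sin y - y).
by have := sqr_ge0 r; lra.
Qed.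

(** The functional equation transports the second-order estimate at 0 to every point. *)
Lemma entire_cexp : entire cexp.
Proof.
move=> z; apply/derivable_cmodP; exists (cexp z) => e e0.
pose c := cmod (cexp z) * 17 + 1.
have c0 : 0 < c by rewrite ltr_wpDl// mulr_ge0 ?cmod_ge0.
exists (Num.min 1 (e / c)); first by rewrite lt_min ltr01 divr_gt0.
move=> h; rewrite lt_min => /andP[h1 he].
have -> : cexp (z + h) - cexp z - cexp z * h = cexp z * (cexp h - 1 - h).
  by rewrite cexpD; ring.
rewrite cmodM (le_trans (ler_wpM2l (cmod_ge0 _) (cexp_local (ltW h1))))//.
rewrite mulrA expr2 mulrA ler_wpM2r ?cmod_ge0//.
rewrite ltr_pdivlMr// mulrC in he; rewrite (le_trans _ (ltW he))//.
by rewrite ler_wpM2r ?cmod_ge0// /c lerDl.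
Qed.

End Exponential.

Section Sinc.
Context {R : realType}.
Implicit Types (x y a b c e t : R) (z w h : R[i]).
Notation Re := (@complex.Re R).
Notation Im := (@complex.Im R).

Definition csin z : R[i] :=
  (sin (Re z) * ((expR (Im z) + expR (- Im z)) / 2)) +i*
  (cos (Re z) * ((expR (Im z) - expR (- Im z)) / 2)).

Lemma csinE z : csin z = ('i%C / (- 2)%:C) * (cexp ('i%C * z) - cexp (- ('i%C * z))).
Proof.
have -> : 'i%C / (- 2)%:C = 0 +i* (- (2^-1)) :> R[i].
  rewrite -fmorphV/=; apply: complex_ReIm; rewrite !ReIm_simp/=; lra.
by apply: complex_ReIm; rewrite !ReIm_simp /cexp/= !ReIm_simp/=;
  rewrite !(mul0r, mul1r, sub0r, add0r, oppr0, addr0, opprK) ?cosN ?sinN; lra.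
Qed.

Lemma entire_csin : entire csin.
Proof.
have -> : csin = fun z => ('i%C / (- 2)%:C) * (cexp ('i%C * z) + - cexp (- ('i%C * z))).
  by apply/funext => z; exact: csinE.
have eL : entire (fun z : R[i] => 'i%C * z).
  by apply: entireM; [exact: entire_cst|exact: entire_id].
apply: entireM; first exact: entire_cst.
apply: entireD; first exact: (entire_comp entire_cexp eL).
apply: entireN; exact: (entire_comp entire_cexp (entireN eL)).
Qed.

Lemma csin_real x : csin x%:C = (sin x)%:C.
Proof.
by apply: complex_ReIm; rewrite /= oppr0 ?subrr ?mul0r ?mulr0// expR0; field.
Qed.

Lemma cmod_csin z : cmod (csin z) <= expR (cmod z).
Proof.
have y1 : expR (Im z) <= expR (cmod z).
  by rewrite ler_expR (le_trans (ler_norm _))// Im_le_cmod.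
have y2 : expR (- Im z) <= expR (cmod z).
  by rewrite ler_expR (le_trans (ler_norm _))// normrN Im_le_cmod.
rewrite csinE cmodM cmodM cmodi cmodV cmod_real normrN mul1r.
rewrite (@ger0_norm _ 2)// ler_pdivrMl//.
rewrite (le_trans (cmodB _ _))// !cmod_cexp !ReIm_simp/=.
by rewrite !mul0r !mul1r !sub0r opprK; lra.
Qed.

(** Third order is what division by [h] requires: it makes [csinc h - 1] quadratic, so that [csinc]
    is differentiable at 0 with derivative 0. The terms below contribute 4, 4, 5 and 4 times r^3,
    within 20. *)
Lemma csin_local h : cmod h <= 1 -> cmod (csin h - h) <= 20 * cmod h ^+ 3.
Proof.
set r := cmod h => r1.
have r0 : 0 <= r by exact: cmod_ge0.
pose x := Re h; pose y := Im h.
have xr : `|x| <= r by exact: Re_le_cmod.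
have yr : `|y| <= r by exact: Im_le_cmod.
have x1 : `|x| <= 1 := le_trans xr r1.
have y1 : `|y| <= 1 := le_trans yr r1.
have yN1 : `|- y| <= 1 by rewrite normrN.
pose ch := (expR y + expR (- y)) / 2; pose sh := (expR y - expR (- y)) / 2.
have chB t : `|t| <= 1 -> `|(expR t + expR (- t)) / 2 - 1| <= 4 * `|t| ^+ 2.
  move=> t1; have := expRB1x_le t1; have := @expRB1x_le _ (- t).
  by rewrite normrN => /(_ t1); rewrite !ler_norml => /andP[? ?] /andP[? ?];
    apply/andP; split; lra.
have r2 : r ^+ 2 <= r by rewrite expr2 ler_piMr.
have y2 : `|y| ^+ 2 <= r ^+ 2 by rewrite lerXn2r ?nnegrE.
have x2 : `|x| ^+ 2 <= r ^+ 2 by rewrite lerXn2r ?nnegrE.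
have x3 : `|x| ^+ 3 <= r ^+ 3 by rewrite lerXn2r ?nnegrE.
have y3 : `|y| ^+ 3 <= r ^+ 3 by rewrite lerXn2r ?nnegrE.
have ch4 : `|ch| <= 4.
  rewrite /ch ger0_norm ?divr_ge0 ?addr_ge0 ?expR_ge0//.
  by have := expR_le4 y1; have := expR_le4 yN1; lra.
have ch1 : `|ch - 1| <= 4 * r ^+ 2.
  by rewrite (le_trans (chB _ y1))// ler_wpM2l.
have shB : `|sh - y| <= 4 * r ^+ 3.
  have dF t : is_derive t 1 (fun t => (expR t - expR (- t)) / 2 - t)
      ((expR t + expR (- t)) / 2 - 1).
    have d1 : is_derive t 1 (expR \o -%R) (expR (- t) * -1).
      exact: is_derive1_comp.
    have := is_deriveB (is_deriveZ 2^-1 (is_deriveB (is_derive_expR t) d1))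
      (is_derive_id t 1).
    rewrite mulrN1 opprK /GRing.scale/= mulrC => H.
    apply: near_eq_is_derive H; near=> u.
    by rewrite /= !fctE/= /GRing.scale/= mulrC.
  apply: (@le_trans _ _ ((4 * `|y| ^+ 2) * `|y|)).
    apply: (derive_bound0 dF) => [|t ty]; first by rewrite /= oppr0 subrr mul0r addr0.
    rewrite (le_trans (chB _ (le_trans ty y1)))// ler_wpM2l// lerXn2r ?nnegrE//.
  by rewrite -mulrA -exprSr ler_wpM2l.
have sh5 : `|sh| <= 5 * r.
  have := ler_normD (sh - y) y; rewrite subrK.
  have : r ^+ 3 <= r.
    by rewrite exprS ler_piMr// (le_trans r2).
  lra.
have t1 : `|(sin x - x) * ch| <= r ^+ 3 * 4.
  by rewrite normrM ler_pM// (le_trans (sinBx_le x)).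
have t2 : `|x * (ch - 1)| <= r * (4 * r ^+ 2) by rewrite normrM ler_pM.
have t3 : `|(cos x - 1) * sh| <= r ^+ 2 * (5 * r).
  by rewrite normrM ler_pM// (le_trans (cosB1_le x))// -real_normK ?num_real.
have -> : csin h - h = ((sin x - x) * ch + x * (ch - 1)) +i*
    ((cos x - 1) * sh + (sh - y)).
  apply: complex_ReIm; rewrite !ReIm_simp/= -/x -/y -/ch -/sh; ring.
rewrite (le_trans (cmod_le_ReIm _))//=.
have := ler_normD ((sin x - x) * ch) (x * (ch - 1)).
have := ler_normD ((cos x - 1) * sh) (sh - y).
have r3 : 0 <= r ^+ 3 by rewrite exprn_ge0.
have e1 : r * (4 * r ^+ 2) = 4 * r ^+ 3 by ring.
have e2 : r ^+ 2 * (5 * r) = 5 * r ^+ 3 by ring.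
lra.
Unshelve. all: by end_near. Qed.

Definition csinc z : R[i] := if z == 0 then 1 else csin z / z.

Lemma csinc_local h : cmod h <= 1 -> cmod (csinc h - 1) <= 20 * cmod h ^+ 2.
Proof.
move=> h1; rewrite /csinc; have [->|h0] := eqVneq h 0.
  by rewrite subrr cmod0 mulr_ge0// sqr_ge0.
have -> : csin h / h - 1 = (csin h - h) / h by rewrite mulrBl divff.
rewrite cmodM cmodV ler_pdivrMr ?cmod_gt0// -mulrA -exprSr.
exact: csin_local.
Qed.

Lemma entire_csinc : entire csinc.
Proof.
move=> z; have [->|z0] := eqVneq z 0.
  apply/derivable_cmodP; exists 0 => e e0.
  exists (Num.min 1 (e / 20)); first by rewrite lt_min ltr01 divr_gt0.
  move=> h; rewrite lt_min add0r mul0r subr0 => /andP[h1 he].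
  rewrite {2}/csinc eqxx (le_trans (csinc_local (ltW h1)))// expr2 mulrA.
  rewrite ler_wpM2r ?cmod_ge0// mulrC -ler_pdivlMr//; exact: ltW.
apply: (@near_eq_derivable _ _ _ (fun w : R[i]^o => csin w * w^-1 : R[i]^o)).
  have : \forall w \near (z : R[i]^o), w != 0.
    apply/nbhs_ballP; exists `|z| => /=; first by rewrite normr_gt0.
    move=> w; rewrite -ball_normE/= => zw; apply/eqP => w0.
    by move: zw; rewrite w0 subr0 ltxx.
  by apply: filterS => w w0 /=; rewrite /csinc (negbTE w0).
apply: (@derivableM _ _ (csin : R[i]^o -> R[i]^o) (fun w : R[i]^o => w^-1)).
  exact: entire_csin.
by apply: derivableV => //; exact: derivable_id.
Qed.

Lemma cmod_csinc z : cmod (csinc z) <= 21 * expR (cmod z).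
Proof.
have E1 : 1 <= expR (cmod z) by rewrite -expR0 ler_expR cmod_ge0.
(* Inside the unit disc 21 is 20 from [csinc_local] plus 1; outside it, division by z only helps. *)
have [z1|z1] := leP (cmod z) 1.
  have := csinc_local z1 => H.
  have -> : csinc z = (csinc z - 1) + 1 by rewrite subrK.
  rewrite (le_trans (cmodD _ _))// cmod1.
  have : cmod z ^+ 2 <= 1 by rewrite expr_le1// cmod_ge0.
  lra.
have z0 : z != 0 by rewrite -cmod_gt0; lra.
rewrite /csinc (negbTE z0) cmodM cmodV ler_pdivrMr; last by lra.
rewrite (le_trans (cmod_csin z))// mulrAC ler_peMl ?expR_ge0//.
by rewrite (le_trans (ltW z1))// ler_peMl// ?cmod_ge0//; lra.
Qed.

Definition sinc x : R := if x == 0 then 1 else sin x / x.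

Lemma csinc_real x : csinc x%:C = (sinc x)%:C.
Proof.
rewrite /csinc /sinc -[0 in LHS]/(0%:C) (inj_eq (@complexI R)).
by case: eqP => // _; rewrite csin_real -fmorphV -rmorphM.
Qed.

Lemma sincxE x : sinc x * x = sin x.
Proof.
by rewrite /sinc; have [->|x0] := eqVneq x 0; rewrite ?mulr0 ?sin0// divfK.
Qed.

Lemma sinc_le1 x : `|sinc x| <= 1.
Proof.
have [->|x0] := eqVneq x 0; first by rewrite /sinc eqxx normr1.
by rewrite -(ler_pM2r (x := `|x|)) ?normr_gt0// -normrM sincxE mul1r sin_le_abs.
Qed.

Lemma sinc_absM_le1 x : `|sinc x| * `|x| <= 1.
Proof. by rewrite -normrM sincxE ler_norml sin_geN1 sin_le1. Qed.

Lemma sincB1_le x : `|sinc x - 1| <= x ^+ 2.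
Proof.
have [->|x0] := eqVneq x 0; first by rewrite /sinc eqxx subrr normr0 sqr_ge0.
rewrite -(ler_pM2r (x := `|x|)) ?normr_gt0// -normrM mulrBl sincxE mul1r.
by rewrite (le_trans (sinBx_le x))// exprSr real_normK ?num_real.
Qed.

End Sinc.

(** * Rotating the ray of integration *)

Section LogIntegrand.
Context {R : realType}.
Implicit Types (x y a b c e t : R) (z w h : R[i]).
Notation Re := (@complex.Re R).
Notation Im := (@complex.Im R).

(** For |w| <= 1 the constant is 17 + 1 from the second-order estimate; for larger w, Re w >= 0
    bounds the left side by 2. *)
Lemma cexpN_bound w : 0 <= Re w -> cmod (cexp (- w) - 1) <= 18 * cmod w.
Proof.
move=> w0; have [w1|w1] := leP (cmod w) 1.
  have := @cexp_local _ (- w); rewrite cmodN => /(_ w1) H.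
  have -> : cexp (- w) - 1 = (cexp (- w) - 1 - - w) + - w by ring.
  rewrite (le_trans (cmodD _ _))// cmodN.
  have : cmod w ^+ 2 <= cmod w by rewrite expr2 ler_piMr ?cmod_ge0.
  lra.
rewrite (le_trans (cmodB _ _))// cmod1 cmod_cexp ReN.
have : expR (- Re w) <= 1 by rewrite -expR0 ler_expR oppr_le0.
lra.
Qed.

(** The inequality e^v >= 1 + v is used at v = u - s with e^s = (m + 1) / k. Taking m + 1 rather
    than the exact maximiser's m keeps the logarithm meaningful for m = 0. *)
Lemma affine_expR_bound (k m : R) : 0 < k -> 0 <= m -> exists M : R,
  forall u : R, expR (- (k * expR u) + m * u) <= M.
Proof.
move=> k0 m0; pose s := ln ((m + 1) / k).
have mk : 0 < (m + 1) / k by rewrite divr_gt0// ltr_wpDl.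
exists (expR (m * s)) => u; rewrite ler_expR.
have H : u <= expR (u - s) + s by have := expR_ge1Dx (u - s); lra.
have E : expR (u - s) = k / (m + 1) * expR u.
  by rewrite expRD mulrC expRN /s lnK ?posrE// invf_div.
have h1 : m * u <= m * (k / (m + 1) * expR u + s).
  by rewrite ler_wpM2l// -E.
have h2 : m * (k / (m + 1) * expR u) <= k * expR u.
  rewrite mulrA ler_wpM2r ?expR_ge0// mulrA ler_pdivrMr ?ltr_wpDl//.
  by rewrite mulrC ler_wpM2l ?(ltW k0)// lerDl.
by move: h1; rewrite mulrDr; lra.
Qed.

(* The integrand F(x) e^(i(psi + t x) - eps x^p) dx in the coordinate x = e^zeta,
   where sectors become rectangles. *)
Definition logint (F : R[i] -> R[i]) t psi eps p z : R[i] :=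
  F (cexp z) *
  cexp ('i%C * (psi%:C + t%:C * cexp z) - eps%:C * cexp (p%:C * z) + z).

Lemma entire_logint F t psi eps p : entire F -> entire (logint F t psi eps p).
Proof.
move=> eF.
have em (q : R[i]) : entire (fun z => q * z).
  by apply: entireM; [exact: entire_cst|exact: entire_id].
have emc (q : R[i]) : entire (fun z => q * cexp z).
  by apply: entireM; [exact: entire_cst|exact: entire_cexp].
apply: entireM; first exact: (entire_comp eF entire_cexp).
apply: (entire_comp entire_cexp); apply: entireD; last exact: entire_id.
apply: entireD; last first.
  apply: entireN; apply: (entire_comp (emc eps%:C)); exact: em.
apply: (entire_comp (em 'i%C)); apply: entireD; first exact: entire_cst.
exact: emc.
Qed.

Lemma cmod_logint F t psi eps p u v : cmod (logint F t psi eps p (u +i* v)) =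
  cmod (F (cexp (u +i* v))) *
  expR (- (t * (expR u * sin v)) - eps * (expR (p * u) * cos (p * v)) + u).
Proof.
rewrite cmodM cmod_cexp; congr (_ * expR _).
by rewrite ?ReIm_simp/= ?ReIm_simp/=; rewrite ?(mul0r, mul1r, subr0, add0r, addr0); lra.
Qed.

Lemma logint_bound F C T t psi eps p u v :
  (forall z, cmod (F z) <= C * expR (T * cmod z)) ->
  cmod (logint F t psi eps p (u +i* v)) <=
  C * expR (T * expR u - t * (expR u * sin v)
            - eps * (expR (p * u) * cos (p * v)) + u).
Proof.
move=> FC; rewrite cmod_logint.
rewrite (le_trans (ler_wpM2r (expR_ge0 _) (FC _)))// cmod_cexp/= -mulrA -expRD.
by rewrite !addrA.
Qed.

(** Dropping the damping multiplies the integrand by e^w with w = eps x^p. As long as Re w >= 0,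
    that is cos (p v) >= 0, the relative error is linear in |w|. *)
Lemma logint_eps F t psi eps p u v : 0 <= eps -> 0 <= cos (p * v) ->
  cmod (logint F t psi eps p (u +i* v) - logint F t psi 0 p (u +i* v)) <=
  18 * eps * expR (p * u) * cmod (logint F t psi 0 p (u +i* v)).
Proof.
move=> e0 c0; set z := u +i* v.
pose w := eps%:C * cexp (p%:C * z).
have -> : logint F t psi eps p z - logint F t psi 0 p z =
    (cexp (- w) - 1) * logint F t psi 0 p z.
  rewrite /logint -/w; set E := 'i%C * _.
  have -> : E - w + z = - w + (E - 0%:C * cexp (p%:C * z) + z) by rewrite mul0r; ring.
  rewrite cexpD; ring.
rewrite cmodM ler_wpM2r ?cmod_ge0// (le_trans (cexpN_bound _))//.
  rewrite /w ?ReIm_simp/= ?ReIm_simp/=.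
  by rewrite ?(mul0r, addr0, subr0) mulr_ge0// mulr_ge0// expR_ge0.
rewrite /w cmodM cmod_real cmod_cexp (ger0_norm e0) !ReIm_simp/=.
by rewrite mul0r subr0 mulrA.
Qed.

End LogIntegrand.

(** * Rotating the half-line to the imaginary axis *)

Section RayShift.
Context {R : realType}.
Implicit Types (x y a b c e t : R) (z w h : R[i]).
Notation Re := (@complex.Re R).
Notation Im := (@complex.Im R).

Lemma cvg_expR_geo (r : R) : 0 < r -> (fun n : nat => expR (- (r * n%:R))) @ \oo --> (0 : R).
Proof.
move=> r0.
have -> : (fun n : nat => expR (- (r * n%:R))) = (fun n => expR (- r) ^+ n).
  by apply/funext => n; rewrite -expRM_natr mulNr.
by apply: cvg_expr; rewrite ger0_norm ?expR_ge0// -expR0 ltr_expR oppr_lt0.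
Qed.

Lemma squeeze_norm_cvg0 (f g : nat -> R) : (forall n, `|f n| <= g n) ->
  g @ \oo --> (0 : R) -> f @ \oo --> (0 : R).
Proof.
move=> fg g0; apply/norm_cvg0P.
apply: (squeeze_cvgr _ (cvg_cst 0) g0).
by near=> n; rewrite normr_ge0 fg.
Unshelve. all: by end_near. Qed.

Lemma le_cos_pi (u v : R) : 0 <= u -> u <= v -> v <= pi -> cos v <= cos u.
Proof.
move=> u0 uv vp; rewrite leNgt ltr_cos ?in_itv/= -?leNgt//.
all: by rewrite ?u0 ?vp ?(le_trans u0 uv) ?(le_trans uv vp).
Qed.

Lemma le_sin_pihalf (u v : R) : - (pi / 2) <= u -> u <= v -> v <= pi / 2 ->
  sin u <= sin v.
Proof.
move=> u0 uv vp; rewrite leNgt ltr_sin ?in_itv/= -?leNgt//.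
all: by rewrite ?u0 ?vp ?(le_trans u0 uv) ?(le_trans uv vp).
Qed.

(** Past the angle th the factor e^(itx) beats growth of type T; p th < pi / 2 keeps Re x^p positive
    in the sector below. Here sin th is the midpoint of T / t and 1, and p the midpoint of 1 and (pi
    / 2) / th. *)
Lemma sector_params T t : 0 <= T -> T < t -> exists th p : R,
  [/\ 0 < th, th < pi / 2, 1 < p, p * th < pi / 2 & T < t * sin th].
Proof.
move=> T0 Tt; have t0 : 0 < t := le_lt_trans T0 Tt.
pose s := (T / t + 1) / 2.
have q0 : 0 <= T / t by rewrite divr_ge0// ltW.
have q1 : T / t < 1 by rewrite ltr_pdivrMr// mul1r.
have s0 : 0 < s by rewrite /s; lra.
have s1 : s < 1 by rewrite /s; lra.
have sN : -1 <= s <= 1 by apply/andP; split; lra.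
have hth : sin (asin s) = s by rewrite asinK// in_itv.
have thp : asin s < pi / 2 by rewrite asin_ltpi2// s1 andbT; lra.
have th0 : 0 < asin s.
  rewrite ltNge; apply/negP => th0.
  have : sin (asin s) <= 0.
    rewrite -oppr_ge0 -sinN; apply: sin_ge0_pi.
    rewrite oppr_ge0 th0/= lerNl (le_trans _ (asin_geNpi2 sN))// lerNl opprK.
    by rewrite ler_pdivrMr// ler_peMr// ?pi_ge0//; lra.
  by rewrite hth leNgt s0.
exists (asin s), ((1 + pi / 2 / asin s) / 2); split => //.
- have : 1 < pi / 2 / asin s by rewrite ltr_pdivlMr// mul1r.
  lra.
- have -> : (1 + pi / 2 / asin s) / 2 * asin s = (asin s + pi / 2) / 2.
    by field; rewrite gt_eqF.
  lra.
- by rewrite hth mulrC -ltr_pdivrMr// /s; lra.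
Qed.

Lemma sintegral_Im_bound K (eK : entire K) x c d M : c <= d ->
  (forall v, c <= v <= d -> cmod (K (x +i* v)) <= M) ->
  `|sintegral (fun v => Im (K (x +i* v))) c d| <= M * (d - c).
Proof.
move=> cd KM; apply: (sintegral_bound (Im_vert_continuous eK x) cd) => v hv.
by rewrite (le_trans (Im_le_cmod _))// KM.
Qed.

Lemma sintegral_Re_bound K (eK : entire K) x c d M : c <= d ->
  (forall u, c <= u <= d -> cmod (K (u +i* x)) <= M) ->
  `|sintegral (fun u => Re (K (u +i* x))) c d| <= M * (d - c).
Proof.
move=> cd KM; apply: (sintegral_bound (Re_horiz_continuous eK x) cd) => v hv.
by rewrite (le_trans (Re_le_cmod _))// KM.
Qed.

Lemma sintegral_ReB K1 K2 (e1 : entire K1) (e2 : entire K2) x c d :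
  sintegral (fun u => Re (K1 (u +i* x) + - K2 (u +i* x))) c d =
  sintegral (fun u => Re (K1 (u +i* x))) c d - sintegral (fun u => Re (K2 (u +i* x))) c d.
Proof.
rewrite -(sintegralB c d (Re_horiz_continuous e1 x) (Re_horiz_continuous e2 x)).
by congr (sintegral _ _ _); apply/funext => u; rewrite ReB.
Qed.

(* On the sides of the logarithmic rectangle the factor e^(-eps x^p) must beat
   e^(T|x|) for |x| = e^n, while eps must be negligible on the ray of angle th,
   where the integrand already decays exponentially; eps ~ e^((1-p)n) does both. *)
Lemma ray_shift T t : 0 <= T -> T < t ->
  exists p, exists eps : nat -> R, [/\ forall n, 0 <= eps n,
    eps @ \oo --> (0 : R) &
  forall (F : R[i] -> R[i]) C psi, entire F ->
   (forall z, cmod (F z) <= C * expR (T * cmod z)) ->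
   (fun n : nat => sintegral (fun u => Re (logint F t psi (eps n) p (u +i* 0))) (- n%:R) n%:R
    - sintegral (fun u => Re (logint F t psi 0 p (u +i* (pi / 2)))) (- n%:R) n%:R)
     @ \oo --> (0 : R)].
Proof.
move=> T0 Tt; have t0 : 0 < t := le_lt_trans T0 Tt.
have [th [p [th0 thp p1 pthp Tth]]] := sector_params T0 Tt.
pose k := t * sin th - T; have k0 : 0 < k by rewrite /k subr_gt0.
pose c := cos (p * th).
have pth0 : 0 < p * th by rewrite mulr_gt0//; lra.
have c0 : 0 < c.
  by apply: cos_gt0_pihalf; rewrite pthp andbT; have := @pi_gt0 R; lra.
(* On the right side eps x^p then has real part at least (T + 1) e^n: T compensates the growth of F
   and the spare 1 leaves e^(-e^n). *)
pose eps n := (T + 1) / c * expR (- ((p - 1) * n%:R)).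
have e0 n : 0 <= eps n.
  by rewrite mulr_ge0 ?expR_ge0// divr_ge0 ?(ltW c0)//; lra.
have p10 : 0 < p - 1 by rewrite subr_gt0.
have epsC : eps @ \oo --> (0 : R).
  rewrite -[0](mulr0 ((T + 1) / c)).
  by apply: cvgM; [exact: cvg_cst|exact: cvg_expR_geo].
exists p, eps; split => // F C psi eF FC.
have C0 : 0 <= C.
  have := le_trans (cmod_ge0 _) (FC 0).
  by rewrite cmod0 mulr0 expR0 mulr1.
(* Exponent p + 1 absorbs e^(p u) from [logint_eps] together with the Jacobian e^u; exponent 2
   absorbs the Jacobian e^n and leaves a factor e^(-n). *)
have [M1 HM1] := @affine_expR_bound R k (p + 1) k0 ltac:(lra).
have [M2 HM2] := @affine_expR_bound R k 2 k0 ltac:(lra).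
have [M3 HM3] := @affine_expR_bound R 1 2 ltr01 ltac:(lra).
have pip := @pi_gt0 R.
have pv v : 0 <= v -> v <= th -> [/\ 0 <= p * v, p * v <= p * th & p * th <= pi].
  move=> v0 vth; split; last by lra.
    by rewrite mulr_ge0//; lra.
  by rewrite ler_wpM2l//; lra.
have sv v : 0 <= v -> v <= th -> 0 <= sin v.
  by move=> v0 vth; rewrite sin_ge0_pi// v0/=; lra.
pose K n := logint F t psi (eps n) p; pose K0 := logint F t psi 0 p.
have eK n : entire (K n) by exact: entire_logint.
have eK0 : entire K0 by exact: entire_logint.
have nN (n : nat) : - n%:R <= n%:R :> R by rewrite ge0_cp.
(* [a1] and [a2] bound the right and left sides of the damped rectangle 0 <= v <= th, [a3] the
   effect of dropping the damping on the common side v = th, [a4] and [a5] the right and left sides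
   of the undamped rectangle th <= v <= pi / 2. *)
pose a1 n : R := C * (M3 * expR (- (1 * n%:R))).
pose a2 n : R := C * (expR T * expR (- (1 * n%:R))).
pose a3 n : R := 18 * eps n * (C * M1).
pose a4 n : R := C * (M2 * expR (- (1 * n%:R))).
pose a5 n : R := C * expR (- (1 * n%:R)).
have S1 n v : 0 <= v <= th -> cmod (K n (n%:R +i* v)) <= a1 n.
  move=> /andP[v0 vth].
  rewrite (le_trans (logint_bound t psi (eps n) p n%:R v FC))// ler_wpM2l//.
  apply: (@le_trans _ _ (expR (- (1 * expR n%:R) + 2 * n%:R) * expR (- (1 * n%:R)))); last first.
    by rewrite ler_wpM2r ?expR_ge0.
  rewrite -expRD ler_expR.
  have h1 : 0 <= t * (expR n%:R * sin v).
    by rewrite mulr_ge0 ?(ltW t0)// mulr_ge0 ?expR_ge0// sv.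
  have h2 : (T + 1) * expR n%:R <= eps n * (expR (p * n%:R) * cos (p * v)).
    have -> : eps n * (expR (p * n%:R) * cos (p * v)) =
        (T + 1) / c * (expR n%:R * cos (p * v)).
      rewrite /eps -mulrA; congr (_ * _); rewrite mulrA -expRD.
      by congr (expR _ * _); ring.
    rewrite -mulrA ler_wpM2l//; first by lra.
    rewrite ler_pdivlMl// mulrC ler_wpM2l ?expR_ge0// /c; have [? ? ?] := pv v v0 vth.
    by apply: le_cos_pi; lra.
  by move: h1 h2; rewrite mulrDl mul1r; lra.
have S2 n v : 0 <= v <= th -> cmod (K n (- n%:R +i* v)) <= a2 n.
  move=> /andP[v0 vth].
  rewrite (le_trans (logint_bound t psi (eps n) p (- n%:R) v FC))// ler_wpM2l//.
  rewrite -expRD ler_expR.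
  have h1 : 0 <= t * (expR (- n%:R) * sin v).
    by rewrite mulr_ge0 ?(ltW t0)// mulr_ge0 ?expR_ge0// sv.
  have h2 : 0 <= eps n * (expR (p * - n%:R) * cos (p * v)).
    rewrite mulr_ge0// mulr_ge0 ?expR_ge0//; have [? ? ?] := pv v v0 vth.
    by apply: cos_ge0_pihalf; lra.
  have h3 : T * expR (- n%:R) <= T.
    by rewrite ler_piMr// -expR0 ler_expR oppr_le0.
  lra.
have S3 n u : cmod (K n (u +i* th) - K0 (u +i* th)) <= a3 n.
  rewrite (le_trans (logint_eps F t psi u (e0 n) (ltW c0)))//.
  rewrite /a3 -[leLHS]mulrA ler_wpM2l//; first by rewrite mulr_ge0.
  apply: (@le_trans _ _ (expR (p * u) *
     (C * expR (T * expR u - t * (expR u * sin th) - 0 * (expR (p * u) * cos (p * th)) + u)))).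
    by rewrite ler_wpM2l ?expR_ge0//; exact: logint_bound.
  rewrite mulrCA ler_wpM2l// -expRD (le_trans _ (HM1 u))// ler_expR /k.
  by rewrite le_eqVlt; apply/orP; left; apply/eqP; ring.
have sth v : th <= v -> v <= pi / 2 -> sin th <= sin v.
  by move=> ? ?; apply: le_sin_pihalf => //; lra.
have Sk u v : th <= v <= pi / 2 -> cmod (K0 (u +i* v)) <= C * expR (- (k * expR u) + u).
  move=> /andP[v0 vth].
  rewrite (le_trans (logint_bound t psi 0 p u v FC))// ler_wpM2l//.
  rewrite ler_expR mul0r subr0 lerD2r.
  have : t * (expR u * sin th) <= t * (expR u * sin v).
    by rewrite ler_wpM2l ?(ltW t0)// ler_wpM2l ?expR_ge0// sth.
  by rewrite /k => h; rewrite mulrBl -mulrA (mulrC (sin th)); lra.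
have S4 (n : nat) v : th <= v <= pi / 2 -> cmod (K0 (n%:R +i* v)) <= a4 n.
  move=> /Sk/le_trans; apply; rewrite ler_wpM2l//.
  apply: (@le_trans _ _ (expR (- (k * expR n%:R) + 2 * n%:R) * expR (- (1 * n%:R)))); last first.
    by rewrite ler_wpM2r ?expR_ge0.
  by rewrite -expRD ler_expR; lra.
have S5 (n : nat) v : th <= v <= pi / 2 -> cmod (K0 (- n%:R +i* v)) <= a5 n.
  move=> /Sk/le_trans; apply; rewrite ler_wpM2l// ler_expR.
  have kn0 : 0 <= k * expR (- n%:R) by rewrite mulr_ge0 ?expR_ge0// ltW.
  lra.
pose B n := (a1 n + a2 n) * th + a3 n * (2 * n%:R) + (a4 n + a5 n) * (pi / 2 - th).
apply: (@squeeze_norm_cvg0 _ B) => [n|].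
  have G1 := goursat (eK n) (nN n) (ltW th0).
  have G2 := goursat eK0 (nN n) (ltW thp).
  have I1 : `|sintegral (fun v => Im (K n (n%:R +i* v))) 0 th| <= a1 n * (th - 0).
    exact: (@sintegral_Im_bound _ (eK n) n%:R _ _ _ (ltW th0) (S1 n)).
  have I2 : `|sintegral (fun v => Im (K n (- n%:R +i* v))) 0 th| <= a2 n * (th - 0).
    exact: (@sintegral_Im_bound _ (eK n) (- n%:R) _ _ _ (ltW th0) (S2 n)).
  have I4 : `|sintegral (fun v => Im (K0 (n%:R +i* v))) th (pi / 2)| <= a4 n * (pi / 2 - th).
    exact: (@sintegral_Im_bound _ eK0 n%:R _ _ _ (ltW thp) (S4 n)).
  have I5 : `|sintegral (fun v => Im (K0 (- n%:R +i* v))) th (pi / 2)| <= a5 n * (pi / 2 - th).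
    exact: (@sintegral_Im_bound _ eK0 (- n%:R) _ _ _ (ltW thp) (S5 n)).
  have eD : entire (fun z => K n z + - K0 z) := entireD (eK n) (entireN eK0).
  have I3 := @sintegral_Re_bound _ eD th _ _ _ (nN n) (fun u _ => S3 n u).
  rewrite (sintegral_ReB (eK n) eK0) in I3.
  move: G1 G2 I1 I2 I3 I4 I5; rewrite /contour /B -/(K n) -/K0.
  do !move: (sintegral _ _ _) => ?; rewrite !ler_norml => G1 G2.
  move=> /andP[? ?] /andP[? ?] /andP[? ?] /andP[? ?] /andP[? ?].
  by apply/andP; split; lra.
have geo r (A : R) : 0 < r -> (fun n : nat => A * expR (- (r * n%:R))) @ \oo --> (0 : R).
  move=> r0; rewrite -[0](mulr0 A).
  by apply: cvgM; [exact: cvg_cst|exact: cvg_expR_geo].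
have Z3 : (fun n => a3 n * (2 * n%:R)) @ \oo --> (0 : R).
  (* The common side has length 2 n; half of the decay of [eps n] pays for this factor. *)
  pose q := (p - 1) / 2; have q0 : 0 < q by rewrite /q; lra.
  have M10 : 0 <= M1 by rewrite (le_trans _ (HM1 0))// expR_ge0.
  have Tc0 : 0 <= (T + 1) / c by rewrite divr_ge0 ?(ltW c0)//; lra.
  pose A := 18 * ((T + 1) / c) * (C * M1) * (2 / q).
  apply: (@squeeze_norm_cvg0 _ (fun n => A * expR (- (q * n%:R)))); last exact: geo.
  move=> n; rewrite ger0_norm; last first.
    have a30 : 0 <= a3 n by rewrite /a3 mulr_ge0// mulr_ge0.
    by rewrite mulr_ge0// mulr_ge0.
  have hn : n%:R <= expR (q * n%:R) / q.
    rewrite ler_pdivlMr// mulrC; have := expR_ge1Dx (q * n%:R); lra.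
  have E : expR (- ((p - 1) * n%:R)) = expR (- (q * n%:R)) * expR (- (q * n%:R)).
    by rewrite -expRD; congr expR; rewrite /q; field.
  rewrite /a3 /eps E.
  have -> : 18 * ((T + 1) / c * (expR (- (q * n%:R)) * expR (- (q * n%:R)))) * (C * M1) * (2 * n%:R)
    = 18 * ((T + 1) / c) * (C * M1) * expR (- (q * n%:R)) * (2 * (expR (- (q * n%:R)) * n%:R)).
    by ring.
  have -> : A * expR (- (q * n%:R)) = 18 * ((T + 1) / c) * (C * M1) * expR (- (q * n%:R)) * (2 / q).
    by rewrite /A; ring.
  have X0 : 0 <= 18 * ((T + 1) / c) * (C * M1) * expR (- (q * n%:R)).
    by apply: mulr_ge0; [apply: mulr_ge0; exact: mulr_ge0|exact: expR_ge0].
  apply: (ler_wpM2l X0); apply: ler_wpM2l => //.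
  rewrite (le_trans (ler_wpM2l (expR_ge0 _) hn))// mulrA -expRD addNr expR0.
  by rewrite mul1r.
have Z1 (a b : nat -> R) (s : R) : a @ \oo --> (0 : R) -> b @ \oo --> (0 : R) ->
   (fun n => (a n + b n) * s) @ \oo --> (0 : R).
  by move=> ha hb; have := cvgM (cvgD ha hb) (cvg_cst s); rewrite addr0 mul0r => H; exact: H.
have geo2 (A A' : R) : (fun n : nat => A * (A' * expR (- (1 * n%:R)))) @ \oo --> (0 : R).
  by under eq_fun do rewrite mulrA; exact: geo.
have za1 : a1 @ \oo --> (0 : R) by exact: geo2.
have za2 : a2 @ \oo --> (0 : R) by exact: geo2.
have za4 : a4 @ \oo --> (0 : R) by exact: geo2.
have za5 : a5 @ \oo --> (0 : R) by exact: geo.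
have := cvgD (cvgD (Z1 _ _ th za1 za2) Z3) (Z1 _ _ (pi / 2 - th) za4 za5).
by rewrite !addr0 => H; exact: H.
Qed.

End RayShift.

(** * Returning to the variable x = e^u *)

Section RealAxis.
Context {R : realType}.
Notation mu := (@lebesgue_measure R).
Implicit Types (x y a b c e t : R) (z w h : R[i]).
Notation Re := (@complex.Re R).
Notation Im := (@complex.Im R).

(** The factor e^(-eps |x|^p), even so that it serves both half-lines. At 0 the default [ln 0 = 0]
    gives e^(-eps), hence continuity is stated only for nonzero [x]. *)
Definition damp (eps p x : R) : R := expR (- (eps * expR (p * ln `|x|))).

Lemma damp_le1 eps p x : 0 <= eps -> damp eps p x <= 1.
Proof.
by move=> e0; rewrite /damp -expR0 ler_expR oppr_le0 mulr_ge0// expR_ge0.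
Qed.

Lemma damp_continuous eps p x : x != 0 -> {for x, continuous (damp eps p)}.
Proof.
move=> x0; have nx0 : 0 < `|x| by rewrite normr_gt0.
rewrite /damp; apply: (continuous_comp _ (@continuous_expR R _)).
apply: continuousN; apply: continuousM; first exact: cst_continuous.
apply: (continuous_comp _ (@continuous_expR R _)).
apply: continuousM; first exact: cst_continuous.
apply: (continuous_comp (@norm_continuous _ _ x)).
exact: continuous_ln.
Qed.

Lemma measurable_damp eps p : measurable_fun setT (damp eps p).
Proof.
rewrite /damp; apply: (measurableT_comp (continuous_measurable_fun (@continuous_expR R))).
apply: measurableT_comp => //; apply: measurable_funM => //.
apply: (measurableT_comp (continuous_measurable_fun (@continuous_expR R))).
apply: measurable_funM => //; apply: (measurableT_comp (@measurable_ln R)) => //.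
Qed.

Lemma damp_cvg (eps : nat -> R) p x : eps @ \oo --> (0 : R) ->
  (fun n => damp (eps n) p x) @ \oo --> (1 : R).
Proof.
move=> e0; rewrite -expR0 -[0]oppr0 -(mul0r (expR (p * ln `|x|))).
apply: (continuous_cvg _ (@continuous_expR R _)).
by apply: cvgN; apply: cvgM => //; exact: cvg_cst.
Qed.

Section Fix.
Variables (F : R[i] -> R[i]) (eF : entire F).
Hypothesis Fconj : forall z, F (conjc z) = conjc (F z).

Let r x := Re (F x%:C).

Lemma selfadjoint_real x : F x%:C = (r x)%:C.
Proof.
have := Fconj x%:C; rewrite conjc_real /r; case: (F _) => a b [] /= /eqP.
by rewrite -addr_eq0 -mulr2n mulrn_eq0 /= => /eqP ->.
Qed.

Lemma Re_on_reals_continuous : continuous r.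
Proof. exact: (Re_horiz_continuous eF 0). Qed.

Lemma mul_cos_continuous t psi : continuous (fun x => r x * cos (t * x + psi)).
Proof.
move=> x; apply: continuousM; first exact: Re_on_reals_continuous.
apply: (continuous_comp _ (@continuous_cos R _)).
apply: continuousD; last exact: cst_continuous.
by apply: continuousM; [exact: cst_continuous|exact: cvg_id].
Qed.

Lemma mul_cos_damp_continuous t psi eps p x : x != 0 ->
  {for x, continuous (fun x => r x * cos (t * x + psi) * damp eps p x)}.
Proof.
move=> x0; apply: continuousM; first exact: mul_cos_continuous.
exact: damp_continuous.
Qed.

Lemma logint_real t psi eps p u : Re (logint F t psi eps p (u +i* 0)) =
  r (expR u) * cos (t * expR u + psi) * damp eps p (expR u) * expR u.
Proof.
have ce : cexp (u +i* 0) = (expR u)%:C.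
  by apply: complex_ReIm; rewrite /= ?cos0 ?sin0 ?mulr1 ?mulr0.
rewrite /logint ce selfadjoint_real; set X := 'i%C * _ - _ + _.
have cp : cexp (p%:C * (u +i* 0)) = (expR (p * u))%:C.
  apply: complex_ReIm; rewrite /= ?ReIm_simp/= !(mul0r, mulr0, subr0, addr0).
    by rewrite cos0 mulr1.
  by rewrite sin0 mulr0.
have RX : Re X = - (eps * expR (p * u)) + u.
  by rewrite /X cp !ReIm_simp/= !(mul0r, mulr0, subr0, sub0r, add0r, addr0, oppr0).
have IX : Im X = t * expR u + psi.
  rewrite /X cp !ReIm_simp/= !(mul0r, mulr0, mul1r, subr0, sub0r, add0r, addr0, oppr0).
  by rewrite addrC.
have -> : Re ((r (expR u))%:C * cexp X) = r (expR u) * (expR (Re X) * cos (Im X)).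
  rewrite ReM /=; ring.
rewrite RX IX expRD /damp ger0_norm ?expR_ge0// expRK; ring.
Qed.

(** The Jacobian of x = e^u is the summand [z] in the exponent of [logint]. *)
Lemma logint_Rintegral t psi eps p (n : nat) :
  sintegral (fun u => Re (logint F t psi eps p (u +i* 0))) (- n%:R) n%:R =
  \int[mu]_(x in `[expR (- n%:R), expR n%:R])
    (r x * cos (t * x + psi) * damp eps p x).
Proof.
have nN : - n%:R <= n%:R :> R by rewrite ge0_cp.
rewrite -(sintegral_Rintegral (Re_horiz_continuous (@entire_logint R F t psi eps p eF) 0) nN).
have dE : derive1 (@expR R) = expR by apply/funext => x; rewrite derive1E derive_val.
rewrite /Rintegral (@integration_by_substitution_increasing R expR
   (fun x => r x * cos (t * x + psi) * damp eps p x) (- n%:R) n%:R nN).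
- congr fine; apply: eq_integral => u _; congr EFin.
  by rewrite dE fctE/= logint_real.
- by move=> x y _ _; rewrite ltr_expR.
- by move=> x _; rewrite dE; exact: continuous_expR.
- by rewrite dE; apply/cvg_ex; eexists; apply: cvg_at_right_filter; exact: continuous_expR.
- by rewrite dE; apply/cvg_ex; eexists; apply: cvg_at_left_filter; exact: continuous_expR.
- split; [by move=> x _; exact: derivable_expR| |].
    by apply: cvg_at_right_filter; exact: continuous_expR.
  by apply: cvg_at_left_filter; exact: continuous_expR.
apply: continuous_in_subspaceT => x; rewrite inE/= in_itv/= => /andP[xn _].
have x0 : x != 0 by rewrite gt_eqF// (lt_le_trans _ xn)// expR_gt0.
exact: (@mul_cos_damp_continuous t psi eps p x).
Qed.

End Fix.
End RealAxis.

(** * Vanishing of the cosine integrals *)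

Section Vanishing.
Context {R : realType}.
Notation mu := (@lebesgue_measure R).
Implicit Types (x y a b c e t : R) (z w h : R[i]).
Notation Re := (@complex.Re R).
Notation Im := (@complex.Im R).

Lemma integrable_le (f g : R -> R) : measurable_fun setT f ->
  (forall x, `|f x| <= g x) -> mu.-integrable setT (EFin \o g) ->
  mu.-integrable setT (EFin \o f).
Proof.
move=> mf fg; apply: le_integrable => //; first exact/measurable_EFinP.
by move=> x _ /=; rewrite lee_fin (le_trans (fg x))// ler_norm.
Qed.

Lemma entire_opp F : @entire R F -> entire (fun z => F (- z)).
Proof. by move=> eF; exact: (entire_comp eF (entireN (@entire_id R))). Qed.

(** On the imaginary axis dx contributes a factor i. With w = F(iy) e^(i psi), the two integrands
    are the same real factor times i w and i conj(w), because F(-iy) = conj(F(iy)); and i (w +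
    conj(w)) is purely imaginary. *)
Lemma logint_imag F t psi p u : (forall z, F (conjc z) = conjc (F z)) ->
  Re (logint (fun z => F (- z)) t (- psi) 0 p (u +i* (pi / 2))) =
  - Re (logint F t psi 0 p (u +i* (pi / 2))).
Proof.
move=> Fconj; rewrite /logint.
have -> : cexp (u +i* (pi / 2)) = 0 +i* expR u.
  by apply: complex_ReIm; rewrite /= ?cos_pihalf ?sin_pihalf ?mulr0 ?mulr1.
have -> : - (0 +i* expR u) = conjc (0 +i* expR u).
  by apply: complex_ReIm; rewrite /= ?oppr0.
rewrite Fconj; case: (F _) => a b.
have E ps : 'i%C * (ps%:C + t%:C * (0 +i* expR u)) - 0%:C * cexp (p%:C * (u +i* (pi / 2)))
     + (u +i* (pi / 2)) = (u - t * expR u) +i* (ps + pi / 2).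
  rewrite mul0r; apply: complex_ReIm; rewrite !ReIm_simp/=; ring.
rewrite !E /cexp !ReM/= !cosDpihalf !sinDpihalf sinN cosN; ring.
Qed.

(* Both half-lines are rotated onto the imaginary axis, where the two integrands
   have opposite real parts (logint_imag). *)
Theorem integral_cos_vanish (F : R[i] -> R[i]) T t psi C :
  entire F -> (forall z, F (conjc z) = conjc (F z)) ->
  (forall z, cmod (F z) <= C * expR (T * cmod z)) -> 0 <= T -> T < t ->
  mu.-integrable setT (EFin \o (fun x => Re (F x%:C))) ->
  \int[mu]_x (Re (F x%:C) * cos (t * x + psi)) = 0.
Proof.
move=> eF Fconj FC T0 Tt ir.
have [p [eps [eps0 epsC shift]]] := ray_shift T0 Tt.
pose r x := Re (F x%:C); pose h x := r x * cos (t * x + psi).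
pose G n x := h x * damp (eps n) p x.
pose P n : set R := `[expR (- n%:R), expR n%:R]%classic.
pose N n : set R := `[- expR n%:R, - expR (- n%:R)]%classic.
have mh : measurable_fun setT h.
  by apply: continuous_measurable_fun; exact: mul_cos_continuous.
have mG n : measurable_fun setT (G n).
  by apply: measurable_funM => //; exact: measurable_damp.
have hr x : `|h x| <= `|r x|.
  by rewrite normrM ler_piMr// cos_max.
have Gh n x : `|G n x| <= `|h x|.
  by rewrite normrM ler_piMr// ger0_norm ?damp_le1// expR_ge0.
have inr : mu.-integrable setT (EFin \o (fun x => `|r x|)).
  have := integrable_norm ir; exact.
have ih : mu.-integrable setT (EFin \o h) by exact: integrable_le mh hr inr.
have inh : mu.-integrable setT (EFin \o (fun x => `|h x|)).
  have := integrable_norm ih; exact.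
have iG n : mu.-integrable setT (EFin \o G n) by exact: integrable_le (mG n) (Gh n) inh.
have mP n : measurable (P n : set (measurableTypeR R)) by exact: measurable_itv.
have mN n : measurable (N n : set (measurableTypeR R)) by exact: measurable_itv.
have eN n : expR (- n%:R) <= expR n%:R :> R by rewrite ler_expR ge0_cp.
have PN n : [disjoint P n & N n].
  apply/disj_setPS => x []; rewrite /P /N /= !in_itv/= => /andP[h1 _] /andP[_ h2].
  by have := expR_gt0 (- n%:R : R); lra.
(* The two imaginary-axis integrals are inserted for free, being opposite; each bracket is then an
   instance of [shift]. *)
have IPN n : \int[mu]_x ((G n) \_ (P n `|` N n)) x =
    (sintegral (fun u => Re (logint F t psi (eps n) p (u +i* 0))) (- n%:R) n%:R
    - sintegral (fun u => Re (logint F t psi 0 p (u +i* (pi / 2)))) (- n%:R) n%:R)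
   + (sintegral (fun u => Re (logint (fun z => F (- z)) t (- psi) (eps n) p (u +i* 0))) (- n%:R) n%:R
    - sintegral (fun u => Re (logint (fun z => F (- z)) t (- psi) 0 p (u +i* (pi / 2)))) (- n%:R) n%:R).
  have -> : (fun u => Re (logint (fun z => F (- z)) t (- psi) 0 p (u +i* (pi / 2)))) =
      (fun u => - Re (logint F t psi 0 p (u +i* (pi / 2)))).
    by apply/funext => u; exact: logint_imag.
  rewrite (sintegralN _ _ (Re_horiz_continuous (@entire_logint R F t psi 0 p eF) (pi / 2))).
  rewrite -Rintegral_mkcond Rintegral_setU//; last first.
    exact: (integrableS measurableT (measurableU _ _ (mP n) (mN n)) (@subsetT _ _) (iG n)).
  rewrite (logint_Rintegral eF Fconj) (logint_Rintegral (entire_opp eF)); last first.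
    by move=> z; rewrite -Fconj rmorphN.
  have E (a1 a2 b1 b2 k : R) : a1 = b1 -> a2 = b2 -> a1 + a2 = b1 - k + (b2 - - k).
    by move=> -> ->; ring.
  apply: E; first by rewrite /P /G /h /r.
  rewrite /N.
  rewrite /Rintegral; apply: (f_equal fine).
  rewrite (@integration_by_substitution_oppr R (G n) _ _ (eN n)).
    apply: eq_integral => x _; congr EFin; rewrite /= /G /h /r /damp normrN.
    rewrite rmorphN/=; congr (_ * _ * _).
    by rewrite -cosN; congr cos; ring.
  apply: continuous_in_subspaceT => x; rewrite inE/= in_itv/= => /andP[_ xn].
  apply: mul_cos_damp_continuous => //.
  by rewrite lt_eqF// (le_lt_trans xn)// oppr_lt0 expR_gt0.
have L0 : (fun n => \int[mu]_x ((G n) \_ (P n `|` N n)) x) @ \oo --> (0 : R).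
  under eq_fun do rewrite IPN.
  have FC' z : cmod (F (- z)) <= C * expR (T * cmod z) by rewrite -(cmodN z) FC.
  have := cvgD (shift F C psi eF FC) (shift _ C (- psi) (entire_opp eF) FC').
  by rewrite addr0 => H; exact: H.
(* The point 0 lies in no [P n] and no [N n], so pointwise convergence holds only off 0. *)
have ae0 : \forall x \ae mu, x != 0.
  exists [set 0]; split; [exact: measurable_set1|exact: lebesgue_measure_set1|].
  by move=> x /= /negP; rewrite negbK => /eqP.
have m1 n : measurable_fun [set: measurableTypeR R] (EFin \o (G n \_ (P n `|` N n))).
  apply/measurable_EFinP; apply/(measurable_restrictT _ (measurableU _ _ (mP n) (mN n))).
  exact: measurable_funS (mG n).
have m2 : measurable_fun [set: measurableTypeR R] (EFin \o h) by exact/measurable_EFinP.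
have c1 : \forall x \ae mu, [set: measurableTypeR R] x ->
    (EFin \o (G n \_ (P n `|` N n))) x @[n --> \oo] --> (EFin \o h) x.
  move: ae0; apply: filterS; first exact: (ae_filter_ringOfSetsType mu).
  move=> x x0 _; apply: cvg_EFin; first exact: nearW.
  have nx0 : 0 < `|x| by rewrite normr_gt0.
  have : (fun n => G n x) @ \oo --> h x.
    have := cvgM (cvg_cst (h x)) (damp_cvg p x epsC).
    by rewrite mulr1 => H; exact: H.
  apply: cvg_trans; apply: near_eq_cvg; near=> n.
  rewrite /= patchE ifT// inE.
  have h1 : `|x| <= expR n%:R.
    rewrite (@le_trans _ _ n%:R)//; last first.
      by have := expR_ge1Dx (n%:R : R); lra.
    by near: n; exact: nbhs_infty_ger.
  have h2 : expR (- n%:R) <= `|x|.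
    rewrite expRN -[leRHS]invrK lef_pV2 ?posrE ?expR_gt0 ?invr_gt0//.
    rewrite (@le_trans _ _ n%:R)//; last first.
      by have := expR_ge1Dx (n%:R : R); lra.
    by near: n; exact: nbhs_infty_ger.
  have [xp|xn] := leP 0 x.
    by left; rewrite /P /= in_itv/=; move: h1 h2; rewrite ger0_norm// => -> ->.
  right; rewrite /N /= in_itv/= lerNl lerNr.
  by move: h1 h2; rewrite ltr0_norm// => -> ->.
have d1 : \forall x \ae mu, forall n, [set: measurableTypeR R] x ->
    (`|(EFin \o (G n \_ (P n `|` N n))) x| <= (EFin \o (fun x => `|h x|%R)) x)%E.
  apply: aeW => x n _; rewrite /= lee_fin patchE.
  by case: ifP => _; [exact: Gh|rewrite normr0].
have [_ _ L] := dominated_convergence measurableT m1 m2 c1 inh d1.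
have fh : (\int[mu]_x (EFin \o h) x)%E \is a fin_num by exact: integrable_fin_num.
rewrite -(fineK fh) in L.
have L1 := fine_cvg L.
exact: (cvg_unique (@Rhausdorff R) (L1 _) L0).
Unshelve. all: by end_near. Qed.

End Vanishing.

(** * Entire functions vanishing on the reals *)

Section Identity.
Context {R : realType}.
Implicit Types (x y a b c e t : R) (z w : R[i]) (f h : R[i] -> R[i]).
Notation Re := (@complex.Re R).
Notation Im := (@complex.Im R).

(** In the coordinate z = w + e^zeta circles about [w] are vertical segments, and the horizontal
    sides cancel by periodicity. So the mean of h - h(w) over a circle is independent of the radius,
    and it tends to 0 with the radius. The factor i in [K] turns the real part into the imaginary
    part that [contour] integrates on vertical sides. *)
Lemma mean_value_bound h w (r M : R) : entire h -> 0 < r ->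
  (forall z, cmod (z - w) = r -> cmod (h z) <= M) -> `|Re (h w)| <= M.
Proof.
move=> eh r0 hM; pose b := ln r; have eb : expR b = r by rewrite lnK.
pose tp : R := 2 * pi; have pip := @pi_gt0 R; have tp0 : 0 < tp by rewrite mulr_gt0.
have tpE : tp = pi *+ 2 by rewrite /tp mulr_natl.
pose g z := h z + - h w.
have eg : entire g.
  by apply: entireD eh _; apply: entireN; exact: entire_cst.
pose K z := 'i%C * g (w + cexp z).
have eK : entire K.
  apply: entireM; first exact: entire_cst.
  apply: (entire_comp eg); apply: entireD; first exact: entire_cst.
  exact: entire_cexp.
have ImK z : Im (K z) = Re (h (w + cexp z)) - Re (h w).
  by rewrite /K /g !ReIm_simp/= mul0r mul1r add0r.
have per a : a <= b -> sintegral (fun v => Im (K (b +i* v))) 0 tp = sintegral (fun v => Im (K (a +i* v))) 0 tp.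
  move=> ab; have := goursat eK ab (ltW tp0); rewrite /contour.
  have -> : (fun u => Re (K (u +i* tp))) = (fun u => Re (K (u +i* 0))).
    apply/funext => u; congr (Re ('i%C * g (w + _))).
    by apply: complex_ReIm; rewrite /= tpE ?cos2pi ?sin2pi ?cos0 ?sin0.
  by rewrite subrr sub0r addrC => /eqP; rewrite subr_eq0 => /eqP ->.
have small e : 0 < e -> `|sintegral (fun v => Im (K (b +i* v))) 0 tp| <= e * tp.
  move=> e0; have [d d0 Hd] := entire_continuous eh w e0.
  pose a := Num.min b (ln (d / 2)).
  have ea : expR a < d.
    rewrite (@le_lt_trans _ _ (d / 2))//; last by rewrite ltr_pdivrMr//; lra.
    by rewrite -[leRHS]lnK ?posrE ?divr_gt0// ler_expR ge_min lexx orbT.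
  rewrite (@per a) ?ge_min ?lexx// -[X in _ <= e * X]subr0.
  apply: (sintegral_Im_bound eK (ltW tp0)) => v _.
  rewrite /K cmodM cmodi mul1r /g ltW// Hd// addrAC subrr add0r cmod_cexp.
  exact: ea.
have II0 : sintegral (fun v => Im (K (b +i* v))) 0 tp = 0.
  apply/eqP; rewrite -normr_le0; apply/ler_addgt0Pr => e e0; rewrite add0r.
  rewrite (le_trans (small (e / tp) _)) ?divr_gt0// divfK ?gt_eqF//.
pose H z := 'i%C * h (w + cexp z).
have eH : entire H.
  apply: entireM; first exact: entire_cst.
  apply: (entire_comp eh); apply: entireD; first exact: entire_cst.
  exact: entire_cexp.
have ImH z : Im (H z) = Re (h (w + cexp z)) by rewrite /H !ReIm_simp/= mul0r mul1r add0r.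
have IIH : sintegral (fun v => Im (H (b +i* v))) 0 tp = Re (h w) * tp.
  have E : (fun v => Im (K (b +i* v))) = (fun v => Im (H (b +i* v)) - (Re (h w) + 0 * v)).
    by apply/funext => v; rewrite ImK ImH mul0r addr0.
  move: II0; rewrite E (sintegralB _ _ (Im_vert_continuous eH b)); last first.
    by move=> x; under eq_fun do rewrite mul0r addr0; exact: cst_continuous.
  by rewrite sintegral_affine => ?; lra.
have := @sintegral_Im_bound _ _ eH b 0 tp M (ltW tp0).
rewrite IIH subr0 normrM (gtr0_norm tp0) ler_pM2r//; apply => v _.
rewrite /H cmodM cmodi mul1r hM// addrAC subrr add0r cmod_cexp.
exact: eb.
Qed.

Lemma near_Im_gt0 z : 0 < Im z -> \forall w \near (z : R[i]^o), 0 < Im w.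
Proof.
move=> z0; apply/nbhs_ballP; exists (Im z)%:C => /=; first by rewrite ltcR.
move=> w; rewrite -ball_normE/= normc_cmod ltcR => zw.
have := le_lt_trans (Im_le_cmod _) zw; rewrite -ImB => /ltr_normlW; lra.
Qed.

Lemma near_Im_lt0 z : Im z < 0 -> \forall w \near (z : R[i]^o), Im w < 0.
Proof.
move=> z0; apply/nbhs_ballP; exists (- Im z)%:C => /=; first by rewrite ltcR oppr_gt0.
move=> w; rewrite -ball_normE/= normc_cmod ltcR => zw.
have := le_lt_trans (Im_le_cmod _) zw; rewrite -ImB => /ltr_normlP[? ?]; lra.
Qed.

Lemma derivable_exp (g : R[i]^o -> R[i]^o) z n : derivable g z 1 ->
  derivable (fun u => g u ^+ n : R[i]^o) z 1.
Proof.
move=> dg; elim: n => [|n IH].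
  rewrite (_ : (fun _ => _) = cst (1 : R[i]^o)); first exact: derivable_cst.
  by apply/funext => u; rewrite expr0.
rewrite (_ : (fun _ => _) = g * (fun u => g u ^+ n : R[i]^o)).
  exact: (derivableM dg IH).
by apply/funext => u; rewrite exprS.
Qed.

Section Upper.
Variables (f : R[i] -> R[i]) (C T : R).
Hypotheses (ef : entire f) (fR : forall x, f x%:C = 0) (T0 : 0 <= T).
Hypothesis fC : forall z, cmod (f z) <= C * expR (T * cmod z).

(* As f and f' vanish on the reals, extending by 0 below the real axis keeps the
   function entire; on a large circle around w the power is geometrically small. *)
Let quot w n z : R[i] :=
  if 0 < Im z then conjc (f w) * f z * ((w + 'i%C) / (z + 'i%C)) ^+ n else 0.

Let cmod_addi z : 0 < Im z -> 1 <= cmod (z + 'i%C).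
Proof.
move=> z0; rewrite (le_trans _ (Im_le_cmod _))// ImD/= ger0_norm; lra.
Qed.

Let addi_neq0 z : 0 < Im z -> z + 'i%C != 0.
Proof. by move=> z0; rewrite -cmod_gt0 (lt_le_trans ltr01)// cmod_addi. Qed.

Let entire_quot w n : entire (quot w n).
Proof.
move=> z; have [z0|z0|z0] := ltgtP (Im z) 0.
- apply: (@near_eq_derivable _ _ _ (cst (0 : R[i]^o))); last exact: derivable_cst.
  by move: (near_Im_lt0 z0); apply: filterS => u u0; rewrite /quot ltNge (ltW u0).
- apply: (@near_eq_derivable _ _ _
    (fun u : R[i]^o => conjc (f w) * f u * ((w + 'i%C) / (u + 'i%C)) ^+ n : R[i]^o)).
    by move: (near_Im_gt0 z0); apply: filterS => u u0; rewrite /quot u0.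
  have eL : entire (fun u : R[i] => u + 'i%C) :=
    @entireD R id (fun=> 'i%C) (@entire_id R) (entire_cst 'i%C).
  have dV : derivable (fun u : R[i]^o => (u + 'i%C)^-1 : R[i]^o) z 1.
    apply: (@derivableV _ _ (fun u : R[i]^o => u + 'i%C : R[i]^o)); first exact: addi_neq0.
    exact: eL.
  have dQ : derivable (fun u : R[i]^o => (w + 'i%C) / (u + 'i%C) : R[i]^o) z 1 :=
    derivableM (entire_cst (w + 'i%C) z) dV.
  have eA : entire (fun u => conjc (f w) * f u) := entireM (entire_cst _) ef.
  exact: (derivableM (eA z) (derivable_exp (n := n) dQ)).
have zx : z = (Re z)%:C by apply: complex_ReIm.
have fz : f z = 0 by rewrite zx fR.
have /derivable_cmodP[d Hd] := @ef z.
(* The derivative at a real point is computed along the real axis, where [f] vanishes; this makes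
   the two halves of [quot] fit together. *)
have d0 : d = 0.
  apply/eqP; rewrite -cmod_eq0 eq_le cmod_ge0 andbT.
  apply/ler_addgt0Pr => e e0; rewrite add0r.
  have [r r0 Hr] := Hd _ e0.
  have r20 : 0 < r / 2 by rewrite divr_gt0.
  have := Hr (r / 2)%:C; rewrite cmod_real gtr0_norm// => /(_ ltac:(lra)).
  rewrite fz zx -rmorphD/= fR subrr sub0r cmodN cmodM cmod_real gtr0_norm//.
  by rewrite ler_pM2r.
rewrite {}d0 in Hd.
apply/derivable_cmodP; exists 0 => e e0.
pose A := cmod (conjc (f w)) * cmod (w + 'i%C) ^+ n.
have A0 : 0 <= A by rewrite mulr_ge0 ?exprn_ge0 ?cmod_ge0.
have A1 : 0 < A + 1 by lra.
have [r r0 Hr] := Hd _ (divr_gt0 e0 A1).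
exists r => // k kr; rewrite mul0r subr0 {2}/quot z0 ltxx subr0.
have := Hr _ kr; rewrite fz mul0r !subr0 => fk.
rewrite /quot; case: ifPn => [zk|_]; last by rewrite cmod0 mulr_ge0 ?cmod_ge0// ltW.
rewrite cmodM cmodX !cmodM cmodV.
have h1 : (cmod (w + 'i%C) / cmod (z + k + 'i%C)) ^+ n <= cmod (w + 'i%C) ^+ n.
  rewrite lerXn2r ?nnegrE ?divr_ge0 ?cmod_ge0//.
  rewrite ler_pdivrMr; last by rewrite cmod_gt0 addi_neq0.
  by rewrite ler_peMr ?cmod_ge0// cmod_addi.
have h2 : (e / (A + 1) * cmod k) * A <= e * cmod k.
  rewrite mulrAC ler_wpM2r ?cmod_ge0// -mulrA ler_piMr ?(ltW e0)//.
  by rewrite mulrC ler_pdivrMr// mul1r; lra.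
rewrite (le_trans _ h2)// /A mulrCA -mulrA.
rewrite ler_wpM2l ?cmod_ge0// ler_pM ?cmod_ge0 ?exprn_ge0 ?divr_ge0 ?cmod_ge0//.
Qed.

(** The factor conj(f(w)) makes the value of [quot] at [w] equal to |f(w)|^2. With L = |w + i|, on
    the circle of radius 3 L about [w] one has |z + i| >= 2 L, so the mean value bound decays like
    2^(-n). *)
Lemma zero_on_upper_half w : 0 < Im w -> f w = 0.
Proof.
move=> w0; pose L := cmod (w + 'i%C).
have L1 : 1 <= L by exact: cmod_addi.
pose M := C * expR (T * (cmod w + 3 * L)).
have C0 : 0 <= C.
  have := le_trans (cmod_ge0 _) (fC 0).
  by rewrite cmod0 mulr0 expR0 mulr1.
have bound n : cmod (f w) ^+ 2 <= cmod (f w) * M / 2 ^+ n.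
  have -> : cmod (f w) ^+ 2 = `|Re (quot w n w)|.
    rewrite /quot w0 divff ?addi_neq0// expr1n mulr1.
    rewrite sqr_cmod; case: (f w) => a b /=; rewrite ger0_norm; first by ring.
    by rewrite mulNr opprK -!expr2 addr_ge0 ?sqr_ge0.
  apply: (@mean_value_bound _ w (3 * L)); [exact: entire_quot|lra|].
  move=> z zw.
  have B0 : 0 <= cmod (f w) * M / 2 ^+ n.
    by rewrite !mulr_ge0 ?cmod_ge0 ?expR_ge0// invr_ge0 exprn_ge0.
  rewrite /quot; case: ifPn => [z0|_]; last by rewrite cmod0.
  rewrite cmodM cmodX !cmodM cmodV -/L.
  have -> : cmod (conjc (f w)) = cmod (f w) by rewrite !cmodE; case: (f w) => a b /=; rewrite sqrrN.
  have h1 : cmod (f z) <= M.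
    rewrite (le_trans (fC z))// ler_wpM2l// ler_expR ler_wpM2l//.
    have -> : z = w + (z - w) by rewrite addrC subrK.
    by rewrite (le_trans (cmodD _ _))// zw.
  have h2 : L / cmod (z + 'i%C) <= 2^-1.
    rewrite ler_pdivrMr ?cmod_gt0 ?addi_neq0// ler_pdivlMl//.
    have := cmodB (z + 'i%C) (w + 'i%C).
    have -> : z + 'i%C - (w + 'i%C) = z - w by ring.
    by rewrite zw -/L; lra.
  have q0 : 0 <= L / cmod (z + 'i%C) by rewrite divr_ge0 ?cmod_ge0.
  have h3 : (L / cmod (z + 'i%C)) ^+ n <= 2^-1 ^+ n.
    by rewrite lerXn2r// nnegrE invr_ge0.
  have h4 : cmod (f w) * cmod (f z) <= cmod (f w) * M by rewrite ler_wpM2l ?cmod_ge0.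
  by rewrite -exprVn; apply: ler_pM => //; [rewrite mulr_ge0 ?cmod_ge0|exact: exprn_ge0].
apply/eqP; rewrite -cmod_eq0 -sqrf_eq0 eq_le sqr_ge0 andbT.
apply/ler_addgt0Pr => e e0; rewrite add0r.
pose B := cmod (f w) * M.
have B0 : 0 <= B by rewrite !mulr_ge0 ?cmod_ge0 ?expR_ge0.
have [n hn] : exists n : nat, B / e < 2 ^+ n.
  exists (Num.bound (B / e)); rewrite (lt_le_trans (archi_boundP _))//.
    by rewrite divr_ge0// ltW.
  by rewrite -natrX ler_nat ltnW// ltn_expl.
rewrite (le_trans (bound n))// -/B ler_pdivrMr ?exprn_gt0// mulrC -ler_pdivrMr//.
exact: ltW.
Qed.

End Upper.

(** It turns f <> 0 as a function on the plane into positive mass on the line. The lower half-plane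
    is reached through z -> -z. *)
Theorem entire_zero_on_reals f C T : entire f -> 0 <= T ->
  (forall z, cmod (f z) <= C * expR (T * cmod z)) ->
  (forall x, f x%:C = 0) -> f = cst 0.
Proof.
move=> ef T0 fC fR; apply/funext => z; have [z0|z0|z0] := ltgtP (Im z) 0.
- rewrite -(opprK z).
  apply: (@zero_on_upper_half (fun z => f (- z)) C T (entire_opp ef)) => //.
  + by move=> x; rewrite -rmorphN/= fR.
  + by move=> u; rewrite -(cmodN u) fC.
  + by rewrite ImN oppr_gt0.
- exact: (@zero_on_upper_half f C T).
- have -> : z = (Re z)%:C by apply: complex_ReIm.
  exact: fR.
Qed.

End Identity.

(** * Mean values against |f|^2 in the Paley-Wiener space *)

Section PaleyWiener.
Context {R : realType}.
Notation mu := (@lebesgue_measure R).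
Implicit Types (x y a b c e t s : R) (z w : R[i]) (f g : R[i] -> R[i]).
Notation Re := (@complex.Re R).
Notation Im := (@complex.Im R).

Definition sqmod f x : R := cmod (f x%:C) ^+ 2.

Lemma sqmod_ge0 f x : 0 <= sqmod f x. Proof. exact: sqr_ge0. Qed.

Lemma cmod_conjc z : cmod (conjc z) = cmod z.
Proof. by rewrite !cmodE; case: z => a b /=; rewrite sqrrN. Qed.

Lemma entire_conj f : entire f -> entire (fun z => conjc (f (conjc z))).
Proof.
move=> ef z; have /derivable_cmodP[d Hd] := ef (conjc z).
apply/derivable_cmodP; exists (conjc d) => e e0.
have [r r0 Hr] := Hd _ e0; exists r => // h hr.
rewrite -cmod_conjc in hr; have := Hr _ hr; rewrite cmod_conjc => H.
rewrite -cmod_conjc (le_trans _ H)//.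
by rewrite !rmorphB/= rmorphM/= !conjcK rmorphD/=.
Qed.

Definition selfconj f z : R[i] := f z * conjc (f (conjc z)).

Lemma selfconj_real f x : Re (selfconj f x%:C) = sqmod f x.
Proof.
rewrite /selfconj conjc_real /sqmod sqr_cmod; case: (f _) => a b /=; ring.
Qed.

Lemma entire_selfconj f : entire f -> entire (selfconj f).
Proof. by move=> ef; exact: (entireM ef (entire_conj ef)). Qed.

Lemma selfconjJ f z : selfconj f (conjc z) = conjc (selfconj f z).
Proof. by rewrite /selfconj rmorphM/= !conjcK mulrC. Qed.

Lemma sqmod_continuous f : entire f -> continuous (sqmod f).
Proof.
move=> ef; have -> : sqmod f = (fun x => Re (selfconj f (x +i* 0))).
  by apply/funext => x; rewrite selfconj_real.
exact: (Re_horiz_continuous (entire_selfconj ef) 0).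
Qed.

Lemma sqmod_measurable f : entire f -> measurable_fun setT (sqmod f).
Proof. by move=> ef; exact: continuous_measurable_fun (sqmod_continuous ef). Qed.

Lemma exp_type_C_ge0 f C (T : R) :
  (forall z, cmod (f z) <= C * expR (T * cmod z)) -> 0 <= C.
Proof.
move=> H; have := le_trans (cmod_ge0 _) (H 0).
by rewrite cmod0 mulr0 expR0 mulr1.
Qed.

Lemma pw_cos tau f t psi : 0 <= tau -> paley_wiener tau f -> 2 * tau < t ->
  \int[mu]_x (sqmod f x * cos (t * x + psi)) = 0.
Proof.
move=> tau0 [ef tf fi] taut.
(* This puts the bound 2 (tau + e) for the type of [selfconj f] halfway between 2 tau and t. *)
pose e := (t - 2 * tau) / 4; have e0 : 0 < e by rewrite /e; lra.
have [C fC] := tf _ e0; have C0 := exp_type_C_ge0 fC.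
under eq_Rintegral do rewrite -selfconj_real.
apply: (@integral_cos_vanish R (selfconj f) (2 * (tau + e)) t psi (C * C)).
- exact: entire_selfconj.
- exact: selfconjJ.
- move=> z; rewrite /selfconj cmodM cmod_conjc.
  have -> : C * C * expR (2 * (tau + e) * cmod z) =
      (C * expR ((tau + e) * cmod z)) * (C * expR ((tau + e) * cmod z)).
    have -> : 2 * (tau + e) * cmod z = (tau + e) * cmod z + (tau + e) * cmod z by ring.
    rewrite expRD; ring.
  apply: ler_pM; rewrite ?cmod_ge0//.
  by rewrite (le_trans (fC _))// cmod_conjc.
- by rewrite mulr_ge0//; lra.
- by rewrite /e; lra.
- rewrite (_ : _ \o _ = (fun x => (cmod (f x%:C) ^+ 2)%:E))//.
  by apply/funext => x /=; rewrite selfconj_real.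
Qed.

(** Half of the slack e in the definition of type pays for the linear factor, through |z| <= (2 / e)
    e^(e |z| / 2). *)
Lemma exp_type_mul_affine tau f a : exp_type_le tau f ->
  exp_type_le tau (fun z => (z - a%:C) * f z).
Proof.
move=> tf e e0; have e20 : 0 < e / 2 by rewrite divr_gt0.
have [C fC] := tf _ e20; have C0 := exp_type_C_ge0 fC.
exists ((2 / e + `|a|) * C) => z.
have -> : tau + e = e / 2 + (tau + e / 2) by field.
rewrite [X in expR X]mulrDl expRD cmodM.
have -> : (2 / e + `|a|) * C * (expR (e / 2 * cmod z) * expR ((tau + e / 2) * cmod z))
  = ((2 / e + `|a|) * expR (e / 2 * cmod z)) * (C * expR ((tau + e / 2) * cmod z)).
  by ring.
apply: ler_pM; rewrite ?cmod_ge0//.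
rewrite (le_trans (cmodB _ _))// cmod_real mulrDl lerD//.
  rewrite -(ler_pM2l e20).
  have -> : e / 2 * (2 / e * expR (e / 2 * cmod z)) = expR (e / 2 * cmod z).
    by field; rewrite gt_eqF.
  by have := expR_ge1Dx (e / 2 * cmod z); lra.
rewrite ler_peMr//; have := expR_ge1Dx (e / 2 * cmod z).
have := mulr_ge0 (ltW e20) (cmod_ge0 z); lra.
Qed.

Lemma sqmod_affine f a x : sqmod (fun z => (z - a%:C) * f z) x = (x - a) ^+ 2 * sqmod f x.
Proof.
by rewrite /sqmod cmodM exprMn -rmorphB/= cmod_real real_normK ?num_real.
Qed.

Lemma entire_mul_affine f a : entire f -> entire (fun z => (z - a%:C) * f z).
Proof.
move=> ef; have e1 : entire (fun z : R[i] => z - a%:C) :=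
  @entireD R id (fun=> - a%:C) (@entire_id R) (entire_cst _).
exact: (entireM e1 ef).
Qed.

Lemma paley_wiener_mul_affine tau f a : paley_wiener tau f ->
  mu.-integrable setT (EFin \o (fun x => (x - a) ^+ 2 * sqmod f x)) ->
  paley_wiener tau (fun z => (z - a%:C) * f z).
Proof.
move=> [ef tf fi] gi; split; [exact: entire_mul_affine|exact: exp_type_mul_affine|].
rewrite (_ : (fun x => _) = EFin \o (fun x => (x - a) ^+ 2 * sqmod f x))//.
by apply/funext => x /=; rewrite -sqmod_affine.
Qed.

(** The function [u] has mean [c] with respect to |f|^2 dx. Integrability is bundled in so that
    linear combinations carry no side conditions. *)
Definition averages f (u : R -> R) (c : R) : Prop :=
  mu.-integrable setT (EFin \o (fun x => sqmod f x * u x)) /\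
  \int[mu]_x (sqmod f x * u x) = c * \int[mu]_x (sqmod f x).

Lemma averages_sum f n (u : 'I_n -> R -> R) (c : 'I_n -> R) :
  mu.-integrable setT (EFin \o sqmod f) ->
  (forall i, averages f (u i) (c i)) ->
  averages f (fun x => \sum_i u i x) (\sum_i c i).
Proof.
move=> fi H.
suff : forall s : seq 'I_n, averages f (fun x => \sum_(i <- s) u i x) (\sum_(i <- s) c i).
  by apply.
elim=> [|i s [IH1 IH2]].
  split.
    rewrite (_ : _ \o _ = cst 0%E); first exact: integrable0.
    by apply/funext => x /=; rewrite big_nil mulr0.
  rewrite big_nil mul0r; under eq_Rintegral do rewrite big_nil mulr0.
  by rewrite Rintegral_cst// mul0r.
have [i1 i2] := H i.
have E x : sqmod f x * (\sum_(j <- i :: s) u j x) =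
   sqmod f x * u i x + sqmod f x * (\sum_(j <- s) u j x).
  by rewrite big_cons mulrDr.
split.
  pose g1 x := sqmod f x * u i x; pose g2 x := sqmod f x * \sum_(j <- s) u j x.
  rewrite (_ : _ \o _ = (EFin \o g1) \+ (EFin \o g2))%E.
    exact: integrableD.
  by apply/funext => x /=; rewrite E EFinD.
under eq_Rintegral do rewrite E.
by rewrite RintegralD// i2 IH2 big_cons mulrDl.
Qed.

Lemma averagesZ f u c k : averages f u c -> averages f (fun x => k * u x) (k * c).
Proof.
move=> [i1 i2].
have E x : sqmod f x * (k * u x) = k * (sqmod f x * u x) by rewrite mulrCA.
split.
  rewrite (_ : _ \o _ = (fun x => k%:E * (sqmod f x * u x)%:E)%E).
    exact: integrableZl.
  by apply/funext => x /=; rewrite E EFinM.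
under eq_Rintegral do rewrite E.
by rewrite RintegralZl// i2 mulrA.
Qed.

Lemma cos_affine_continuous t psi : continuous (fun x : R => cos (t * x + psi)).
Proof.
move=> x; apply: continuous_comp; last exact: continuous_cos.
apply: continuousD; last exact: cst_continuous.
by apply: continuousM; [exact: cst_continuous|exact: cvg_id].
Qed.

Lemma averages_cos tau f t psi : 0 <= tau -> paley_wiener tau f ->
  2 * tau < `|t| -> averages f (fun x => cos (t * x + psi)) 0.
Proof.
move=> tau0 pf taut; have [ef tf fi] := pf.
split.
  apply: (@integrable_le _ _ (sqmod f) _ _ fi) => [|x].
    apply: measurable_funM; first exact: sqmod_measurable.
    exact: continuous_measurable_fun (@cos_affine_continuous t psi).
  by rewrite normrM (ger0_norm (sqmod_ge0 _ _)) ler_piMr ?sqmod_ge0 ?cos_max.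
rewrite mul0r; have [t0|t0] := leP 0 t.
  by rewrite (ger0_norm t0) in taut; exact: (pw_cos psi tau0 pf).
rewrite (ltr0_norm t0) in taut; rewrite -(pw_cos (- psi) tau0 pf taut).
apply: eq_Rintegral => x _; rewrite -cosN; congr (_ * cos _); ring.
Qed.

Lemma averages_cst f c : mu.-integrable setT (EFin \o sqmod f) ->
  averages f (fun=> c) c.
Proof.
move=> fi; split.
  rewrite (_ : _ \o _ = (fun x => c%:E * (sqmod f x)%:E)%E).
    exact: integrableZl.
  by apply/funext => x /=; rewrite mulrC EFinM.
under eq_Rintegral do rewrite mulrC.
by rewrite RintegralZl.
Qed.

End PaleyWiener.

(** * The Fejer kernel and the uncertainty inequality *)

Section Fejer.
Context {R : realType}.
Notation mu := (@lebesgue_measure R).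
Implicit Types (x y a b c e t s : R) (z w : R[i]) (f g : R[i] -> R[i]).
Notation Re := (@complex.Re R).
Notation Im := (@complex.Im R).

(** This is |sum of e^(iky) over k < N|^2 / N, a form in which nonnegativity is evident; [fejerE]
    exhibits its frequencies. *)
Definition fejer (N : nat) y : R :=
  N%:R^-1 * ((\sum_(k < N) cos (k%:R * y)) ^+ 2 + (\sum_(k < N) sin (k%:R * y)) ^+ 2).

Lemma fejerE N y : fejer N y =
  N%:R^-1 * \sum_(j < N) \sum_(k < N) cos ((j%:R - k%:R) * y).
Proof.
rewrite /fejer; congr (_ * _); rewrite !expr2 !mulr_suml -big_split/=.
apply: eq_bigr => j _; rewrite !mulr_sumr -big_split/=.
by apply: eq_bigr => k _; rewrite mulrBl cosB.
Qed.

Lemma fejer_ge0 N y : 0 <= fejer N y.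
Proof. by rewrite mulr_ge0 ?invr_ge0// addr_ge0 ?sqr_ge0. Qed.

Lemma cossin_exp y n : (cos y +i* sin y) ^+ n = cos (n%:R * y) +i* sin (n%:R * y).
Proof.
elim: n => [|n IH]; first by rewrite expr0 mul0r cos0 sin0.
rewrite exprS IH; apply: complex_ReIm; rewrite !ReIm_simp/= -natr1 mulrDl mul1r.
  by rewrite cosD; ring.
by rewrite sinD; ring.
Qed.

Lemma Re_sum n (F : 'I_n -> R[i]) : Re (\sum_i F i) = \sum_i Re (F i).
Proof. by elim/big_ind2: _ => // x1 x2 y1 y2 <- <-; rewrite ReD. Qed.

Lemma Im_sum n (F : 'I_n -> R[i]) : Im (\sum_i F i) = \sum_i Im (F i).
Proof. by elim/big_ind2: _ => // x1 x2 y1 y2 <- <-; rewrite ImD. Qed.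

(** With z = e^(iy) the geometric sum S satisfies (z - 1) S = z^N - 1, of modulus at most 2, and |z
    - 1|^2 = 2 - 2 cos y. *)
Lemma fejer_le N y : fejer N y * (2 - 2 * cos y) <= 4 / N%:R.
Proof.
pose z := cos y +i* sin y; pose S := \sum_(k < N) z ^+ k.
have -> : fejer N y = N%:R^-1 * cmod S ^+ 2.
  rewrite sqr_cmod /S Re_sum Im_sum /fejer.
  congr (_ * (_ ^+ 2 + _ ^+ 2)); apply: eq_bigr => k _;
    by rewrite cossin_exp.
have -> : 2 - 2 * cos y = cmod (z - 1) ^+ 2.
  rewrite sqr_cmod !ReIm_simp/= oppr0 addr0.
  have := cos2Dsin2 y; set u := cos y; set v := sin y => h.
  have -> : (u - 1) ^+ 2 + v ^+ 2 = (u ^+ 2 + v ^+ 2) + 1 - 2 * u by ring.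
  by rewrite h; ring.
rewrite -mulrA -exprMn -cmodM mulrC (mulrC S) -subrX1 ler_wpM2r ?invr_ge0//.
have h : cmod (z ^+ N - 1) <= 2.
  rewrite (le_trans (cmodB _ _))// cmod1 /z cossin_exp cmodE/= cos2Dsin2 sqrtr1.
  by [].
have := cmod_ge0 (z ^+ N - 1); rewrite (_ : 4 = 2 ^+ 2 :> R); last by ring.
by move=> h0; rewrite lerXn2r// nnegrE.
Qed.

(** Off the diagonal the frequency (j - k) s has modulus at least s > 2 tau and mean 0; the N
    diagonal terms, divided by N, give 1. *)
Lemma averages_fejer tau f s psi N : (0 < N)%N -> 0 <= tau -> paley_wiener tau f ->
  2 * tau < s -> averages f (fun x => fejer N (s * x + psi)) 1.
Proof.
move=> N0 tau0 pf ts; have [ef tf fi] := pf.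
have -> : (fun x => fejer N (s * x + psi)) = (fun x => N%:R^-1 *
   \sum_(j < N) \sum_(k < N) cos (((j%:R - k%:R) * s) * x + (j%:R - k%:R) * psi)).
  apply/funext => x; rewrite fejerE; congr (_ * _).
  by apply: eq_bigr => j _; apply: eq_bigr => k _; rewrite mulrDr mulrA.
have E1 : N%:R^-1 * \sum_(j < N) \sum_(k < N) (j == k)%:R = 1 :> R.
  under eq_bigr => j _.
    rewrite (bigD1 j)//= eqxx big1 ?addr0; last by move=> k /negbTE; rewrite eq_sym => ->.
    over.
  by rewrite sumr_const card_ord mulVf// pnatr_eq0 -lt0n.
pose u (j k : 'I_N) x := cos (((j%:R - k%:R) * s) * x + (j%:R - k%:R) * psi).
suff H0 j k : averages f (u j k) (j == k)%:R.
  have H1 j := averages_sum fi (H0 j).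
  by rewrite -[X in averages _ _ X]E1; exact: (averagesZ N%:R^-1 (averages_sum fi H1)).
rewrite /u; have [->|jk] := eqVneq j k.
  under eq_fun do rewrite subrr !mul0r addr0 cos0.
  exact: averages_cst.
apply: (averages_cos _ tau0 pf); rewrite (lt_le_trans ts)// normrM.
have s0 : 0 <= s by lra.
rewrite (ger0_norm s0) ler_peMl//.
have : (j : nat) != k by [].
move: (nat_of_ord j) (nat_of_ord k) => m n; rewrite neq_ltn => /orP[mn|nm].
  rewrite distrC ger0_norm; last by rewrite subr_ge0 ler_nat ltnW.
  by rewrite -natrB 1?ltnW// ler1n subn_gt0.
rewrite ger0_norm; last by rewrite subr_ge0 ler_nat ltnW.
by rewrite -natrB 1?ltnW// ler1n subn_gt0.
Qed.

Lemma Rintegral_sqmod_ge0 f : 0 <= \int[mu]_x (sqmod f x).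
Proof. by apply: Rintegral_ge0 => x _; exact: sqmod_ge0. Qed.

(* The Fejer kernel has mean 1 against |f|^2 and against |(x - a) f|^2, and tends to
   0 uniformly on |x - a| < l, the only place where (x - a)^2 - l^2 is negative. *)
Lemma uncertainty_lt tau f a l : 0 < tau -> paley_wiener tau f ->
  mu.-integrable setT (EFin \o (fun x => (x - a) ^+ 2 * sqmod f x)) ->
  0 < l -> l * (2 * tau) < pi ->
  l ^+ 2 * \int[mu]_x (sqmod f x) <= \int[mu]_x ((x - a) ^+ 2 * sqmod f x).
Proof.
move=> tau0 pf gi l0 ltau; have [ef tf fi] := pf.
have pg := paley_wiener_mul_affine pf gi.
pose g z := (z - a%:C) * f z.
have gE : (fun x => (x - a) ^+ 2 * sqmod f x) = sqmod g.
  by apply/funext => x; rewrite sqmod_affine.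
(* Any s strictly between 2 tau and pi / l serves: the first bound gives the kernel mean 1, the
   second keeps its nearest peaks, at distance pi / s from a, outside |x - a| <= l. *)
pose s := (2 * tau + pi / l) / 2.
have h1 : 2 * tau < pi / l by rewrite ltr_pdivlMr// mulrC.
have ts : 2 * tau < s by rewrite /s; lra.
have sl : s * l < pi by rewrite -ltr_pdivlMr// /s; lra.
have s0 : 0 < s by lra.
have sl0 : 0 < s * l by rewrite mulr_gt0.
(* The minimum over |x - a| <= l of the factor 2 - 2 cos in [fejer_le], attained at the ends. *)
pose m := 2 + 2 * cos (s * l).
have m0 : 0 < m.
  have : cos pi < cos (s * l).
    by rewrite ltr_cos// ?in_itv/= ?(ltW sl0) ?(ltW sl) ?pi_ge0//=.
  by rewrite cospi /m; lra.
have m40 : 0 <= 4 / m by rewrite divr_ge0// ltW.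
pose If := \int[mu]_x (sqmod f x).
have If0 : 0 <= If by exact: Rintegral_sqmod_ge0.
suff key N : (0 < N)%N ->
    l ^+ 2 * If <= \int[mu]_x ((x - a) ^+ 2 * sqmod f x) + l ^+ 2 * (4 / m) * If / N%:R.
  apply/ler_addgt0Pr => e e0; pose A := l ^+ 2 * (4 / m) * If.
  have A0 : 0 <= A := mulr_ge0 (mulr_ge0 (sqr_ge0 l) m40) If0.
  pose N := (Num.bound (A / e)).+1.
  rewrite (le_trans (key N isT))// lerD2l -/A ler_pdivrMr// mulrC -ler_pdivrMr//.
  rewrite ltW// (lt_le_trans (archi_boundP _)) ?ler_nat//.
  by rewrite divr_ge0// ltW.
move=> N0.
pose p x := fejer N (s * x + (pi - s * a)).
have [i1 E1] := averages_fejer (pi - s * a) N0 (ltW tau0) pf ts.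
have [i2 E2] := averages_fejer (pi - s * a) N0 (ltW tau0) pg ts.
rewrite gE -[X in _ <= X + _]mul1r -E2 -{1}[If]mul1r -E1.
rewrite -/p -RintegralZl//.
have i3 : mu.-integrable setT (EFin \o (fun x => l ^+ 2 * (4 / m) / N%:R * sqmod f x)).
  rewrite (_ : _ \o _ = (fun x => (l ^+ 2 * (4 / m) / N%:R)%:E * (sqmod f x)%:E)%E).
    exact: integrableZl.
  by apply/funext => x /=; rewrite EFinM.
have -> : l ^+ 2 * (4 / m) * If / N%:R = \int[mu]_x (l ^+ 2 * (4 / m) / N%:R * sqmod f x).
  by rewrite RintegralZl// mulrAC.
rewrite -RintegralD//; apply: le_Rintegral => //.
- rewrite (_ : _ \o _ = (fun x => (l ^+ 2)%:E * (sqmod f x * p x)%:E)%E).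
    exact: integrableZl.
  by apply/funext => x /=; rewrite EFinM.
- pose g1 x := sqmod g x * p x; pose g2 x := l ^+ 2 * (4 / m) / N%:R * sqmod f x.
  rewrite (_ : _ \o _ = (EFin \o g1) \+ (EFin \o g2))%E//.
  exact: integrableD.
move=> x _; rewrite -/(sqmod g) sqmod_affine.
have f0 := sqmod_ge0 f x; have p0 : 0 <= p x by exact: fejer_ge0.
(* Outside, l^2 <= (x - a)^2 and the kernel is kept; inside, the kernel is at most 4 / (m N). *)
have [xl|xl] := leP l `|x - a|.
  rewrite mulrA ler_wpDr//.
    by rewrite mulr_ge0// divr_ge0// mulr_ge0 ?sqr_ge0.
  rewrite ler_wpM2r// ler_wpM2r// -[leRHS]real_normK ?num_real//.
  by rewrite lerXn2r ?nnegrE// ltW.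
have px : p x <= (4 / m) / N%:R.
  have := fejer_le N (s * x + (pi - s * a)).
  have -> : s * x + (pi - s * a) = s * (x - a) + pi by ring.
  rewrite /p.
  have -> : s * x + (pi - s * a) = s * (x - a) + pi by ring.
  rewrite cosDpi => H.
  have mm : m <= 2 - 2 * - cos (s * (x - a)).
    have : cos (s * l) <= cos (s * (x - a)); last by rewrite /m; lra.
    rewrite -(cos_norm (s * (x - a))) normrM (gtr0_norm s0).
    apply: le_cos_pi; [by rewrite mulr_ge0// ltW| |exact: ltW].
    by rewrite ler_wpM2l// ltW.
  rewrite -mulrA (mulrC m^-1) mulrA ler_pdivlMr//.
  by rewrite (le_trans _ H)// ler_wpM2l// fejer_ge0.
have -> : l ^+ 2 * (4 / m) / N%:R * sqmod f x = l ^+ 2 * (sqmod f x * (4 / m / N%:R)) by ring.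
rewrite ler_wpDl//; first by rewrite mulr_ge0// mulr_ge0// sqr_ge0.
by rewrite ler_wpM2l ?sqr_ge0// ler_wpM2l.
Qed.

Lemma uncertainty tau f a : 0 < tau -> paley_wiener tau f ->
  mu.-integrable setT (EFin \o (fun x => (x - a) ^+ 2 * sqmod f x)) ->
  (pi / (2 * tau)) ^+ 2 * \int[mu]_x (sqmod f x)
  <= \int[mu]_x ((x - a) ^+ 2 * sqmod f x).
Proof.
move=> tau0 pf gi; pose L := pi / (2 * tau).
have pip := @pi_gt0 R.
have t20 : 0 < 2 * tau by lra.
have L0 : 0 < L by rewrite divr_gt0.
pose If := \int[mu]_x (sqmod f x); have If0 : 0 <= If by exact: Rintegral_sqmod_ge0.
apply/ler_addgt0Pr => e e0.
(* The loss in L^2 - (L - d)^2 is at most 2 L d, so the second bound keeps the error below e; the +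
   1 covers a vanishing integral. *)
pose d := Num.min (L / 2) (e / (2 * L * (If + 1))).
have LI : 0 < 2 * L * (If + 1) by rewrite mulr_gt0//; lra.
have d0 : 0 < d by rewrite lt_min !divr_gt0.
have dL : d <= L / 2 by rewrite ge_min lexx.
have de : d * (2 * L * (If + 1)) <= e.
  by rewrite -ler_pdivlMr// ge_min lexx orbT.
have l0 : 0 < L - d by lra.
have lt : (L - d) * (2 * tau) < pi.
  by rewrite -ltr_pdivlMr// -/L; lra.
have := uncertainty_lt tau0 pf gi l0 lt; rewrite -/If -/L => H.
have : (L ^+ 2 - 2 * L * d) * If <= (L - d) ^+ 2 * If.
  by rewrite ler_wpM2r//; have := sqr_ge0 d; lra.
have h2 : 2 * L * d * If <= e.
  rewrite (le_trans _ de)// (_ : _ * If = d * (2 * L * If)); last by ring.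
  by rewrite ler_wpM2l ?(ltW d0)// ler_wpM2l//; lra.
by rewrite mulrBl; lra.
Qed.

End Fejer.

(** * The weights *)

Section Weights.
Context {R : realType}.
Notation mu := (@lebesgue_measure R).
Implicit Types (x y a b c e t s : R) (z w : R[i]) (f g : R[i] -> R[i]) (G : symmetry_group).
Notation Re := (@complex.Re R).
Notation Im := (@complex.Im R).

Lemma sincN x : sinc (- x) = sinc x.
Proof. by rewrite /sinc oppr_eq0 sinN invrN mulrNN. Qed.

Lemma sinc2piE x : sinc2pi x = sinc (2 * pi * x).
Proof.
rewrite /sinc2pi /sinc mulf_eq0; have -> : (2 * pi == 0 :> R) = false.
  by apply/negbTE; rewrite mulf_neq0// gt_eqF// pi_gt0.
by [].
Qed.

Lemma W_acB1 G x : `|W_ac G x - 1| <= `|sinc2pi x|.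
Proof.
case: G => /=; rewrite ?subrr ?normr0//.
- by rewrite addrC addKr normrN.
- by rewrite addrC addKr.
- by rewrite addrC addKr normrN.
Qed.

Lemma sinc2pi_le1 x : `|sinc2pi x| <= 1.
Proof. by rewrite sinc2piE sinc_le1. Qed.

Lemma sinc2pi_decay x : `|sinc2pi x| * `|x| <= 1.
Proof.
rewrite sinc2piE (le_trans _ (sinc_absM_le1 (2 * pi * x)))// ler_wpM2l//.
rewrite normrM ler_peMl// ger0_norm ?mulr_ge0 ?pi_ge0//.
have := @pi_ge2 R; lra.
Qed.

Lemma W_ac_ge0 G x : 0 <= W_ac G x.
Proof.
by have := le_trans (W_acB1 G x) (sinc2pi_le1 x); rewrite ler_norml => /andP[? ?]; lra.
Qed.

Lemma W_ac_le2 G x : W_ac G x <= 2.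
Proof.
by have := le_trans (W_acB1 G x) (sinc2pi_le1 x); rewrite ler_norml => /andP[? ?]; lra.
Qed.

Lemma W_atom_ge0 G : 0 <= W_atom R G.
Proof. by case: G => //=; lra. Qed.

Lemma W_atom_le1 G : W_atom R G <= 1.
Proof. by case: G => //=; lra. Qed.

(** For 0 <= v <= 2 one has sin v = 2 sin (v/2) cos (v/2) <= v cos (v/2), and for v > 2 simply |sinc
    v| <= 1/2. *)
Lemma sinc_away (v0 : R) : 0 < v0 -> exists2 c : R, 0 < c <= 1 &
  forall v, v0 <= `|v| -> `|sinc v| <= 1 - c.
Proof.
move=> v00; pose w := Num.min v0 2.
have w0 : 0 < w by rewrite lt_min v00 ltr0n.
have w2 : w <= 2 by rewrite ge_min lexx orbT.
have p2 := @pi_ge2 R.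
have cw1 : cos (w / 2) < 1.
  by rewrite -[ltRHS]cos0 ltr_cos// ?in_itv/=; [lra|apply/andP; split; lra|apply/andP; split; lra].
have cw0 : 0 <= cos (w / 2) by apply: cos_ge0_pihalf; apply/andP; split; lra.
exists (Num.min 2^-1 (1 - cos (w / 2))).
  by rewrite lt_min subr_gt0 cw1 invr_gt0 ltr0n/= ge_min invf_le1// ler1n.
move=> v hv; set c := Num.min _ _.
have c1 : c <= 2^-1 by rewrite ge_min lexx.
have c2 : c <= 1 - cos (w / 2) by rewrite ge_min lexx orbT.
wlog v0p : v hv / 0 <= v.
  move=> H; have [|vn] := leP 0 v; first exact: H.
  by rewrite -sincN H ?normrN// oppr_ge0 ltW.
rewrite ger0_norm// in hv.
have wv : w <= v by rewrite (le_trans _ hv)// ge_min lexx.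
have vp : 0 < v by exact: lt_le_trans wv.
have [v2|v2] := leP v 2; last first.
  rewrite (@le_trans _ _ 2^-1)//; last by lra.
  have := sinc_absM_le1 v; rewrite (gtr0_norm vp) => h.
  rewrite -(ler_pM2r vp) (le_trans h)// -ler_pdivrMl ?invr_gt0//.
  by rewrite invrK mulr1 ltW.
rewrite (@le_trans _ _ (cos (w / 2)))//; last by lra.
rewrite -(ler_pM2r vp) -[X in _ * X <= _](gtr0_norm vp) -normrM sincxE.
have s0 : 0 <= sin v by rewrite sin_ge0_pi// v0p/=; lra.
rewrite ger0_norm//.
have -> : sin v = 2 * (cos (v / 2) * sin (v / 2)).
  by rewrite {1}(_ : v = (v / 2) *+ 2) ?sin_mulr2n ?mulr_natl// -mulr_natr divfK.
have h1 : sin (v / 2) <= v / 2.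
  by rewrite (le_trans (ler_norm _))// (le_trans (sin_le_abs _))// ger0_norm// divr_ge0.
have h2 : cos (v / 2) <= cos (w / 2) by apply: le_cos_pi; lra.
have h3 : 0 <= sin (v / 2) by apply: sin_ge0_pi; apply/andP; split; lra.
have -> : cos (w / 2) * v = 2 * (cos (w / 2) * (v / 2)) by field.
rewrite ler_wpM2l// (@le_trans _ _ (cos (w / 2) * sin (v / 2)))//.
  by rewrite ler_wpM2r.
by rewrite ler_wpM2l.
Qed.

(** The densities of Sp and SO(odd) vanish at 0, so a positive lower bound can hold only away from
    0. *)
Lemma W_ac_away (x0 : R) : 0 < x0 -> exists2 c : R, 0 < c <= 1 &
  forall G x, x0 <= `|x| -> c <= W_ac G x.
Proof.
move=> x00; have tp : 0 < 2 * pi :> R by rewrite mulr_gt0// pi_gt0.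
have [c c0 H] := sinc_away (mulr_gt0 tp x00).
exists c => // G x xx0.
have := W_acB1 G x; rewrite sinc2piE.
have := H (2 * pi * x); rewrite normrM (gtr0_norm tp) ler_pM2l// => /(_ xx0) h1 h2.
by have := le_trans h2 h1; rewrite ler_norml => /andP[? ?]; lra.
Qed.

Lemma W_ac_far (d : R) : 0 < d -> exists2 X : R, 0 < X &
  forall G x, X <= `|x| -> `|W_ac G x - 1| <= d.
Proof.
move=> d0; exists d^-1; first by rewrite invr_gt0.
move=> G x hx; rewrite (le_trans (W_acB1 G x))//.
have x0 : 0 < `|x| by rewrite (lt_le_trans _ hx)// invr_gt0.
rewrite -(ler_pM2r x0) (le_trans (sinc2pi_decay x))//.
by rewrite -ler_pdivrMl// mulr1.
Qed.

Lemma sinc_continuous : continuous (@sinc R).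
Proof.
have -> : @sinc R = (fun x => Re (csinc (x +i* 0))).
  by apply/funext => x; rewrite [x +i* 0](_ : _ = x%:C)// csinc_real.
exact: (Re_horiz_continuous entire_csinc 0).
Qed.

Lemma W_ac_continuous G : continuous (@W_ac R G).
Proof.
have cs : continuous (@sinc2pi R).
  have -> : @sinc2pi R = (fun x => sinc (2 * pi * x)) by apply/funext => x; exact: sinc2piE.
  move=> x; apply: continuous_comp; last exact: sinc_continuous.
  by apply: continuousM; [exact: cst_continuous|exact: cvg_id].
case: G; try exact: cst_continuous.
- by move=> x; apply: continuousB; [exact: cst_continuous|exact: cs].
- by move=> x; apply: continuousD; [exact: cst_continuous|exact: cs].
- by move=> x; apply: continuousB; [exact: cst_continuous|exact: cs].
Qed.

Lemma W_ac_measurable G : measurable_fun setT (@W_ac R G).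
Proof. exact: continuous_measurable_fun (@W_ac_continuous G). Qed.

Lemma integrable_mulW G (u : R -> R) : (forall x, 0 <= u x) ->
  mu.-integrable setT (EFin \o u) ->
  mu.-integrable setT (EFin \o (fun x => u x * W_ac G x)).
Proof.
move=> u0 iu.
have i2 : mu.-integrable setT (EFin \o (fun x => 2 * u x)).
  rewrite (_ : _ \o _ = (fun x => 2%:E * (u x)%:E)%E); first exact: integrableZl.
  by apply/funext => x /=; rewrite EFinM.
apply: (@integrable_le _ _ (fun x => 2 * u x)) => // [|x].
  apply: measurable_funM; last exact: W_ac_measurable.
  by apply/measurable_EFinP; exact: (measurable_int mu).
by rewrite normrM !ger0_norm ?W_ac_ge0// mulrC ler_wpM2r//; exact: W_ac_le2.
Qed.

Lemma continuous_Rintegral_gt0 (u : R -> R) x0 : continuous u ->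
  (forall x, 0 <= u x) -> mu.-integrable setT (EFin \o u) -> 0 < u x0 ->
  0 < \int[mu]_x u x.
Proof.
move=> cu u0 iu ux0.
have ux20 : 0 < u x0 / 2 by rewrite divr_gt0.
have := cu x0; move/cvgrPdist_lt => /(_ _ ux20) /nbhs_ballP[d /= d0 Hd].
pose I : set (measurableTypeR R) := `[x0 - d / 2, x0 + d / 2]%classic.
have mI : measurable I by exact: measurable_itv.
have muI : mu I = (d%:E)%E.
  rewrite lebesgue_measure_itv/= lte_fin ifT; last by lra.
  by rewrite -EFinB; congr EFin; lra.
have iI : mu.-integrable I (EFin \o u).
  exact: (integrableS measurableT mI (@subsetT _ _) iu).
have h1 : (u x0 / 2) * d <= \int[mu]_(x in I) u x.
  have -> : (u x0 / 2) * d = \int[mu]_(x in I) (u x0 / 2).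
    by transitivity (u x0 / 2 * fine (mu I)); [rewrite muI|rewrite Rintegral_cst].
  apply: le_Rintegral => //.
    exact: (@continuous_itv_integrable R (cst (u x0 / 2)) (@cst_continuous _ _ _) _ _).
  move=> x; rewrite /I /= in_itv/= => /andP[h1 h2].
  have : ball x0 d x.
    by rewrite /ball/=; rewrite ltr_norml; apply/andP; split; lra.
  move/Hd => /=; rewrite ltr_norml => /andP[? ?]; lra.
have h2 : \int[mu]_(x in I) u x <= \int[mu]_x u x.
  rewrite Rintegral_mkcond; apply: le_Rintegral => //.
    rewrite (_ : _ \o _ = (EFin \o u) \_ I); last by rewrite restrict_EFin.
    exact/(integrable_mkcond _ mI).
  by move=> x _; rewrite patchE; case: ifP.
by rewrite (lt_le_trans _ h2)// (lt_le_trans _ h1)// mulr_gt0.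
Qed.

(* Pointwise W >= c (1 - (2/3) (1 + cos (t x))), and cos (t x) has mean 0 against
   |f|^2. *)
Lemma weight_lower_bound tau : 0 <= tau -> exists2 c : R, 0 < c <= 1 &
  forall G f, paley_wiener tau f ->
  c * \int[mu]_x (sqmod f x) <= \int[mu]_x (sqmod f x * W_ac G x).
Proof.
move=> tau0; pose t := 2 * tau + 1; have t0 : 0 < t by rewrite /t; lra.
have ts : 2 * tau < `|t| by rewrite gtr0_norm// /t; lra.
(* For |x| < 1 / (2 t) the cosine is at least 1/2, so the minorant c (1/3 - (2/3) cos (t x)) is
   nonpositive; elsewhere it is at most c. Its mean is c / 3. *)
have t1 : 0 < (2 * t)^-1 by rewrite invr_gt0; lra.
have [c /andP[c0 c1] Hc] := W_ac_away t1.
exists (c / 3); first by apply/andP; split; lra.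
move=> G f pf; have [ef tf fi] := pf.
have [ic Ec] := averages_cos 0 tau0 pf ts.
have iW : mu.-integrable setT (EFin \o (fun x => sqmod f x * W_ac G x)).
  by apply: integrable_mulW => // x; exact: sqmod_ge0.
pose v x := (c / 3) * sqmod f x + (- (c * (2 / 3))) * (sqmod f x * cos (t * x + 0)).
have iA : mu.-integrable setT (EFin \o (fun x => (c / 3) * sqmod f x)).
  rewrite (_ : _ \o _ = (fun x => (c / 3)%:E * (sqmod f x)%:E)%E); first exact: integrableZl.
  by apply/funext => x /=; rewrite EFinM.
have iB : mu.-integrable setT (EFin \o (fun x => (- (c * (2 / 3))) * (sqmod f x * cos (t * x + 0)))).
  rewrite (_ : _ \o _ = (fun x => (- (c * (2 / 3)))%:E * (sqmod f x * cos (t * x + 0))%:E)%E).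
    exact: integrableZl.
  by apply/funext => x /=; rewrite EFinM.
have <- : \int[mu]_x v x = c / 3 * \int[mu]_x sqmod f x.
  by rewrite /v RintegralD// RintegralZl// [X in _ + X]RintegralZl// Ec mul0r mulr0 addr0.
apply: le_Rintegral => //.
  pose g1 x := (c / 3) * sqmod f x; pose g2 x := (- (c * (2 / 3))) * (sqmod f x * cos (t * x + 0)).
  by rewrite (_ : _ \o _ = (EFin \o g1) \+ (EFin \o g2))%E//; exact: integrableD.
move=> x _; rewrite /v addr0.
have -> : c / 3 * sqmod f x + - (c * (2 / 3)) * (sqmod f x * cos (t * x)) =
  sqmod f x * (c * (3^-1 - 2 / 3 * cos (t * x))) by field.
rewrite ler_wpM2l ?sqmod_ge0//.
have [xt|xt] := leP (2 * t)^-1 `|x|.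
  rewrite (le_trans _ (Hc G x xt))// ler_piMr ?(ltW c0)//.
  by have := cos_geN1 (t * x); lra.
rewrite (le_trans _ (W_ac_ge0 G x))//; apply: mulr_ge0_le0; first exact: ltW.
suff : 2^-1 <= cos (t * x) by lra.
have tx : `|t * x| <= 2^-1.
  rewrite normrM (gtr0_norm t0) mulrC -ler_pdivlMr//.
  by rewrite -invfM; exact: ltW.
have := cosB1_le (t * x); rewrite -real_normK ?num_real// => h.
have : `|t * x| ^+ 2 <= 2^-1 ^+ 2 by rewrite lerXn2r// nnegrE// invr_ge0.
by move=> h2; have := le_trans h h2; rewrite ler_norml expr2 => /andP[? ?]; lra.
Qed.


End Weights.

(** * Lower bound *)

Section Cutoff.
Context {R : realType}.
Notation mu := (@lebesgue_measure R).
Implicit Types (x y a b c e t s : R) (z w : R[i]) (f g : R[i] -> R[i]) (G : symmetry_group).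
Notation Re := (@complex.Re R).
Notation Im := (@complex.Im R).

Lemma integrable_scale k (u : R -> R) : mu.-integrable setT (EFin \o u) ->
  mu.-integrable setT (EFin \o (fun x => k * u x)).
Proof.
move=> iu; rewrite (_ : _ \o _ = (fun x => k%:E * (u x)%:E)%E); first exact: integrableZl.
by apply/funext => x /=; rewrite EFinM.
Qed.

Lemma integrable_add (u v : R -> R) : mu.-integrable setT (EFin \o u) ->
  mu.-integrable setT (EFin \o v) ->
  mu.-integrable setT (EFin \o (fun x => u x + v x)).
Proof.
move=> iu iv; rewrite (_ : _ \o _ = ((EFin \o u) \+ (EFin \o v))%E)//.
exact: integrableD.
Qed.

Lemma integrable_measurable (u : R -> R) : mu.-integrable setT (EFin \o u) ->
  measurable_fun setT u.
Proof. by move=> iu; apply/measurable_EFinP; exact: (measurable_int mu). Qed.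

(** On [-1, 1], where the density may vanish, continuity of [u] suffices; outside, the density is at
    least [c]. Hence an infinite moment stays infinite after weighting. *)
Lemma integrable_unweight G (u : R -> R) : continuous u -> (forall x, 0 <= u x) ->
  mu.-integrable setT (EFin \o (fun x => u x * W_ac G x)) ->
  mu.-integrable setT (EFin \o u).
Proof.
move=> cu u0 iW; have [c /andP[c0 c1] Hc] := W_ac_away (@ltr01 R).
pose I : set (measurableTypeR R) := `[-1, 1]%classic.
have mI : measurable I by exact: measurable_itv.
have iI : mu.-integrable setT (EFin \o (u \_ I)).
  rewrite -restrict_EFin; apply/(integrable_mkcond _ mI).
  exact: continuous_itv_integrable.
apply: (@integrable_le _ _ (fun x => c^-1 * (u x * W_ac G x) + (u \_ I) x)) => [|x|].
- exact: continuous_measurable_fun.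
- rewrite ger0_norm// patchE.
  have h : 0 <= c^-1 * (u x * W_ac G x).
    by rewrite !mulr_ge0 ?invr_ge0 ?(ltW c0) ?W_ac_ge0.
  case: ifPn => [_|xI]; first by rewrite lerDr.
  rewrite addr0 mulrCA ler_peMr// ler_pdivlMl// mulr1 Hc//.
  rewrite leNgt; apply/negP => x1; move/negP: xI; apply; rewrite inE /I/= in_itv/=.
  by move: x1; rewrite ltr_norml => /andP[? ?]; apply/andP; split; exact: ltW.
- by apply: integrable_add => //; exact: integrable_scale.
Qed.

Lemma exp_type_mulsinc tau f th a : 0 <= th -> exp_type_le tau f ->
  exp_type_le (tau + th) (fun z => f z * csinc (th%:C * (z - a%:C))).
Proof.
move=> th0 tf e e0; have [C fC] := tf _ e0; have C0 := exp_type_C_ge0 fC.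
exists (C * (21 * expR (th * `|a|))) => z.
have -> : C * (21 * expR (th * `|a|)) * expR ((tau + th + e) * cmod z) =
  (C * expR ((tau + e) * cmod z)) * (21 * expR (th * (cmod z + `|a|))).
  have -> : (tau + th + e) * cmod z = (tau + e) * cmod z + th * cmod z by ring.
  have -> : th * (cmod z + `|a|) = th * cmod z + th * `|a| by ring.
  by rewrite !expRD; ring.
rewrite cmodM; apply: ler_pM; rewrite ?cmod_ge0//.
rewrite (le_trans (cmod_csinc _))// ler_wpM2l// ler_expR cmodM cmod_real (ger0_norm th0).
by rewrite ler_wpM2l// (le_trans (cmodB _ _))// cmod_real.
Qed.

Lemma sqmod_mulsinc f th a x :
  sqmod (fun z => f z * csinc (th%:C * (z - a%:C))) x
  = sqmod f x * sinc (th * (x - a)) ^+ 2.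
Proof.
rewrite /sqmod cmodM exprMn -rmorphB/= -rmorphM/= csinc_real cmod_real.
by rewrite real_normK ?num_real.
Qed.

Lemma paley_wiener_mulsinc tau f th a : 0 <= th -> paley_wiener tau f ->
  paley_wiener (tau + th) (fun z => f z * csinc (th%:C * (z - a%:C))).
Proof.
move=> th0 [ef tf fi].
have e1 : entire (fun z : R[i] => z - a%:C) :=
  @entireD R id (fun=> - a%:C) (@entire_id R) (entire_cst _).
have e2 : entire (fun z : R[i] => th%:C * (z - a%:C)) := entireM (entire_cst _) e1.
have e3 : entire (fun z : R[i] => csinc (th%:C * (z - a%:C))) :=
  entire_comp entire_csinc e2.
have e4 := entireM ef e3.
split => //; first exact: exp_type_mulsinc.
apply: (integrable_le (sqmod_measurable e4) _ fi) => x.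
rewrite ger0_norm ?sqmod_ge0// sqmod_mulsinc ler_piMr ?sqmod_ge0//.
by rewrite -real_normK ?num_real// expr_le1// sinc_le1.
Qed.

(* The uncertainty inequality is applied to f(x) sinc(th (x - a)): the cutoff makes
   the region |x| < X, where W is far from 1, negligible as |a| grows, and costs only
   1 - sinc^2 = O(th^2 (x - a)^2), which is absorbed by the numerator. *)
Lemma cutoff_bound tau f a th (X c : R) G :
  0 < tau -> 0 < th -> th < 1 -> 0 < c -> 0 < X -> X < `|a| ->
  (forall x, X <= `|x| -> `|W_ac G x - 1| <= th) ->
  (forall g, paley_wiener tau g ->
    c * \int[mu]_x (sqmod g x) <= \int[mu]_x (sqmod g x * W_ac G x)) ->
  paley_wiener tau f ->
  mu.-integrable setT (EFin \o (fun x => (x - a) ^+ 2 * sqmod f x)) ->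
  \int[mu]_x (sqmod f x * W_ac G x) <=
  (1 + th) * ((2 * (tau + th)) / pi) ^+ 2 *
    ((1 - th)^-1 + (c * (th * (`|a| - X)) ^+ 2)^-1) *
      \int[mu]_x ((x - a) ^+ 2 * sqmod f x * W_ac G x)
  + (2 * th ^+ 2 + 2 / (c * (`|a| - X) ^+ 2)) *
      \int[mu]_x ((x - a) ^+ 2 * sqmod f x * W_ac G x).
Proof.
move=> tau0 th0 th1 c0 X0 Xa HX Hc pf gi; have [ef tf fi] := pf.
have pg := paley_wiener_mul_affine pf gi.
pose g z := (z - a%:C) * f z.
have gE x : (x - a) ^+ 2 * sqmod f x = sqmod g x by rewrite sqmod_affine.
have gi' : mu.-integrable setT (EFin \o sqmod g).
  by rewrite (_ : sqmod g = (fun x => (x - a) ^+ 2 * sqmod f x))//; apply/funext => x; rewrite gE.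
pose F z := f z * csinc (th%:C * (z - a%:C)).
pose H z := g z * csinc (th%:C * (z - a%:C)).
have pF : paley_wiener (tau + th) F := paley_wiener_mulsinc a (ltW th0) pf.
have pH : paley_wiener (tau + th) H := paley_wiener_mulsinc a (ltW th0) pg.
have FE x : sqmod F x = sqmod f x * sinc (th * (x - a)) ^+ 2 by exact: sqmod_mulsinc.
have HE x : sqmod H x = sqmod g x * sinc (th * (x - a)) ^+ 2 by exact: sqmod_mulsinc.
have [eF tF Fi] := pF; have [eH tH Hi] := pH.
have HFE : (fun x => (x - a) ^+ 2 * sqmod F x) = sqmod H.
  by apply/funext => x; rewrite FE HE -gE; ring.
have tth0 : 0 < tau + th by lra.
have U : (pi / (2 * (tau + th))) ^+ 2 * \int[mu]_x (sqmod F x) <= \int[mu]_x (sqmod H x).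
  by rewrite -HFE; apply: (uncertainty tth0 pF); rewrite HFE.
pose T := `|a| - X; have T0 : 0 < T by rewrite subr_gt0.
pose n := \int[mu]_x (sqmod g x * W_ac G x).
have nE : \int[mu]_x ((x - a) ^+ 2 * sqmod f x * W_ac G x) = n.
  by apply: eq_Rintegral => x _; rewrite gE.
rewrite nE -/T.
have cg : \int[mu]_x (sqmod g x) <= n / c by rewrite ler_pdivlMr// mulrC; exact: Hc.
have fWi := integrable_mulW G (sqmod_ge0 f) fi.
have gWi := integrable_mulW G (sqmod_ge0 g) gi'.
have near x : `|x| < X -> T ^+ 2 <= (x - a) ^+ 2.
  move=> xX; rewrite -[leRHS]real_normK ?num_real// lerXn2r ?nnegrE ?(ltW T0)//.
  by have := lerB_dist a x; rewrite distrC /T; move: xX; clear; lra.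
(* From |sinc y| |y| <= 1 with |y| >= th T. *)
have near_sinc x : `|x| < X -> sinc (th * (x - a)) ^+ 2 <= ((th * T) ^+ 2)^-1.
  move=> xX; have q0 : 0 < (th * T) ^+ 2 by rewrite exprn_gt0// mulr_gt0.
  rewrite -[leRHS]mul1r ler_pdivlMr//.
  have := sinc_absM_le1 (th * (x - a)) => h.
  have : (`|sinc (th * (x - a))| * `|th * (x - a)|) ^+ 2 <= 1 by rewrite expr_le1.
  rewrite exprMn !real_normK ?num_real// => /(le_trans _); apply.
  rewrite ler_wpM2l ?sqr_ge0// !exprMn ler_wpM2l ?sqr_ge0//; exact: near.
have sinc1 x : 0 <= sinc (th * (x - a)) ^+ 2 <= 1.
  by rewrite sqr_ge0/= -real_normK ?num_real// expr_le1// sinc_le1.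
have th1' : 0 < 1 - th by rewrite subr_gt0.
(* For |x| >= X, sinc^2 <= 1 <= W / (1 - th); for |x| < X the small factor of [near_sinc] multiplies
   the unweighted integral, which is at most n / c. *)
have Hbound : \int[mu]_x (sqmod H x) <= ((1 - th)^-1 + (c * (th * T) ^+ 2)^-1) * n.
  apply: (@le_trans _ _ ((1 - th)^-1 * n + ((th * T) ^+ 2)^-1 * \int[mu]_x (sqmod g x))); last first.
    have -> : ((1 - th)^-1 + (c * (th * T) ^+ 2)^-1) * n =
        (1 - th)^-1 * n + ((th * T) ^+ 2)^-1 * (n / c) by rewrite invfM; ring.
    by rewrite lerD2l ler_wpM2l// invr_ge0 sqr_ge0.
  rewrite /n -!RintegralZl// -RintegralD//; [|exact: integrable_scale|exact: integrable_scale].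
  apply: le_Rintegral => //.
    by apply: integrable_add; exact: integrable_scale.
  move=> x _; rewrite HE; have g0 := sqmod_ge0 g x.
  have -> : (1 - th)^-1 * (sqmod g x * W_ac G x) + ((th * T) ^+ 2)^-1 * sqmod g x =
     sqmod g x * ((1 - th)^-1 * W_ac G x + ((th * T) ^+ 2)^-1) by ring.
  rewrite ler_wpM2l//; have [xX|xX] := leP X `|x|.
    have /andP[_ s1] := sinc1 x; rewrite (le_trans s1)// ler_wpDr//.
      by rewrite invr_ge0 sqr_ge0.
    rewrite mulrC ler_pdivlMr// mul1r.
    by have := HX x xX; rewrite ler_norml => /andP[+ +]; clear; lra.
  rewrite (le_trans (near_sinc x xX))// ler_wpDl// mulr_ge0 ?W_ac_ge0// invr_ge0.
  exact: ltW.
have Fbound : \int[mu]_x (sqmod F x) <=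
    (2 * (tau + th) / pi) ^+ 2 * \int[mu]_x (sqmod H x).
  have pp := @pi_gt0 R.
  have q0 : 0 < (2 * (tau + th) / pi) ^+ 2 by rewrite exprn_gt0// divr_gt0// mulr_gt0.
  rewrite -ler_pdivrMl// -exprVn invf_div; exact: U.
(* Write W = W S + W (1 - S) with S = sinc^2. The second part is O(th^2 (x - a)^2) W. The first is
   at most (1 + th) S for |x| >= X, and at most 2 <= 2 (x - a)^2 / T^2 for |x| < X. *)
have Dbound : \int[mu]_x (sqmod f x * W_ac G x) <=
   (1 + th) * \int[mu]_x (sqmod F x) + 2 * th ^+ 2 * n + 2 / T ^+ 2 * \int[mu]_x (sqmod g x).
  rewrite /n -!RintegralZl//.
  rewrite -RintegralD//; [|exact: integrable_scale|exact: integrable_scale].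
  rewrite -RintegralD//; [|by apply: integrable_add; exact: integrable_scale|exact: integrable_scale].
  apply: le_Rintegral => //.
    by apply: integrable_add; [apply: integrable_add|]; exact: integrable_scale.
  move=> x _; rewrite FE -gE; have f0 := sqmod_ge0 f x.
  set S := sinc (th * (x - a)) ^+ 2.
  have /andP[S0 S1] := sinc1 x; rewrite -/S in S0 S1.
  have W0 := W_ac_ge0 G x; have W2 := W_ac_le2 G x.
  have -> : (1 + th) * (sqmod f x * S) + 2 * th ^+ 2 * ((x - a) ^+ 2 * sqmod f x * W_ac G x)
     + 2 / T ^+ 2 * ((x - a) ^+ 2 * sqmod f x) =
     sqmod f x * ((1 + th) * S + 2 * (th * (x - a)) ^+ 2 * W_ac G x + 2 * ((x - a) ^+ 2 / T ^+ 2)).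
    by ring.
  rewrite ler_wpM2l//.
  have h1 : 1 - S <= 2 * (th * (x - a)) ^+ 2.
    have := sincB1_le (th * (x - a)); have := sinc_le1 (th * (x - a)).
    rewrite /S; set y := sinc _; rewrite !ler_norml => /andP[y1 y2] /andP[y3 y4].
    have -> : 1 - y ^+ 2 = (1 - y) * (1 + y) by ring.
    by rewrite mulrC; apply: ler_pM; clear - y1 y2 y3 y4; lra.
  have h2 : W_ac G x * (1 - S) <= 2 * (th * (x - a)) ^+ 2 * W_ac G x.
    by rewrite mulrC ler_wpM2r.
  have r0 : 0 <= 2 * ((x - a) ^+ 2 / T ^+ 2) by rewrite mulr_ge0// divr_ge0 ?sqr_ge0.
  suff h3 : W_ac G x * S <= (1 + th) * S + 2 * ((x - a) ^+ 2 / T ^+ 2).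
    by clear - h2 h3; lra.
  have [xX|xX] := leP X `|x|.
    rewrite ler_wpDr// ler_wpM2r//.
    by have := HX x xX; rewrite ler_norml => /andP[+ +]; clear; lra.
  rewrite ler_wpDl//; first by rewrite mulr_ge0// addr_ge0// ltW.
  have :1 <= (x - a) ^+ 2 / T ^+ 2.
    by rewrite ler_pdivlMr ?exprn_gt0// mul1r; exact: near.
  have : W_ac G x * S <= 2 * 1 by apply: ler_pM.
  by clear; lra.
have n0 : 0 <= n by apply: Rintegral_ge0 => x _; rewrite mulr_ge0 ?sqmod_ge0 ?W_ac_ge0.
have k1 : (1 + th) * \int[mu]_x (sqmod F x) <=
    (1 + th) * (2 * (tau + th) / pi) ^+ 2 * ((1 - th)^-1 + (c * (th * T) ^+ 2)^-1) * n.
  rewrite -[leRHS]mulrA -[leRHS]mulrA ler_wpM2l//; first by rewrite addr_ge0// ltW.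
  by rewrite (le_trans Fbound)// ler_wpM2l ?sqr_ge0.
have k2 : 2 / T ^+ 2 * \int[mu]_x (sqmod g x) <= 2 / (c * T ^+ 2) * n.
  have -> : 2 / (c * T ^+ 2) * n = 2 / T ^+ 2 * (n / c) by rewrite invfM; ring.
  by rewrite ler_wpM2l// divr_ge0 ?sqr_ge0.
by rewrite mulrDl; move: Dbound k1 k2; clear; lra.
Qed.

End Cutoff.

(** * Lower bounds for the infimum *)

Section LowerBound.
Context {R : realType}.
Notation mu := (@lebesgue_measure R).
Implicit Types (x y a b c e t s : R) (z w : R[i]) (f g : R[i] -> R[i]) (G : symmetry_group).
Notation Re := (@complex.Re R).
Notation Im := (@complex.Im R).

(** The left side is what remains of the constant of [cutoff_bound] as |a| grows with th fixed. It
    is continuous in th, with value (2 tau / pi)^2 at th = 0. *)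
Lemma cutoff_const_lt (tau K : R) : (2 * tau / pi) ^+ 2 < K ->
  exists th : R, [/\ 0 < th, th < 1 &
    (1 + th) * (2 * (tau + th) / pi) ^+ 2 * (1 - th)^-1 + 2 * th ^+ 2 < K].
Proof.
move=> hK.
pose k (th : R) := (1 + th) * (2 * (tau + th) / pi) ^+ 2 * (1 - th)^-1 + 2 * th ^+ 2.
have ck : k x @[x --> (0 : R)] --> k 0.
  have c1 : (1 + x) @[x --> (0 : R)] --> (1 + 0 : R) by apply: cvgD; [exact: cvg_cst|exact: cvg_id].
  have c2 : (2 * (tau + x) / pi) @[x --> (0 : R)] --> (2 * (tau + 0) / pi : R).
    apply: cvgM; last exact: cvg_cst.
    apply: cvgM; first exact: cvg_cst.
    by apply: cvgD; [exact: cvg_cst|exact: cvg_id].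
  have c3 : (1 - x)^-1 @[x --> (0 : R)] --> ((1 - 0)^-1 : R).
    apply: cvgV; first by rewrite subr0 oner_neq0.
    by apply: cvgB; [exact: cvg_cst|exact: cvg_id].
  have c4 : (2 * x ^+ 2) @[x --> (0 : R)] --> (2 * 0 ^+ 2 : R).
    by apply: cvgM; [exact: cvg_cst|apply: cvgM; exact: cvg_id].
  have := cvgD (cvgM (cvgM c1 (cvgM c2 c2)) c3) c4.
  by move=> H; exact: H.
have k0 : k 0 < K by rewrite /k !addr0 subr0 invr1 expr0n mulr0 mul1r mulr1 addr0.
have /nbhs_ballP[d /= d0 Hd] : \forall x \near (0 : R), k x < K.
  exact: (cvgr_lt _ ck).
exists (Num.min (d / 2) 2^-1); have d2 : 0 < d / 2 by rewrite divr_gt0.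
have h0 : 0 < Num.min (d / 2) 2^-1 by rewrite lt_min d2 invr_gt0 ltr0n.
have hd : Num.min (d / 2) 2^-1 <= d / 2 by rewrite ge_min lexx.
have h1 : Num.min (d / 2) 2^-1 <= 2^-1 by rewrite ge_min lexx orbT.
split => //; first by lra.
apply: (Hd (Num.min (d / 2) 2^-1)).
by rewrite /ball/= sub0r normrN gtr0_norm//; lra.
Qed.

(** The conclusion 1 <= K a^2 is for the atom at 0, whose numerator term is a^2 times its
    denominator term. *)
Lemma lower_real (tau K : R) : 0 < tau -> (2 * tau / pi) ^+ 2 < K ->
  exists M : R, forall a, M < `|a| -> 1 <= K * a ^+ 2 /\
    forall G f, paley_wiener tau f ->
     mu.-integrable setT (EFin \o (fun x => (x - a) ^+ 2 * sqmod f x)) ->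
     \int[mu]_x (sqmod f x * W_ac G x) <=
     K * \int[mu]_x ((x - a) ^+ 2 * sqmod f x * W_ac G x).
Proof.
move=> tau0 hK; have K0 : 0 < K by rewrite (le_lt_trans _ hK)// sqr_ge0.
have [th [th0 th1 hth]] := cutoff_const_lt hK.
have [c /andP[c0 c1] Hc] := weight_lower_bound (ltW tau0).
have [X X0 HX] := W_ac_far th0.
pose q := (1 + th) * (2 * (tau + th) / pi) ^+ 2.
pose k1 := q * (1 - th)^-1 + 2 * th ^+ 2.
have dk : 0 < K - k1 by rewrite subr_gt0.
(* The coefficient of 1 / T^2 in [cutoff_bound], where T = |a| - X. *)
pose B := q / (c * th ^+ 2) + 2 / c.
have q0 : 0 <= q by rewrite mulr_ge0 ?sqr_ge0// addr_ge0// ltW.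
have B0 : 0 <= B by rewrite addr_ge0// divr_ge0// ?(ltW c0)// mulr_ge0 ?sqr_ge0// ltW.
(* This gives T >= 1 and T >= B / (K - k1), hence B / T^2 <= K - k1, and also |a| >= 1 and |a| >= 1
   / K, hence K a^2 >= 1. *)
exists (X + 1 + B / (K - k1) + K^-1) => a hM.
have BK : 0 <= B / (K - k1) by rewrite divr_ge0// ltW.
have Ki : 0 < K^-1 by rewrite invr_gt0.
have a1 : 1 <= `|a| by lra.
split.
  rewrite -[a ^+ 2]real_normK ?num_real// -ler_pdivrMl// mulr1 expr2.
  by rewrite (@le_trans _ _ `|a|)//; [lra|rewrite ler_peMl].
move=> G f pf gi; have Xa : X < `|a| by lra.
set n := (X in _ <= K * X).
have n0 : 0 <= n.
  by apply: Rintegral_ge0 => x _; rewrite mulr_ge0 ?W_ac_ge0// mulr_ge0 ?sqr_ge0// sqmod_ge0.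
rewrite (le_trans (cutoff_bound tau0 th0 th1 c0 X0 Xa (HX G) (Hc G) pf gi))//.
rewrite -/n -/q -mulrDl ler_wpM2r//.
pose T := `|a| - X; have T1 : 1 <= T by rewrite /T; lra.
have TB : B / (K - k1) <= T by rewrite /T; lra.
have T0 : 0 < T by lra.
have BT : B / T ^+ 2 <= K - k1.
  rewrite ler_pdivrMr ?exprn_gt0// mulrC -ler_pdivrMr//.
  by rewrite (le_trans TB)// expr2 ler_peMr// ltW.
have -> : q * ((1 - th)^-1 + (c * (th * (`|a| - X)) ^+ 2)^-1) +
   (2 * th ^+ 2 + 2 / (c * (`|a| - X) ^+ 2)) = k1 + B / T ^+ 2.
  by rewrite /k1 /B -/T exprMn; field; rewrite !gt_eqF//; lra.
by lra.
Qed.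

Lemma W_integralE G (u : R -> R) : measurable_fun setT u ->
  W_integral G u = (\int[mu]_x (u x * W_ac G x)%:E + (W_atom R G * u 0)%:E)%E.
Proof.
move=> mf; rewrite /W_integral; congr (_ + _)%E.
rewrite (@integral_dirac _ _ (0 : measurableTypeR R) R setT measurableT (fun x => (u x)%:E)).
  by rewrite diracT mul1e EFinM.
exact/measurable_EFinP.
Qed.

Lemma W_integral_fin G (u : R -> R) : (forall x, 0 <= u x) ->
  mu.-integrable setT (EFin \o u) ->
  W_integral G u = (\int[mu]_x (u x * W_ac G x) + W_atom R G * u 0)%:E.
Proof.
move=> u0 iu; rewrite W_integralE; last exact: integrable_measurable.
rewrite EFinD; congr (_ + _)%E; rewrite /Rintegral fineK//.
exact: integrable_fin_num (integrable_mulW G u0 iu).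
Qed.

Lemma W_integral_infty G (u : R -> R) : continuous u -> (forall x, 0 <= u x) ->
  ~ mu.-integrable setT (EFin \o u) -> W_integral G u = +oo%E.
Proof.
move=> cu u0 nu; have mf := continuous_measurable_fun cu.
rewrite W_integralE//.
suff -> : (\int[mu]_x (u x * W_ac G x)%:E = +oo)%E by [].
apply/eqP; apply: contra_notT nu; rewrite -ltey => ioo.
apply: (integrable_unweight (G := G)) => //; apply/integrableP; split.
  by apply/measurable_EFinP; apply: measurable_funM => //; exact: W_ac_measurable.
apply: le_lt_trans ioo; rewrite le_eqVlt; apply/orP; left; apply/eqP.
apply: eq_integral => x _; rewrite /= ger0_norm// mulr_ge0 ?W_ac_ge0//.
Qed.

(** By [weight_lower_bound] only the unweighted mass matters, and it vanishes only if [f] is 0 on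
    the reals, hence everywhere. *)
Lemma pw_mass_gt0 tau f G : 0 <= tau -> paley_wiener tau f -> f <> cst 0 ->
  0 < \int[mu]_x (sqmod f x * W_ac G x).
Proof.
move=> tau0 pf f0; have [ef tf fi] := pf.
have [c /andP[c0 c1] Hc] := weight_lower_bound tau0.
rewrite (lt_le_trans _ (Hc G f pf))// mulr_gt0//.
have [[x0 fx0]|nx] := pselect (exists x, f x%:C != 0).
  apply: (@continuous_Rintegral_gt0 _ _ x0) => //; first exact: sqmod_continuous.
  - exact: sqmod_ge0.
  - by rewrite /sqmod exprn_gt0// cmod_gt0.
exfalso; apply: f0; have [C fC] := tf _ ltr01.
apply: (entire_zero_on_reals ef (T := tau + 1) _ fC); first by lra.
by move=> x; apply/eqP; apply: contra_notT nx => h; exists x.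
Qed.

(** Functions with infinite moment give the quotient [+oo]; for the others density and atom are
    compared separately. The atomic hypothesis carries the mass as a factor, so that U at a = 0 is
    covered. *)
Lemma bbA_ge G tau a (K : R) : 0 < tau -> 0 < K ->
  W_atom R G <= W_atom R G * (K * a ^+ 2) ->
  (forall f, paley_wiener tau f ->
     mu.-integrable setT (EFin \o (fun x => (x - a) ^+ 2 * sqmod f x)) ->
     \int[mu]_x (sqmod f x * W_ac G x) <=
     K * \int[mu]_x ((x - a) ^+ 2 * sqmod f x * W_ac G x)) ->
  ((K^-1)%:E <= bbA G tau a)%E.
Proof.
move=> tau0 K0 atomK H; apply: le_ereal_inf_tmp => _ [f [pf f0] <-].
have [ef tf fi] := pf.
have D0 := pw_mass_gt0 G (ltW tau0) pf f0.
rewrite (@W_integral_fin G (sqmod f) (sqmod_ge0 f) fi).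
set D := \int[mu]_x (sqmod f x * W_ac G x).
have A0 : 0 <= W_atom R G * sqmod f 0 by rewrite mulr_ge0 ?W_atom_ge0 ?sqmod_ge0.
have DA : 0 < D + W_atom R G * sqmod f 0 by rewrite ltr_pwDl.
have uE : (fun x => cmod ((x - a)%:C * f x%:C) ^+ 2) = (fun x => (x - a) ^+ 2 * sqmod f x).
  by apply/funext => x; rewrite cmodM exprMn cmod_real real_normK ?num_real.
rewrite uE.
have u0 x : 0 <= (x - a) ^+ 2 * sqmod f x by rewrite mulr_ge0 ?sqr_ge0 ?sqmod_ge0.
rewrite inver gt_eqF//.
have [gi|ngi] := pselect (mu.-integrable setT (EFin \o (fun x => (x - a) ^+ 2 * sqmod f x))).
  rewrite W_integral_fin// -EFinM lee_fin ler_pdivlMr// ler_pdivrMl//.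
  rewrite mulrDr lerD//; first exact: H.
  rewrite sub0r sqrrN.
  have -> : K * (W_atom R G * (a ^+ 2 * sqmod f 0)) =
     W_atom R G * (K * a ^+ 2) * sqmod f 0 by ring.
  by rewrite ler_wpM2r ?sqmod_ge0.
rewrite W_integral_infty//.
  by rewrite gt0_mulye ?leey// lte_fin invr_gt0.
have -> : (fun x => (x - a) ^+ 2 * sqmod f x) = sqmod (fun z => (z - a%:C) * f z).
  by apply/funext => x; rewrite sqmod_affine.
by apply: sqmod_continuous; exact: entire_mul_affine.
Qed.

Theorem bbA_lower_eventually (tau l : R) : 0 < tau -> 0 < l -> l < (pi / (2 * tau)) ^+ 2 ->
  exists M : R, forall G a, M < `|a| -> (l%:E <= bbA G tau a)%E.
Proof.
move=> tau0 l0 hl.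
have hK : (2 * tau / pi) ^+ 2 < l^-1.
  have pp := @pi_gt0 R.
  rewrite -[ltLHS]invrK ltf_pV2 ?posrE ?invr_gt0 ?exprn_gt0 ?divr_gt0 ?mulr_gt0//.
  by rewrite -exprVn invf_div.
have [M HM] := lower_real tau0 hK.
exists M => G a aM; have [Ka Ha] := HM a aM.
rewrite -[l]invrK; apply: bbA_ge => //; first by rewrite invr_gt0.
  by rewrite ler_peMr// W_atom_ge0.
exact: Ha.
Qed.

Theorem bbA_U_lower (tau : R) : 0 < tau ->
  (((pi / (2 * tau)) ^+ 2)%:E <= bbA GU tau 0)%E.
Proof.
move=> tau0; rewrite -[X in X%:E]invrK.
have pp := @pi_gt0 R.
have q0 : 0 < (pi / (2 * tau)) ^+ 2 by rewrite exprn_gt0// divr_gt0// mulr_gt0.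
apply: bbA_ge => //; first by rewrite invr_gt0.
  by rewrite /= mul0r.
move=> f pf gi /=.
under eq_Rintegral do rewrite mulr1.
under [X in _ <= _ * X]eq_Rintegral do rewrite mulr1.
by rewrite -ler_pdivrMl ?invr_gt0// invrK; exact: uncertainty.
Qed.

End LowerBound.

(** * Upper bound *)

Section ExtremalProfile.
Context {R : realType}.
Notation mu := (@lebesgue_measure R).
Implicit Types (x y a b c e t s u v : R) (z w : R[i]) (f g : R[i] -> R[i]) (G : symmetry_group).
Notation Re := (@complex.Re R).
Notation Im := (@complex.Im R).

(** By [phi_mul] this is pi cos u / ((pi/2)^2 - u^2), so at u = pi Delta x it is 4 / pi times the
    extremal function. As a sum of shifted sincs it extends to an entire function without removable
    singularities at +-pi/2. *)
Definition phi u : R := sinc (u + pi / 2) + sinc (u - pi / 2).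

Lemma phi_continuous : continuous phi.
Proof.
have c (k : R) : continuous (fun u : R => sinc (u + k)).
  pose g (u : R) := u + k; change (continuous (fun u => sinc (g u))).
  move=> u; apply: continuous_comp; last exact: sinc_continuous.
  by apply: continuousD; [exact: cvg_id|exact: cst_continuous].
by move=> u; exact: (continuousD (c (pi / 2) u) (c (- (pi / 2)) u)).
Qed.

Lemma phi_cosE u : cos u * phi u =
  sin (u + pi / 2) * sinc (u + pi / 2) - sin (u - pi / 2) * sinc (u - pi / 2).
Proof. by rewrite /phi sinDpihalf sinBpihalf; ring. Qed.

Lemma phi_mul u : (u ^+ 2 - (pi / 2) ^+ 2) * phi u = - pi * cos u.
Proof.
have h1 := sincxE (u + pi / 2); have h2 := sincxE (u - pi / 2).
rewrite sinDpihalf in h1; rewrite sinBpihalf in h2.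
have -> : (u ^+ 2 - (pi / 2) ^+ 2) * phi u =
  (u - pi / 2) * (sinc (u + pi / 2) * (u + pi / 2)) +
  (u + pi / 2) * (sinc (u - pi / 2) * (u - pi / 2)) by rewrite /phi; ring.
by rewrite h1 h2; field.
Qed.

Lemma phi_decay : exists2 A : R, 0 < A & forall u, `|phi u| <= A / (1 + u ^+ 2).
Proof.
have pp := @pi_gt0 R.
exists (pi + (1 + (pi / 2) ^+ 2) * 2).
  by rewrite addr_gt0// mulr_gt0// ltr_pwDl// sqr_ge0.
move=> u; have u0 : 0 < 1 + u ^+ 2 by rewrite ltr_pwDl// sqr_ge0.
rewrite ler_pdivlMr// mulrC -{1}(gtr0_norm u0) -normrM.
(* The first term is -pi cos u by [phi_mul]; the second uses |phi| <= 2. *)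
have -> : (1 + u ^+ 2) * phi u = (u ^+ 2 - (pi / 2) ^+ 2) * phi u + (1 + (pi / 2) ^+ 2) * phi u by ring.
rewrite (le_trans (ler_normD _ _))// phi_mul lerD//.
  by rewrite normrM normrN (gtr0_norm pp) ler_piMr ?(ltW pp)// cos_max.
rewrite normrM ger0_norm; last by rewrite addr_ge0// sqr_ge0.
rewrite ler_wpM2l//; first by rewrite addr_ge0// sqr_ge0.
rewrite (le_trans (ler_normD _ _))//.
by have := sinc_le1 (u + pi / 2); have := sinc_le1 (u - pi / 2); clear; lra.
Qed.

Definition cauchy u : R := (1 + u ^+ 2)^-1.

Lemma cauchy_gt0 u : 0 < cauchy u.
Proof. by rewrite invr_gt0 ltr_pwDl// sqr_ge0. Qed.

Lemma cauchy_le1 u : cauchy u <= 1.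
Proof. by rewrite invf_le1 ?ltr_pwDl ?sqr_ge0// lerDl sqr_ge0. Qed.

Lemma cauchy_continuous : continuous cauchy.
Proof. exact: continuous_oneDsqrV. Qed.

Lemma cauchy_integrable : mu.-integrable setT (EFin \o cauchy).
Proof.
apply/integrableP; split.
  by apply/measurable_EFinP; exact: continuous_measurable_fun cauchy_continuous.
under eq_integral do rewrite /= ger0_norm ?(ltW (cauchy_gt0 _))//.
rewrite (ge0_symfun_integralT (fun u => ltW (cauchy_gt0 u)) cauchy_continuous).
  by rewrite -set_itvcy integral0y_oneDsqr -EFinM ltry.
by move=> x; rewrite /cauchy /= sqrrN.
Qed.

Section Affine.
Variables (tau a : R).
Hypothesis tau0 : 0 < tau.

Let F x := tau * (x - a).

Let dF x : is_derive x 1 F tau.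
Proof.
have d1 : is_derive x 1 (tau \*: (@id R - cst a)) (tau *: (1 - 0)).
  by apply: is_deriveZ; apply: is_deriveB.
rewrite subr0 /GRing.scale/= mulr1 in d1.
by apply: near_eq_is_derive d1; near=> y.
Unshelve. all: by end_near. Qed.

Lemma integral_affine (u : R -> R) : continuous u -> (forall x, 0 <= u x) ->
  (\int[mu]_x (u x)%:E = \int[mu]_x (u (tau * (x - a)) * tau)%:E)%E.
Proof.
move=> cu u0.
have F' : derive1 F = cst tau.
  by apply/funext => x; rewrite derive1E; exact: (@derive_val _ _ _ _ _ _ _ (dF x)).
rewrite (@increasing_ge0_integration_by_substitutionT R F u)//.
- by apply: eq_integral => x _; rewrite F'.
- by move=> x y xy; rewrite /F ltr_pM2l// ltrD2r.
- by rewrite F'; exact: cst_continuous.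
- by rewrite F'; exact: is_cvg_cst.
- by rewrite F'; exact: is_cvg_cst.
- apply/cvgrNyPle => A; near=> x; rewrite /F mulrC -ler_pdivlMr// lerBlDr.
  by near: x; exact: nbhs_ninfty_le (num_real _).
- apply/cvgryPge => A; near=> x; rewrite /F mulrC -ler_pdivrMr// lerBrDr.
  by near: x; exact: nbhs_pinfty_ge (num_real _).
Unshelve. all: by end_near. Qed.

Lemma integrable_affine (u : R -> R) : continuous u -> (forall x, 0 <= u x) ->
  mu.-integrable setT (EFin \o u) ->
  mu.-integrable setT (EFin \o (fun x => u (tau * (x - a)))) /\
  \int[mu]_x u (tau * (x - a)) = tau^-1 * \int[mu]_x u x.
Proof.
move=> cu u0 iu.
have cF : continuous F.
  move=> x; apply: (@differentiable_continuous _ R^o R^o); apply/derivable1_diffP.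
  exact: (@ex_derive _ _ _ _ _ _ _ (dF x)).
have cuF : continuous (fun x => u (F x)).
  by move=> x; apply: continuous_comp; [exact: cF|exact: cu].
have E := integral_affine cu u0.
have i1 : mu.-integrable setT (EFin \o (fun x => u (F x) * tau)).
  apply/integrableP; split.
    apply/measurable_EFinP; apply: measurable_funM => //.
    exact: continuous_measurable_fun.
  move/integrableP : iu => [_]; apply: le_lt_trans.
  under eq_integral do rewrite /= ger0_norm ?mulr_ge0 ?(ltW tau0)//.
  rewrite -E le_eqVlt; apply/orP; left; apply/eqP.
  by apply: eq_integral => x _; rewrite /= ger0_norm.
have i2 : mu.-integrable setT (EFin \o (fun x => u (F x))).
  have := integrable_scale tau^-1 i1.
  rewrite (_ : (fun x => tau^-1 * (u (F x) * tau)) = (fun x => u (F x)))//.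
  by apply/funext => x; rewrite mulrCA mulVf ?mulr1// gt_eqF.
split => //.
have <- : \int[mu]_x (u (F x) * tau) = \int[mu]_x u x.
  by rewrite /Rintegral; exact: (f_equal fine (esym E)).
rewrite (RintegralZr tau measurableT i2) mulrC.
by rewrite mulfK// gt_eqF.
Qed.

End Affine.
End ExtremalProfile.

(** * The extremal function attains the constant *)

Section ExtremalIdentity.
Context {R : realType}.
Notation mu := (@lebesgue_measure R).
Implicit Types (x y a b c e t s u v : R) (z w : R[i]) (f g : R[i] -> R[i]) (G : symmetry_group).
Notation Re := (@complex.Re R).
Notation Im := (@complex.Im R).

Lemma Rintegral_ge0_segments (p : R -> R) (N : nat) : continuous p ->
  mu.-integrable setT (EFin \o p) ->
  (forall n : nat, (N <= n)%N -> 0 <= sintegral p (- n%:R) n%:R) ->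
  0 <= \int[mu]_x p x.
Proof.
move=> cp ip H.
pose I n : set (measurableTypeR R) := `[- n%:R, n%:R]%classic.
have mI n : measurable (I n) by exact: measurable_itv.
have mp := continuous_measurable_fun cp.
have m1 n : measurable_fun [set: measurableTypeR R] (EFin \o (p \_ (I n))).
  apply/measurable_EFinP; apply/(measurable_restrictT _ (mI n)).
  exact: measurable_funS mp.
have m2 : measurable_fun [set: measurableTypeR R] (EFin \o p) by exact/measurable_EFinP.
have c1 : \forall x \ae mu, [set: measurableTypeR R] x ->
    (EFin \o (p \_ (I n))) x @[n --> \oo] --> (EFin \o p) x.
  apply: aeW => x _; apply: cvg_near_cst; near=> n.
  rewrite /= patchE ifT// inE /I /= in_itv/= -ler_norml.
  by near: n; exact: nbhs_infty_ger.
have inp : mu.-integrable setT (EFin \o (fun x => `|p x|)).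
  have := integrable_norm ip; exact.
have d1 : \forall x \ae mu, forall n, [set: measurableTypeR R] x ->
    (`|(EFin \o (p \_ (I n))) x| <= (EFin \o (fun x => `|p x|%R)) x)%E.
  apply: aeW => x n _; rewrite /= lee_fin patchE.
  by case: ifP => _ //; rewrite normr0.
have [_ _ L] := dominated_convergence measurableT m1 m2 c1 inp d1.
have fp : (\int[mu]_x (EFin \o p) x)%E \is a fin_num by exact: integrable_fin_num.
rewrite -(fineK fp) in L.
have L1 : (fun n => \int[mu]_x (p \_ (I n)) x) @ \oo --> \int[mu]_x p x.
  have L1 := fine_cvg L; exact: (L1 _).
apply: (cvgr_to_ge L1); near=> n.
rewrite -Rintegral_mkcond sintegral_Rintegral ?ge0_cp//.
by apply: H; near: n; exact: nbhs_infty_ge.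
Unshelve. all: by end_near. Qed.

(** The odd function sin^2 v / v; cos u phi(u) is the difference of its translates by pi/2 and
    -pi/2. *)
Definition sinsinc v : R := sin v * sinc v.

Lemma sinsinc_continuous : continuous sinsinc.
Proof.
by move=> v; exact: (continuousM (@continuous_sin R v) (@sinc_continuous R v)).
Qed.

Lemma sinsincN v : sinsinc (- v) = - sinsinc v.
Proof. by rewrite /sinsinc sinN sincN mulNr. Qed.

Lemma sinsinc_ge0 v : 0 <= v -> 0 <= sinsinc v.
Proof.
move=> v0; rewrite /sinsinc -[X in X * _]sincxE mulrAC -expr2.
by apply: mulr_ge0 => //; exact: sqr_ge0.
Qed.

Lemma sintegral_odd (s : R -> R) b c : continuous s -> (forall v, s (- v) = - s v) ->
  sintegral s (- c) (- b) = - sintegral s b c.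
Proof.
move=> cs sN.
have dN x : is_derive x 1 (prim s \o -%R) (s x).
  have d1 : is_derive x 1 (prim s \o -%R) (s (- x) * -1).
    by apply: is_derive1_comp; exact: is_derive_prim.
  by rewrite sN mulrN1 opprK in d1.
have := derive_cst_eq dN (is_derive_prim cs) c b.
by rewrite /sintegral /= => ->; lra.
Qed.

Lemma cosphi_continuous : continuous (fun u : R => cos u * phi u).
Proof.
by move=> v; exact: (continuousM (@continuous_cos R v) (@phi_continuous R v)).
Qed.

Lemma sintegral_shift (s : R -> R) k b c : continuous s ->
  sintegral (fun u => s (u + k)) b c = sintegral s (b + k) (c + k).
Proof.
move=> cs; have csk : continuous (fun u : R => s (u + k)).
  pose g (u : R) := u + k; change (continuous (fun u => s (g u))).
  move=> u; apply: continuous_comp; last exact: cs.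
  by apply: continuousD; [exact: cvg_id|exact: cst_continuous].
apply: (@sintegral_FTC R (fun u => prim s (u + k)) _ b c csk) => x.
have d0 : is_derive x 1 (@id R + cst k) (1 + 0) by exact: is_deriveD.
have := @is_derive1_comp R (prim s) (@id R + cst k) x _ _ (is_derive_prim cs _) d0.
by rewrite addr0 mulr1 => H; exact: H.
Qed.

(* By oddness of sin^2 v / v the integral reduces to twice the one over
   [n - pi/2, n + pi/2]. *)
Lemma cosphi_sintegral_ge0 (n : nat) : (2 <= n)%N -> 0 <= sintegral (fun u : R => cos u * phi u) (- n%:R) n%:R.
Proof.
(* As n >= 2 >= pi/2, the interval [n - pi/2, n + pi/2] lies where sin^2 v / v >= 0. *)
move=> n2; have n2' : 2 <= n%:R :> R by rewrite ler_nat.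
have pp := @pi_gt0 R; have p2 : pi / 2 <= 2 :> R by have := @pihalf_02 R; lra.
have cc k : continuous (fun u : R => sinsinc (u + k)).
  pose g (u : R) := u + k; change (continuous (fun u => sinsinc (g u))).
  move=> u; apply: continuous_comp; last exact: sinsinc_continuous.
  by apply: continuousD; [exact: cvg_id|exact: cst_continuous].
have -> : (fun u : R => cos u * phi u) =
    (fun u => sinsinc (u + pi / 2) - sinsinc (u + - (pi / 2))).
  by apply/funext => u; rewrite phi_cosE.
rewrite (sintegralB _ _ (cc _) (cc _)) !(sintegral_shift _ _ _ sinsinc_continuous).
have -> : - n%:R - pi / 2 = - (n%:R + pi / 2) :> R by ring.
have -> : - n%:R + pi / 2 = - (n%:R - pi / 2) :> R by ring.
have := sintegral_chasles sinsinc (- (n%:R - pi / 2)) (n%:R - pi / 2) (n%:R + pi / 2).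
have := sintegral_chasles sinsinc (- (n%:R + pi / 2)) (- (n%:R - pi / 2)) (n%:R - pi / 2).
rewrite (sintegral_odd _ _ sinsinc_continuous sinsincN).
have : 0 <= sintegral sinsinc (n%:R - pi / 2) (n%:R + pi / 2).
  rewrite -sintegral_Rintegral; [|exact: sinsinc_continuous|lra].
  apply: Rintegral_ge0 => x; rewrite /= in_itv/= => /andP[h _].
  by apply: sinsinc_ge0; lra.
do !move: (sintegral _ _ _) => ?; clear; lra.
Qed.

Lemma phi_sq_bounds : exists2 A : R, 0 < A & forall u,
  (phi u ^+ 2 <= A * cauchy u) /\ (u ^+ 2 * phi u ^+ 2 <= A * cauchy u).
Proof.
have [A A0 HA] := @phi_decay R; exists (A ^+ 2); first by rewrite exprn_gt0.
move=> u; have q0 : 0 < 1 + u ^+ 2 by rewrite ltr_pwDl// sqr_ge0.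
have h : phi u ^+ 2 <= A ^+ 2 * cauchy u * cauchy u.
  rewrite -real_normK ?num_real//.
  have -> : A ^+ 2 * cauchy u * cauchy u = (A / (1 + u ^+ 2)) ^+ 2 by rewrite /cauchy; ring.
  by rewrite lerXn2r ?nnegrE// divr_ge0// ltW.
have c0 := @cauchy_gt0 R u; have B0 : 0 <= A ^+ 2 * cauchy u by rewrite mulr_ge0 ?sqr_ge0// ltW.
split; first by rewrite (le_trans h)// ler_piMr// cauchy_le1.
rewrite (le_trans (ler_wpM2l (sqr_ge0 u) h))// mulrCA ler_piMr//.
by rewrite /cauchy ler_pdivrMr// mul1r lerDr.
Qed.

Lemma phi_sq_continuous : continuous (fun u : R => phi u ^+ 2).
Proof. by move=> u; exact: (continuousM (@phi_continuous R u) (@phi_continuous R u)). Qed.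

Lemma sq_phi_sq_continuous : continuous (fun u : R => u ^+ 2 * phi u ^+ 2).
Proof.
have cg : continuous (fun u : R => u * phi u).
  by move=> u; apply: continuousM; [exact: cvg_id|exact: phi_continuous].
have -> : (fun u : R => u ^+ 2 * phi u ^+ 2) = (fun u => (u * phi u) * (u * phi u)).
  by apply/funext => u; rewrite -expr2 exprMn.
by move=> u; exact: (continuousM (cg u) (cg u)).
Qed.

Lemma phi_sq_integrable : mu.-integrable setT (EFin \o (fun u => phi u ^+ 2)).
Proof.
have [A A0 HA] := phi_sq_bounds.
apply: (integrable_le _ _ (integrable_scale A cauchy_integrable)) => [|u].
  exact: continuous_measurable_fun phi_sq_continuous.
by rewrite ger0_norm ?sqr_ge0//; case: (HA u).
Qed.

Lemma sq_phi_sq_integrable : mu.-integrable setT (EFin \o (fun u => u ^+ 2 * phi u ^+ 2)).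
Proof.
have [A A0 HA] := phi_sq_bounds.
apply: (integrable_le _ _ (integrable_scale A cauchy_integrable)) => [|u].
  exact: continuous_measurable_fun sq_phi_sq_continuous.
have h : 0 <= u ^+ 2 * phi u ^+ 2 := mulr_ge0 (sqr_ge0 _) (sqr_ge0 _).
by rewrite ger0_norm//; case: (HA u).
Qed.

(** By [phi_mul], ((pi/2)^2 - u^2) phi^2 = pi cos u phi, whose integrals over [-n, n] are
    nonnegative for n >= 2. *)
Lemma phi_extremal :
  \int[mu]_u (u ^+ 2 * phi u ^+ 2) <= (pi / 2) ^+ 2 * \int[mu]_u (phi u ^+ 2).
Proof.
have pp := @pi_gt0 R.
have hE u : (pi / 2) ^+ 2 * phi u ^+ 2 - u ^+ 2 * phi u ^+ 2 = pi * (cos u * phi u).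
  transitivity (- ((u ^+ 2 - (pi / 2) ^+ 2) * phi u * phi u)); first by ring.
  by rewrite phi_mul; ring.
have i1 := integrable_scale ((pi / 2) ^+ 2) phi_sq_integrable.
have i2 := sq_phi_sq_integrable.
have ic : mu.-integrable setT (EFin \o (fun u : R => cos u * phi u)).
  have := integrable_scale pi^-1 (integrable_add i1 (integrable_scale (-1) i2)).
  rewrite (_ : (fun x => _) = (fun u : R => cos u * phi u))//.
  by apply/funext => u; rewrite mulN1r hE mulrA mulVf ?mul1r// gt_eqF.
rewrite -subr_ge0 -(RintegralZl _ measurableT phi_sq_integrable) -RintegralB//.
under eq_Rintegral do rewrite hE.
rewrite RintegralZl// mulr_ge0 ?(ltW pp)//.
exact: (Rintegral_ge0_segments cosphi_continuous ic cosphi_sintegral_ge0).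
Qed.

End ExtremalIdentity.

(** * Test functions and upper bounds *)

Section UpperBound.
Context {R : realType}.
Notation mu := (@lebesgue_measure R).
Implicit Types (x y a b c e t s u v : R) (z w : R[i]) (f g : R[i] -> R[i]) (G : symmetry_group).
Notation Re := (@complex.Re R).
Notation Im := (@complex.Im R).

Lemma bbA_le G tau a (l : R) f : 0 <= tau -> paley_wiener tau f -> f <> cst 0 ->
  mu.-integrable setT (EFin \o (fun x => (x - a) ^+ 2 * sqmod f x)) ->
  \int[mu]_x ((x - a) ^+ 2 * sqmod f x * W_ac G x) + W_atom R G * (a ^+ 2 * sqmod f 0)
  <= l * (\int[mu]_x (sqmod f x * W_ac G x) + W_atom R G * sqmod f 0) ->
  (bbA G tau a <= l%:E)%E.
Proof.
move=> tau0 pf f0 gi H; have [ef tf fi] := pf.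
apply: ge_ereal_inf; eexists; first by exists f.
have D0 := pw_mass_gt0 G tau0 pf f0.
rewrite (@W_integral_fin _ G (sqmod f) (sqmod_ge0 f) fi).
have A0 : 0 <= W_atom R G * sqmod f 0 by rewrite mulr_ge0 ?W_atom_ge0 ?sqmod_ge0.
have DA : 0 < \int[mu]_x (sqmod f x * W_ac G x) + W_atom R G * sqmod f 0.
  by rewrite ltr_pwDl.
have uE : (fun x => cmod ((x - a)%:C * f x%:C) ^+ 2) = (fun x => (x - a) ^+ 2 * sqmod f x).
  by apply/funext => x; rewrite cmodM exprMn cmod_real real_normK ?num_real.
rewrite uE W_integral_fin//; last by move=> x; rewrite mulr_ge0 ?sqr_ge0 ?sqmod_ge0.
by rewrite inver gt_eqF// -EFinM lee_fin ler_pdivrMr// sub0r sqrrN.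
Qed.

Definition extremal (tau a : R) z : R[i] :=
  csinc (tau%:C * (z - a%:C) + (pi / 2)%:C) + csinc (tau%:C * (z - a%:C) - (pi / 2)%:C).

Lemma sqmod_extremal tau a x : sqmod (extremal tau a) x = phi (tau * (x - a)) ^+ 2.
Proof.
rewrite /sqmod /extremal -rmorphB/= -rmorphM/= -rmorphD/= -rmorphB/= !csinc_real.
by rewrite -rmorphD/= cmod_real real_normK ?num_real.
Qed.

Lemma phi0_gt0 : 0 < phi (0 : R).
Proof.
have pp := @pi_gt0 R; have p2 : 0 < pi / 2 :> R by rewrite divr_gt0.
rewrite /phi add0r sub0r sincN -mulr2n mulrn_wgt0// /sinc gt_eqF//.
by rewrite sin_pihalf divr_gt0.
Qed.

Lemma extremal_neq0 tau a : extremal tau a <> cst 0.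
Proof.
move=> E; have := sqmod_extremal tau a a; rewrite E /sqmod cmod0 expr0n subrr mulr0 => /esym/eqP.
by rewrite sqrf_eq0 gt_eqF// phi0_gt0.
Qed.

Lemma entire_extremal tau a : entire (extremal tau a).
Proof.
have e1 : entire (fun z : R[i] => z - a%:C) :=
  @entireD R id (fun=> - a%:C) (@entire_id R) (entire_cst _).
have e2 : entire (fun z : R[i] => tau%:C * (z - a%:C)) := entireM (entire_cst _) e1.
have e3 (k : R[i]) : entire (fun z : R[i] => tau%:C * (z - a%:C) + k) :=
  @entireD R _ (fun=> k) e2 (entire_cst _).
have e4 (k : R[i]) : entire (fun z : R[i] => csinc (tau%:C * (z - a%:C) + k)) :=
  entire_comp entire_csinc (e3 k).
exact: (entireD (e4 (pi / 2)%:C) (e4 (- (pi / 2)%:C))).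
Qed.

Lemma exp_type_extremal tau a : 0 <= tau -> exp_type_le tau (extremal tau a).
Proof.
move=> tau0 e e0; pose k := tau * `|a| + pi / 2.
have pp := @pi_gt0 R; have p2 : 0 < pi / 2 :> R by rewrite divr_gt0.
exists (42 * expR k) => z.
have B (q : R[i]) : cmod q = pi / 2 ->
    cmod (csinc (tau%:C * (z - a%:C) + q)) <= 21 * expR k * expR ((tau + e) * cmod z).
  move=> hq; rewrite (le_trans (cmod_csinc _))// -mulrA ler_wpM2l// -expRD ler_expR.
  rewrite (le_trans (cmodD _ _))// hq cmodM cmod_real (ger0_norm tau0) /k.
  have : tau * cmod (z - a%:C) <= tau * (cmod z + `|a|).
    by rewrite ler_wpM2l// (le_trans (cmodB _ _))// cmod_real.
  have : 0 <= e * cmod z by rewrite mulr_ge0 ?cmod_ge0// ltW.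
  by rewrite mulrDl mulrDr; clear; lra.
have b1 := B (pi / 2)%:C; have b2 := B (- (pi / 2)%:C).
rewrite cmod_real gtr0_norm// in b1; rewrite cmodN cmod_real gtr0_norm// in b2.
rewrite (le_trans (cmodD _ _))//.
by move: (b1 erefl) (b2 erefl); clear; lra.
Qed.

Section Fix.
Variables (tau a : R).
Hypothesis tau0 : 0 < tau.
Let f := extremal tau a.

Lemma extremal_sq_integrable : mu.-integrable setT (EFin \o sqmod f) /\
  \int[mu]_x sqmod f x = tau^-1 * \int[mu]_u (phi u ^+ 2).
Proof.
have [i1 i2] := integrable_affine a tau0 phi_sq_continuous (fun u => sqr_ge0 (phi u))
  phi_sq_integrable.
by rewrite (_ : sqmod f = (fun x => phi (tau * (x - a)) ^+ 2))//;
  apply/funext => x; exact: sqmod_extremal.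
Qed.

Lemma extremal_sqE x : (x - a) ^+ 2 * sqmod f x =
  tau^-2 * ((tau * (x - a)) ^+ 2 * phi (tau * (x - a)) ^+ 2).
Proof.
by rewrite sqmod_extremal; field; rewrite gt_eqF.
Qed.

Lemma extremal_moment_integrable :
  mu.-integrable setT (EFin \o (fun x => (x - a) ^+ 2 * sqmod f x)) /\
  \int[mu]_x ((x - a) ^+ 2 * sqmod f x) = tau^-2 * (tau^-1 * \int[mu]_u (u ^+ 2 * phi u ^+ 2)).
Proof.
have [i1 i2] := integrable_affine a tau0 sq_phi_sq_continuous
  (fun u => mulr_ge0 (sqr_ge0 u) (sqr_ge0 (phi u))) sq_phi_sq_integrable.
have E : (fun x => (x - a) ^+ 2 * sqmod f x) =
    (fun x => tau^-2 * ((tau * (x - a)) ^+ 2 * phi (tau * (x - a)) ^+ 2)).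
  by apply/funext => x; exact: extremal_sqE.
rewrite E; split; first exact: integrable_scale.
by rewrite RintegralZl// i2.
Qed.

Lemma extremal_pw : paley_wiener tau f.
Proof.
split; [exact: entire_extremal|by apply: exp_type_extremal; exact: ltW|].
exact: extremal_sq_integrable.1.
Qed.

Lemma extremal_moment_le :
  \int[mu]_x ((x - a) ^+ 2 * sqmod f x) <= (pi / (2 * tau)) ^+ 2 * \int[mu]_x sqmod f x.
Proof.
rewrite extremal_moment_integrable.2 extremal_sq_integrable.2.
have -> : (pi / (2 * tau)) ^+ 2 * (tau^-1 * \int[mu]_u (phi u ^+ 2)) =
  tau^-2 * (tau^-1 * ((pi / 2) ^+ 2 * \int[mu]_u (phi u ^+ 2))).
  by field; rewrite gt_eqF.
by rewrite ler_wpM2l ?invr_ge0 ?sqr_ge0// ler_wpM2l ?invr_ge0 ?(ltW tau0)//; exact: phi_extremal.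
Qed.

End Fix.

Theorem bbA_U_upper (tau : R) : 0 < tau -> (bbA GU tau 0 <= ((pi / (2 * tau)) ^+ 2)%:E)%E.
Proof.
move=> tau0.
have pf := extremal_pw 0 tau0; have nf := @extremal_neq0 tau 0.
have mf := (extremal_moment_integrable 0 tau0).1.
apply: (@bbA_le GU tau 0 _ _ (ltW tau0) pf nf mf).
rewrite /= !mul0r !addr0.
under eq_Rintegral do rewrite mulr1.
under [X in _ <= _ * X]eq_Rintegral do rewrite mulr1.
exact: extremal_moment_le.
Qed.

(** A Peetre-type inequality, 1 + a^2 <= 2 (1 + (x - a)^2) (1 + x^2); the factor [k] passes from
    scale tau to scale 1. *)
Lemma shifted_cauchy_decay (tau : R) : 0 < tau -> exists2 K : R, 0 < K &
  forall a x, cauchy (tau * (x - a)) * cauchy x <= K * cauchy a.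
Proof.
move=> tau0; pose k := 1 + tau^-2.
have k0 : 0 < k by rewrite /k ltr_pwDl// invr_ge0 sqr_ge0.
exists (2 * k); first by rewrite mulr_gt0.
move=> a x; rewrite /cauchy -invfM.
have p1 u : 0 < 1 + u ^+ 2 :> R by rewrite ltr_pwDl// sqr_ge0.
rewrite ler_pdivlMr// mulrC ler_pdivrMr ?mulr_gt0//.
have h1 : 1 + (x - a) ^+ 2 <= k * (1 + (tau * (x - a)) ^+ 2).
  have -> : k * (1 + (tau * (x - a)) ^+ 2) =
    1 + (x - a) ^+ 2 + (tau^-2 + (tau * (x - a)) ^+ 2) by rewrite /k; field; rewrite gt_eqF.
  by rewrite lerDl addr_ge0 ?invr_ge0 ?sqr_ge0.
have h2 : 1 + a ^+ 2 <= 2 * (1 + (x - a) ^+ 2) * (1 + x ^+ 2).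
  have -> : 2 * (1 + (x - a) ^+ 2) * (1 + x ^+ 2) =
    1 + a ^+ 2 + (1 + (2 * x - a) ^+ 2 + 2 * ((x - a) * x) ^+ 2) by ring.
  by have := sqr_ge0 (2 * x - a); have := sqr_ge0 ((x - a) * x); rewrite lerDl; clear; lra.
rewrite (le_trans h2)//.
have -> : 2 * k * ((1 + (tau * (x - a)) ^+ 2) * (1 + x ^+ 2)) =
  2 * (k * (1 + (tau * (x - a)) ^+ 2)) * (1 + x ^+ 2) by ring.
by rewrite ler_wpM2r ?(ltW (p1 _))// ler_wpM2l.
Qed.

(* |W - 1| <= d1 + B (1 + x^2)^-2, and the second term is handled by
   shifted_cauchy_decay. *)
Lemma weight_defect (tau d : R) : 0 < tau -> 0 < d -> exists M : R, forall G a, M < `|a| ->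
  mu.-integrable setT (EFin \o (fun x => cauchy (tau * (x - a)) * `|W_ac G x - 1|)) /\
  (\int[mu]_x (cauchy (tau * (x - a)) * `|W_ac G x - 1|) <= d /\
   cauchy (tau * a) <= d).
Proof.
move=> tau0 d0; pose J := \int[mu]_u @cauchy R u.
have J0 : 0 <= J by apply: Rintegral_ge0 => x _; exact/ltW/cauchy_gt0.
pose d1 := d / 2 / (J / tau + 1).
have Jt0 : 0 <= J / tau by rewrite divr_ge0// ltW.
have Jt1 : 0 < J / tau + 1 by rewrite ltr_wpDl.
have d20 : 0 < d / 2 by rewrite divr_gt0.
have d10 : 0 < d1 by rewrite divr_gt0.
have [X X0 HX] := W_ac_far d10.
have [K K0 HK] := shifted_cauchy_decay tau0.
(* On |x| < X this makes B (1 + x^2)^(-2) >= 1 >= |W - 1|. Of the two Cauchy factors one gives decay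
   in a, the other integrability in x. *)
pose B := (1 + X ^+ 2) ^+ 2; have B0 : 0 <= B by exact: sqr_ge0.
(* Through cauchy a <= 1 / |a|, the first summand brings the contribution of |x| < X below d / 2,
   the second brings cauchy (tau a) below d. *)
pose Q := B * (K * J) / (d / 2) + K / d.
have Q0 : 0 <= Q.
  apply: addr_ge0; last by rewrite divr_ge0// ltW.
  by rewrite divr_ge0 ?(ltW d20)// mulr_ge0// mulr_ge0// ltW.
exists (Q + 1) => G a aQ.
have a1 : 1 <= `|a| by rewrite (le_trans _ (ltW aQ))// lerDr.
have ca : cauchy a <= `|a|^-1.
  rewrite /cauchy lef_pV2 ?posrE ?ltr_pwDl ?sqr_ge0//; last exact: lt_le_trans a1.
  rewrite -real_normK ?num_real// ler_wpDl// expr2 ler_peMl//.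
have aQ' : Q <= `|a| by rewrite (le_trans _ (ltW aQ))// lerDl.
have a0 : 0 < `|a| by exact: lt_le_trans a1.
have [ip Ep] := integrable_affine a tau0 cauchy_continuous
  (fun u => ltW (cauchy_gt0 u)) cauchy_integrable.
have iW : mu.-integrable setT (EFin \o (fun x => cauchy (tau * (x - a)) * `|W_ac G x - 1|)).
  apply: (integrable_le _ _ ip) => [|x].
    apply: measurable_funM; first exact: integrable_measurable ip.
    apply: measurableT_comp => //.
    by apply: measurable_funB => //; exact: W_ac_measurable.
  have c0 := ltW (cauchy_gt0 (tau * (x - a))).
  rewrite normrM normr_id (ger0_norm c0) ler_piMr//.
  exact: le_trans (W_acB1 G x) (sinc2pi_le1 x).
split => //; split; last first.
  have := HK a 0; rewrite /cauchy expr0n/= addr0 invr1 mulr1 sub0r mulrN sqrrN => h.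
  rewrite (le_trans h)// (le_trans (ler_wpM2l (ltW K0) ca))//.
  rewrite ler_pdivrMr// mulrC -ler_pdivrMr// (le_trans _ aQ')// /Q lerDr.
  by rewrite divr_ge0 ?(ltW d20)// mulr_ge0// mulr_ge0// ltW.
have -> : d = d / 2 + d / 2 by field.
have iB : mu.-integrable setT (EFin \o (fun x => B * (K * cauchy a) * cauchy x)).
  exact: integrable_scale cauchy_integrable.
apply: (@le_trans _ _ (d1 * \int[mu]_x cauchy (tau * (x - a)) +
   B * (K * cauchy a) * \int[mu]_x (cauchy x))); last first.
  apply: lerD.
    rewrite Ep -/J /d1.
    have -> : d / 2 / (J / tau + 1) * (tau^-1 * J) = d / 2 * (J / tau / (J / tau + 1)).
      by rewrite (mulrC tau^-1); ring.
    by rewrite ler_piMr ?(ltW d20)// ler_pdivrMr// mul1r lerDl.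
  rewrite -/J (_ : _ * J = B * (K * J) * cauchy a); last by ring.
  have BKJ : 0 <= B * (K * J) by rewrite mulr_ge0// mulr_ge0// ltW.
  rewrite (le_trans (ler_wpM2l BKJ ca))// ler_pdivrMr// (mulrC (d / 2)) -ler_pdivrMr//.
  by rewrite (le_trans _ aQ')// /Q lerDl divr_ge0// ltW.
rewrite -(RintegralZl d1 measurableT ip) -(RintegralZl _ measurableT cauchy_integrable).
have id1 := integrable_scale d1 ip.
rewrite -RintegralD//; apply: le_Rintegral => //; first exact: integrable_add.
move=> x _; set p := cauchy (tau * (x - a)).
have p0 : 0 < p by exact: cauchy_gt0.
have q0 := @cauchy_gt0 R x; have qa0 := @cauchy_gt0 R a.
have [xX|xX] := leP X `|x|.
  rewrite ler_wpDr//.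
    by rewrite mulr_ge0 ?(ltW q0)// mulr_ge0// mulr_ge0 ?(ltW K0)// ltW.
  by rewrite mulrC ler_wpM2r ?(ltW p0)//; exact: HX.
rewrite ler_wpDl//; first by rewrite mulr_ge0 ?(ltW p0)// ltW.
have W1 : `|W_ac G x - 1| <= 1 := le_trans (W_acB1 G x) (sinc2pi_le1 x).
rewrite (le_trans (ler_wpM2l (ltW p0) W1))// mulr1.
have qB : 1 <= B * cauchy x * cauchy x.
  have -> : B * cauchy x * cauchy x = ((1 + X ^+ 2) * cauchy x) ^+ 2 by rewrite /B; ring.
  rewrite exprn_ege1// /cauchy ler_pdivlMr ?ltr_pwDl ?sqr_ge0// mul1r lerD2l.
  by rewrite -[leLHS]real_normK ?num_real// lerXn2r ?nnegrE ?(ltW X0)// ltW.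
rewrite (@le_trans _ _ (p * (B * cauchy x * cauchy x)))//.
  by rewrite ler_peMr// ltW.
have -> : p * (B * cauchy x * cauchy x) = B * (p * cauchy x) * cauchy x by ring.
rewrite ler_wpM2r ?(ltW q0)// ler_wpM2l//; exact: HK.
Qed.

(** Tested on the extremal function centred at [a]: both |f|^2 and (x - a)^2 |f|^2 are dominated by
    cauchy (tau (x - a)), so [weight_defect] controls the change of both integrals, and also the
    atomic term a^2 |f(0)|^2. *)
Theorem bbA_upper_eventually (tau l : R) : 0 < tau -> (pi / (2 * tau)) ^+ 2 < l ->
  exists M : R, forall G a, M < `|a| -> (bbA G tau a <= l%:E)%E.
Proof.
move=> tau0 hl; pose l0 := (pi / (2 * tau)) ^+ 2.
have l00 : 0 <= l0 by exact: sqr_ge0.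
have lp : 0 < l by exact: le_lt_trans hl.
pose m := tau^-1 * \int[mu]_u (phi u ^+ 2).
have m0 : 0 < m.
  rewrite mulr_gt0 ?invr_gt0//.
  apply: (@continuous_Rintegral_gt0 _ _ 0) => //.
  - exact: phi_sq_continuous.
  - by move=> u; exact: sqr_ge0.
  - exact: phi_sq_integrable.
  - by rewrite exprn_gt0// phi0_gt0.
have [A A0 HA] := @phi_sq_bounds R.
(* The numerator error enters twice, once for the density and once for the atom; the denominator
   error is multiplied by l. The choice of [d] below makes the total equal to the gap (l - l0) m. *)
pose C := A * (2 * tau^-2 + l).
have t20 : 0 < tau^-2 by rewrite invr_gt0 exprn_gt0.
have C0 : 0 < C by rewrite mulr_gt0// addr_gt0// mulr_gt0.
have d0 : 0 < (l - l0) * m / C by rewrite divr_gt0// mulr_gt0// subr_gt0.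
have [M HM] := weight_defect tau0 d0.
exists M => G a /(HM G) [iE [E1 E2]].
set d := _ / C in E1 E2; set Ea := \int[mu]_x _ in E1.
have [if1 if2] := extremal_sq_integrable a tau0.
have [iu1 iu2] := extremal_moment_integrable a tau0.
have ml := extremal_moment_le a tau0; rewrite -/l0 in ml.
have pf := extremal_pw a tau0; have nf := @extremal_neq0 tau a.
apply: (@bbA_le G tau a _ _ (ltW tau0) pf nf iu1).
set f := extremal tau a in if1 if2 iu1 iu2 ml *.
have Wd x : `|W_ac G x - 1| = `|1 - W_ac G x| by rewrite distrC.
have fb x : sqmod f x <= A * cauchy (tau * (x - a)).
  by rewrite /f sqmod_extremal; case: (HA (tau * (x - a))).
have ub x : (x - a) ^+ 2 * sqmod f x <= tau^-2 * A * cauchy (tau * (x - a)).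
  rewrite /f extremal_sqE// -mulrA ler_wpM2l ?(ltW t20)//.
  by case: (HA (tau * (x - a))).
have iA k : mu.-integrable setT (EFin \o (fun x => k * (cauchy (tau * (x - a)) * `|W_ac G x - 1|))).
  exact: integrable_scale iE.
have N1 : \int[mu]_x ((x - a) ^+ 2 * sqmod f x * W_ac G x) <=
    \int[mu]_x ((x - a) ^+ 2 * sqmod f x) + tau^-2 * A * Ea.
  rewrite -(RintegralZl _ measurableT iE) -RintegralD//.
  apply: le_Rintegral => //.
  - by apply: integrable_mulW => // x; rewrite mulr_ge0 ?sqr_ge0 ?sqmod_ge0.
  - exact: integrable_add.
  move=> x _; have u0 : 0 <= (x - a) ^+ 2 * sqmod f x by rewrite mulr_ge0 ?sqr_ge0 ?sqmod_ge0.
  rewrite -lerBlDl mulrA.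
  have -> : (x - a) ^+ 2 * sqmod f x * W_ac G x - (x - a) ^+ 2 * sqmod f x =
     (x - a) ^+ 2 * sqmod f x * (W_ac G x - 1) by ring.
  rewrite (@le_trans _ _ ((x - a) ^+ 2 * sqmod f x * `|W_ac G x - 1|))//.
    by rewrite ler_wpM2l// ler_norm.
  by rewrite ler_wpM2r.
have D1 : \int[mu]_x (sqmod f x) <= \int[mu]_x (sqmod f x * W_ac G x) + A * Ea.
  rewrite -(RintegralZl _ measurableT iE) -RintegralD//; last first.
    by apply: integrable_mulW => // x; exact: sqmod_ge0.
  apply: le_Rintegral => //.
    by apply: integrable_add => //; apply: integrable_mulW => // x; exact: sqmod_ge0.
  move=> x _; have f0 := sqmod_ge0 f x.
  rewrite -lerBlDl mulrA.
  have -> : sqmod f x - sqmod f x * W_ac G x = sqmod f x * (1 - W_ac G x) by ring.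
  rewrite (@le_trans _ _ (sqmod f x * `|W_ac G x - 1|))//.
    by rewrite ler_wpM2l// Wd ler_norm.
  by rewrite ler_wpM2r.
have at0 := @W_atom_ge0 R G; have at1 := @W_atom_le1 R G.
have P1 : W_atom R G * (a ^+ 2 * sqmod f 0) <= tau^-2 * A * d.
  have := ub 0; rewrite sub0r sqrrN => h.
  have q0 : 0 <= a ^+ 2 * sqmod f 0 by rewrite mulr_ge0 ?sqr_ge0 ?sqmod_ge0.
  rewrite (@le_trans _ _ (a ^+ 2 * sqmod f 0))//; first by rewrite ler_piMl.
  rewrite (le_trans h)// ler_wpM2l//; first by rewrite mulr_ge0 ?(ltW t20)// ltW.
  by move: E2; rewrite /cauchy mulrN sqrrN.
have P2 : 0 <= l * (W_atom R G * sqmod f 0).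
  by rewrite mulr_ge0 ?(ltW lp)// mulr_ge0 ?sqmod_ge0.
rewrite if2 -/m in D1 ml.
have key : 2 * (tau^-2 * A * d) + l * (A * d) = (l - l0) * m.
  rewrite /d /C; field; rewrite !gt_eqF//=.
  by rewrite addr_gt0// mulr_gt0// exprn_gt0.
have e1 : tau^-2 * A * Ea <= tau^-2 * A * d.
  by rewrite ler_wpM2l// mulr_ge0 ?(ltW t20)// ltW.
have e2 : l * (A * Ea) <= l * (A * d).
  by rewrite ler_wpM2l ?(ltW lp)// ler_wpM2l// ltW.
have D2 := ler_wpM2l (ltW lp) D1.
rewrite mulrDr; move: N1 ml P1 P2 key e1 e2 D2; rewrite [l * (_ + A * Ea)]mulrDr mulrBl.
do 3 (move: (\int[mu]_x _) => ?).
lra.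
Qed.

End UpperBound.

(** * The limit *)

Lemma near_abs_infty (R : realType) (P : R -> Prop) (M : R) :
  (forall a, M < `|a| -> P a) -> \forall a \near abs_infty R, P a.
Proof. by move=> MP; exists M => // a /= /MP. Qed.

Theorem theorem3 (R : realType) (Delta : R) (hDelta : 0 < Delta)
    (G : symmetry_group) :
  bbA G (pi * Delta) alpha @[alpha --> abs_infty R] --> bbA GU (pi * Delta) 0
  /\ bbA GU (pi * Delta) 0 = (1 / (4 * Delta ^+ 2))%:E.
Proof.
have pp := @pi_gt0 R; have tau0 : 0 < pi * Delta by rewrite mulr_gt0.
have LE : (pi / (2 * (pi * Delta))) ^+ 2 = 1 / (4 * Delta ^+ 2).
  by move: (pi : R) pp => q q0; field; rewrite (gt_eqF q0) (gt_eqF hDelta).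
have E : bbA GU (pi * Delta) 0 = (1 / (4 * Delta ^+ 2))%:E.
  by rewrite -LE; apply/le_anti; rewrite bbA_U_upper ?bbA_U_lower.
split => //; rewrite E.
set L := 1 / (4 * Delta ^+ 2) in LE *.
have L0 : 0 < L by rewrite divr_gt0// mulr_gt0// exprn_gt0.
have two_sided (e : R) : 0 < e -> \forall a \near abs_infty R,
    ((L - e)%:E <= bbA G (pi * Delta) a /\ bbA G (pi * Delta) a <= (L + e)%:E)%E.
  move=> e0.
  have Le : L < L + e by rewrite ltrDl.
  (* The lower level must be positive, hence the maximum with L / 2 when e is large. *)
  have m0 : 0 < Num.max (L / 2) (L - e) by rewrite lt_max divr_gt0.
  have mL : Num.max (L / 2) (L - e) < L.
    by rewrite gt_max ltrBlDr Le andbT ltr_pdivrMr// ltr_pMr// ltr1n.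
  rewrite -[X in X < _]LE in Le; rewrite -[X in _ < X]LE in mL.
  have [M1 H1] := bbA_lower_eventually tau0 m0 mL.
  have [M2 H2] := bbA_upper_eventually tau0 Le.
  apply: (@near_abs_infty _ _ (Num.max M1 M2)) => a; rewrite gt_max => /andP[a1 a2].
  split; last exact: H2.
  by apply: le_trans (H1 G a a1); rewrite lee_fin le_max lexx orbT.
(* The infimum is an extended real; the two-sided bound with e = 1 makes it finite for large
   |alpha|. *)
apply/fine_cvgP; split.
  apply: filterS (two_sided 1 ltr01) => a [h1 h2].
  rewrite fin_numE; apply/andP; split; apply/eqP => h.
    by rewrite h leeNy_eq in h1.
  by rewrite h leye_eq in h2.
apply/cvgrPdist_le => /= e e0; apply: filterS (two_sided e e0) => a.
case: (bbA G (pi * Delta) a) => [r| |] /=; rewrite ?lee_fin.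
- by move=> [h1 h2]; rewrite ler_norml; apply/andP; split; lra.
- by move=> [_]; rewrite leye_eq.
- by move=> []; rewrite leeNy_eq.
Qed.
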